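(* Let $k\ge2$, let $f$ be a good piecewise expanding $C^k$ unimodal map, and let $v,w\in\mathcal B^k(I)$ satisfy $v(-1)=v(1)=w(-1)=w(1)=0$, $J(f,v)=0$ and $J(f,w)\neq0$. Then for every $C^k$ family $t\mapsto f_t$ of piecewise expanding $C^k$ unimodal maps with $f_0=f$ and $\partial_tf_t|_{t=0}=v$, there exist $\delta>0$ and a unique continuous function $b:(-\delta,\delta)\to\mathbb R$ with $b(0)=0$ such that $\tilde f_t=f_t+b(t)w$ is topologically conjugate with $f$ for all $|t|<\delta$. Furthermore, this unique $b$ is $C^{k-1+\mathrm{Lip}}$ and satisfies $b'(0)=0$ (so $\partial_t\tilde f_t|_{t=0}=v$), and $t\mapsto\tilde f_t$ is a $C^{k-1+\mathrm{Lip}}$ family of piecewise expanding $C^k$ unimodal maps. In addition, there exists a sequence of $C^k$ families $t\mapsto g_{t,n}$, $t\in(-\delta,\delta)$, of piecewise expanding $C^k$ unimodal maps such that: $g_{t,n}$ is topologically conjugate with $g_{0,n}$ for each $t$ and $n$; the critical point of $g_{0,n}$ is periodic for each $n$; and for each $t$, $g_{t,n}\to\tilde f_t$ in the $\mathcal B^{k-1}(I)$ topology as $n\to\infty$.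
   Context: Let $I=[-1,1]$ and $c=0$ (the critical point). For an integer $k\ge0$, $\mathcal B^k(I)$ is the Banach space of continuous $f:I\to\mathbb R$ that are $C^k$ on $[-1,0]$ and on $[0,1]$ (one-sided derivatives at endpoints) with $f(1)=f(-1)$, with norm $|f|_k=\max\{|f|_{C^k[-1,0]},|f|_{C^k[0,1]}\}$, $|f|_{C^k(Q)}=\max_{0\le i\le k}\sup_Q|D^if|$. For $k\ge1$, a piecewise expanding $C^k$ unimodal map is an $f\in\mathcal B^k(I)$ with $f(-1)=f(1)=-1$, $\inf_{x\in[-1,0]}Df(x)>1$, $\sup_{x\in[0,1]}Df(x)<-1$ and $f(0)\le1$; the set of these is $\mathcal U^k$. For $1\le j\le k$ with $j$ an integer or $j=k-1+\mathrm{Lip}$, a $C^j$ family of piecewise expanding $C^k$ unimodal maps is a $C^j$ map $t\mapsto f_t$ from an interval around $0$ into $\mathcal U^k\subset\mathcal B^k(I)$. A piecewise expanding unimodal map $f$ is good if either $c$ is not periodic, or $c$ has prime period $p\ge2$ and $|Df^{p-1}(f(c))|\min\{|Df^+(c)|,|Df^-(c)|\}>2$, where $Df^\pm(c)$ are the one-sided derivatives at $c$. For bounded $v:I\to\mathbb R$: if $c$ is not periodic, $J(f,v)=\sum_{i=0}^\infty \frac{v(f^i(c))}{Df^i(f(c))}$; if $c$ has prime period $p$, $J(f,v)=\sum_{i=0}^{p-1}\frac{v(f^i(c))}{Df^i(f(c))}$. Maps $f,g:I\to I$ are topologically conjugate if there is a homeomorphism $h:I\to I$ with $h\circ f=g\circ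 h$. *)

(* Defs.v *)
From Stdlib Require Import Reals Lra Lia ClassicalEpsilon.
From Coquelicot Require Import Coquelicot.
Open Scope R_scope.

Definition inI (x : R) : Prop := -1 <= x <= 1.
Definition inCC (a b x : R) : Prop := a <= x <= b.

Definition deriv_within (a b : R) (g : R -> R) (x l : R) : Prop :=
  forall eps : R, 0 < eps -> exists delta : R, 0 < delta /\
    forall y : R, inCC a b y -> y <> x -> Rabs (y - x) < delta ->
      Rabs ((g y - g x) / (y - x) - l) < eps.

Definition cont_within (S : R -> Prop) (g : R -> R) (x : R) : Prop :=
  forall eps : R, 0 < eps -> exists delta : R, 0 < delta /\
    forall y : R, S y -> Rabs (y - x) < delta -> Rabs (g y - g x) < eps.

(** The derivative within [a,b] as a function (chosen; it is unique when it
    exists since a < b in all uses). *)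
Definition Dwithin (a b : R) (g : R -> R) : R -> R :=
  fun x => epsilon (inhabits 0) (fun l => deriv_within a b g x l).

Fixpoint Dpiece (a b : R) (i : nat) (g : R -> R) : R -> R :=
  match i with
  | O => g
  | S i' => Dwithin a b (Dpiece a b i' g)
  end.

Definition CkOn (k : nat) (a b : R) (g : R -> R) : Prop :=
  (forall i : nat, (i < k)%nat -> forall x : R, inCC a b x ->
     deriv_within a b (Dpiece a b i g) x (Dpiece a b (S i) g x)) /\
  (forall x : R, inCC a b x -> cont_within (inCC a b) (Dpiece a b k g) x).

Definition in_Bk (k : nat) (g : R -> R) : Prop :=
  CkOn k (-1) 0 g /\ CkOn k 0 1 g /\ g (-1) = g 1.

Definition normk_le (k : nat) (g : R -> R) (M : R) : Prop :=
  CkOn k (-1) 0 g /\ CkOn k 0 1 g /\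
  forall i : nat, (i <= k)%nat ->
    (forall x, inCC (-1) 0 x -> Rabs (Dpiece (-1) 0 i g x) <= M) /\
    (forall x, inCC 0 1 x -> Rabs (Dpiece 0 1 i g x) <= M).

Definition DL (g : R -> R) : R -> R := Dpiece (-1) 0 1 g.
Definition DR (g : R -> R) : R -> R := Dpiece 0 1 1 g.

Definition unimodal (k : nat) (g : R -> R) : Prop :=
  in_Bk k g /\ g (-1) = -1 /\ g 1 = -1 /\
  (exists a : R, 1 < a /\ forall x, inCC (-1) 0 x -> a <= DL g x) /\
  (exists a : R, a < -1 /\ forall x, inCC 0 1 x -> DR g x <= a) /\
  g 0 <= 1.

Fixpoint iter (n : nat) (g : R -> R) (x : R) : R :=
  match n with
  | O => x
  | S n' => g (iter n' g x)
  end.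

(** Derivative of g at a point x <> 0 of I (x = 0 never used below). *)
Definition Dpt (g : R -> R) (x : R) : R :=
  if Rlt_dec x 0 then DL g x else DR g x.

(** Dg^n(y) = prod_{j<n} Dg(g^j y) (chain rule along the orbit) *)
Fixpoint Diter (n : nat) (g : R -> R) (y : R) : R :=
  match n with
  | O => 1
  | S n' => Diter n' g y * Dpt g (iter n' g y)
  end.

Definition prime_period (g : R -> R) (p : nat) : Prop :=
  (1 <= p)%nat /\ iter p g 0 = 0 /\
  forall q : nat, (1 <= q)%nat -> (q < p)%nat -> iter q g 0 <> 0.

Definition crit_periodic (g : R -> R) : Prop := exists p : nat, prime_period g p.

Definition good (g : R -> R) : Prop :=
  (~ crit_periodic g) \/
  (exists p : nat, prime_period g p /\ (2 <= p)%nat /\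
     Rabs (Diter (p - 1) g (g 0)) * Rmin (Rabs (DR g 0)) (Rabs (DL g 0)) > 2).

Definition Jterm (g v : R -> R) (i : nat) : R :=
  v (iter i g 0) / Diter i g (g 0).

Definition J (g v : R -> R) : R :=
  match excluded_middle_informative (crit_periodic g) with
  | left _ =>
      let p := epsilon (inhabits 0%nat) (fun p => prime_period g p) in
      sum_n (Jterm g v) (p - 1)
  | right _ => Series (Jterm g v)
  end.

Definition top_conj (f g : R -> R) : Prop :=
  (forall x, inI x -> inI (f x)) /\ (forall x, inI x -> inI (g x)) /\
  exists h hinv : R -> R,
    (forall x, inI x -> inI (h x)) /\ (forall y, inI y -> inI (hinv y)) /\
    (forall x, inI x -> hinv (h x) = x) /\ (forall y, inI y -> h (hinv y) = y) /\
    (forall x, inI x -> cont_within inI h x) /\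
    (forall y, inI y -> cont_within inI hinv y) /\
    (forall x, inI x -> h (f x) = g (h x)).

Definition inD (d t : R) : Prop := -d < t < d.

Definition Bk_deriv (k : nat) (d : R) (F : R -> R -> R) (t0 : R) (L : R -> R)
  : Prop :=
  in_Bk k L /\
  forall eps : R, 0 < eps -> exists delta : R, 0 < delta /\
    forall t : R, inD d t -> Rabs (t - t0) < delta ->
      normk_le k (fun x => F t x - F t0 x - (t - t0) * L x) (eps * Rabs (t - t0)).

Definition Bk_cont (k : nat) (d : R) (F : R -> R -> R) (t0 : R) : Prop :=
  forall eps : R, 0 < eps -> exists delta : R, 0 < delta /\
    forall t : R, inD d t -> Rabs (t - t0) < delta ->
      normk_le k (fun x => F t x - F t0 x) eps.

Definition Cj_curve_with (k j : nat) (d : R) (F : R -> R -> R)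
  (DF : nat -> R -> R -> R) : Prop :=
  (forall t x, inD d t -> inI x -> DF O t x = F t x) /\
  (forall i t, (i <= j)%nat -> inD d t -> in_Bk k (DF i t)) /\
  (forall i t, (i < j)%nat -> inD d t -> Bk_deriv k d (DF i) t (DF (S i) t)) /\
  (forall t, inD d t -> Bk_cont k d (DF j) t).

Definition Ck_family (k j : nat) (d : R) (F : R -> R -> R) : Prop :=
  (forall t, inD d t -> unimodal k (F t)) /\
  exists DF, Cj_curve_with k j d F DF.

Definition CLip_family (k j : nat) (d : R) (F : R -> R -> R) : Prop :=
  (forall t, inD d t -> unimodal k (F t)) /\
  exists DF, Cj_curve_with k (j - 1) d F DF /\
    exists C : R, forall s t, inD d s -> inD d t ->
      normk_le k (fun x => DF (j - 1)%nat s x - DF (j - 1)%nat t x) (C * Rabs (s - t)).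

Definition real_CLip (j : nat) (d : R) (b : R -> R) : Prop :=
  exists Db : nat -> R -> R,
    (forall t, inD d t -> Db O t = b t) /\
    (forall i t, (i < j - 1)%nat -> inD d t -> is_derive (Db i) t (Db (S i) t)) /\
    exists C : R, forall s t, inD d s -> inD d t ->
      Rabs (Db (j - 1)%nat s - Db (j - 1)%nat t) <= C * Rabs (s - t).

(* Main.v *)
Require Import Defs.
From Stdlib Require Import Wf_nat Compare_dec Reals Lra Lia ClassicalEpsilon Classical.
From Coquelicot Require Import Coquelicot.
Open Scope R_scope.

(** Extend the two branches of f_t + s w to expanding C^1 bijections of the line. Every sequence of sides then codes a unique bounded orbit, depending on (t, s); let X_0(t, s) be the initial point of the orbit whose code is the itinerary of the critical point of f. The map f_t + s w has the kneading data of f when X_0(t, s) = 0 and the coded orbit really stays on the sides prescribed by its code, and equal kneading data give a conjugacy. The s-derivative of X_0 at (0, 0) is a nonzero multiple of J(f, w), so X_0(t, b(t)) = 0 defines b.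

If c is periodic the sides are checked on a finite orbit. Otherwise J(f, w) <> 0 makes c periodic for f + s_n w with s_n -> 0; for the corresponding families g_{t,n} the sides persist in t because the finite critical orbit cannot hit c again: for short return times by continuity, for long ones because the return map would expand by more than 2 on a bounded orbit. The sides of f_t + b(t) w are obtained in the limit.

Differentiating x_{i+1} = f_t(x_i) + b(t) w(x_i) gives backward affine recursions with contraction factors 1 / Df, whose bounded solutions are as smooth as their coefficients; this bootstraps b to C^k, with b'(0) proportional to J(f, v) = 0. *)

(** * Preliminaries *)

(** Before s is known to be b(t), the coded orbit need not lie in I or on its sides. The extension
    to the line makes X_0(t, s) a function on a full neighbourhood of (0, 0), so its zero can be
    found before anything is known about the dynamics. Codes are read backwards through inverse
    branches, which contract by 1 / lam. Existence, uniqueness, Lipschitz bounds, linearisation and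
    smoothness therefore all rest on one fact: a bounded sequence with |Z_i| <= theta |Z_(i+1)| + c
    is bounded by c / (1 - theta). Tails of codes are damped geometrically, so all radii can be
    chosen uniformly over the codes that agree with the one of c for N steps; the approximating
    families then live on the same interval as b, and their parameters converge like lam^(-n).
    Conversely a conjugacy fixes the critical point and preserves sides, hence forces X_0(t, s) = 0,
    and the nonzero slope in s gives the uniqueness of b. The recursions deliver k bounded
    derivatives of b, from which the Lipschitz statements follow by the mean value theorem. *)

Lemma Rabs_minus_le a b : Rabs (a - b) <= Rabs a + Rabs b.
Proof. unfold Rminus. eapply Rle_trans; [apply Rabs_triang|]. rewrite Rabs_Ropp. lra. Qed.

Lemma continuous_eps (g : R -> R) (x : R) :
  continuous g x <->
  (forall eps, 0 < eps -> exists d, 0 < d /\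
     forall y, Rabs (y - x) < d -> Rabs (g y - g x) < eps).
Proof.
  unfold continuous. rewrite filterlim_locally. split.
  - intros H eps He. destruct (H (mkposreal eps He)) as [d Hd].
    exists d. split; [apply cond_pos|]. intros y Hy. exact (Hd y Hy).
  - intros H eps. destruct (H eps (cond_pos eps)) as [d [Hd K]].
    exists (mkposreal d Hd). intros y Hy. exact (K y Hy).
Qed.

Lemma is_derive_eps (g : R -> R) (x l : R) :
  is_derive g x l <->
  (forall eps, 0 < eps -> exists d, 0 < d /\
     forall y, Rabs (y - x) < d -> Rabs (g y - g x - l * (y - x)) <= eps * Rabs (y - x)).
Proof.
  rewrite is_derive_Reals. unfold derivable_pt_lim. split.
  - intros H eps He. destruct (H eps He) as [d Hd]. exists d.
    split; [apply cond_pos|]. intros y Hy.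
    destruct (Req_dec y x) as [->|Hn].
    { replace (g x - g x - l * (x - x)) with 0 by ring.
      replace (x - x) with 0 by ring. rewrite Rabs_R0. lra. }
    specialize (Hd (y - x) ltac:(lra) Hy).
    replace (x + (y - x)) with y in Hd by ring.
    replace (g y - g x - l * (y - x)) with (((g y - g x) / (y - x) - l) * (y - x))
      by (field; lra).
    rewrite Rabs_mult. apply Rmult_le_compat_r; [apply Rabs_pos | lra].
  - intros H eps He. destruct (H (eps / 2) ltac:(lra)) as [d [Hd K]].
    exists (mkposreal d Hd). intros h Hh Hhd. simpl in Hhd.
    specialize (K (x + h)). replace (x + h - x) with h in K by ring.
    specialize (K Hhd).
    replace ((g (x + h) - g x) / h - l) with ((g (x + h) - g x - l * h) / h)
      by (field; lra).
    unfold Rdiv. rewrite Rabs_mult, Rabs_inv.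
    assert (0 < Rabs h) by now apply Rabs_pos_lt.
    apply Rle_lt_trans with (eps / 2 * Rabs h * / Rabs h).
    + apply Rmult_le_compat_r; [left; now apply Rinv_0_lt_compat | exact K].
    + replace (eps / 2 * Rabs h * / Rabs h) with (eps / 2) by (field; lra). lra.
Qed.

Definition clamp (a b x : R) : R := Rmax a (Rmin b x).

Lemma clamp_in a b x : a <= b -> inCC a b (clamp a b x).
Proof.
  intros H. unfold clamp, inCC. split; [apply Rmax_l|].
  apply Rmax_lub; [exact H | apply Rmin_l].
Qed.

Lemma clamp_id a b x : inCC a b x -> clamp a b x = x.
Proof.
  unfold clamp, inCC. intros [H1 H2]. rewrite Rmin_right, Rmax_right; lra.
Qed.

Lemma clamp_mono a b x y : x <= y -> 0 <= clamp a b y - clamp a b x <= y - x.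
Proof.
  intros H. unfold clamp, Rmax, Rmin.
  repeat destruct (Rle_dec _ _); lra.
Qed.

Lemma clamp_lip a b x y : Rabs (clamp a b y - clamp a b x) <= Rabs (y - x).
Proof.
  destruct (Rle_dec x y).
  - destruct (clamp_mono a b x y) as [H1 H2]; [assumption|].
    rewrite !Rabs_pos_eq; lra.
  - destruct (clamp_mono a b y x) as [H1 H2]; [lra|].
    rewrite (Rabs_minus_sym y), (Rabs_minus_sym (clamp a b y)).
    rewrite !Rabs_pos_eq; lra.
Qed.

Lemma ivt_within (g : R -> R) (a b y : R) :
  a <= b -> (forall x, inCC a b x -> cont_within (inCC a b) g x) ->
  (g a <= y <= g b \/ g b <= y <= g a) ->
  exists x, inCC a b x /\ g x = y.
Proof.
  intros Hab Hc Hy.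
  destruct (IVT_gen (fun x => g (clamp a b x)) a b y) as [x [Hx Ex]].
  - intros x. apply continuity_pt_filterlim.
    change (continuous (fun x => g (clamp a b x)) x).
    apply continuous_eps. intros eps He.
    destruct (Hc (clamp a b x) (clamp_in a b x Hab) eps He) as [d [Hd K]].
    exists d. split; [exact Hd|]. intros z Hz. apply K.
    + now apply clamp_in.
    + eapply Rle_lt_trans; [apply clamp_lip | exact Hz].
  - rewrite !clamp_id by (unfold inCC; lra).
    unfold Rmin, Rmax. repeat destruct (Rle_dec _ _); lra.
  - rewrite Rmin_left, Rmax_right in Hx by lra.
    exists x. split; [exact Hx|]. rewrite clamp_id in Ex by exact Hx. exact Ex.
Qed.

Lemma pow_small (th B eps : R) :
  0 <= th < 1 -> 0 < eps -> exists N, forall n, (N <= n)%nat -> th ^ n * B < eps.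
Proof.
  intros Hth He.
  assert (L : is_lim_seq (fun n => th ^ n * B) 0).
  { replace (Finite 0) with (Rbar_mult 0 B) by (simpl; f_equal; ring).
    apply (is_lim_seq_scal_r (fun n => th ^ n) B 0).
    apply is_lim_seq_geom. rewrite Rabs_pos_eq; lra. }
  apply is_lim_seq_spec in L. destruct (L (mkposreal eps He)) as [N HN].
  exists N. intros n Hn. specialize (HN n Hn). simpl in HN.
  rewrite Rminus_0_r in HN. apply Rabs_def2 in HN. lra.
Qed.

Lemma le_pow_all (a c th B : R) :
  0 <= th < 1 -> (forall n, a <= th ^ n * B + c) -> a <= c.
Proof.
  intros Hth H. destruct (Rle_dec a c) as [|Hn]; [assumption|].
  destruct (pow_small th B (a - c) Hth) as [N HN]; [lra|].
  specialize (HN N (Nat.le_refl N)). specialize (H N). lra.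
Qed.

(** Each step towards [a] multiplies the error by [th] and adds [c], so the sum is geometric. The
    index type is left general because the recursion is run along the integers, along the points of
    I with [tau] the map itself, and along pairs of a point and a time. *)
Lemma backward_trunc {T : Type} (tau : T -> T) (Z : T -> R) (th c B : R) :
  0 <= th < 1 -> 0 <= c ->
  forall m a,
  (forall j, (j < m)%nat -> Rabs (Z (Nat.iter j tau a)) <= th * Rabs (Z (Nat.iter (S j) tau a)) + c) ->
  Rabs (Z (Nat.iter m tau a)) <= B ->
  Rabs (Z a) <= th ^ m * B + c / (1 - th).
Proof.
  intros Hth Hc m. induction m as [|m IH]; intros a H HB; simpl.
  - simpl in HB. assert (0 <= c / (1 - th)).
    { apply Rmult_le_pos; [exact Hc|]. left; apply Rinv_0_lt_compat; lra. }
    lra.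
  - assert (E : Rabs (Z (tau a)) <= th ^ m * B + c / (1 - th)).
    { apply IH.
      - intros j Hj. specialize (H (S j) ltac:(lia)).
        rewrite !Nat.iter_succ_r in H. rewrite Nat.iter_succ_r. exact H.
      - rewrite Nat.iter_succ_r in HB. exact HB. }
    specialize (H 0%nat ltac:(lia)). simpl in H.
    apply (Rmult_le_compat_l th) in E; [|lra].
    replace (c / (1 - th)) with (th * (c / (1 - th)) + c) by (field; lra).
    lra.
Qed.

(** Letting [m] tend to infinity removes the a priori bound [B], which only has to exist. With
    [c = 0] the conclusion is [Z = 0]; every uniqueness statement about coded orbits is obtained in
    this way. *)
Lemma backward_bound {T : Type} (tau : T -> T) (Z : T -> R) (th c B : R) :
  0 <= th < 1 -> 0 <= c -> (forall a, Rabs (Z a) <= B) ->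
  (forall a, Rabs (Z a) <= th * Rabs (Z (tau a)) + c) ->
  forall a, Rabs (Z a) <= c / (1 - th).
Proof.
  intros Hth Hc HB H a. apply (le_pow_all _ _ th B Hth). intros n.
  apply (backward_trunc tau Z th c B Hth Hc); auto.
Qed.

Lemma iter_S_nat (m a : nat) : Nat.iter m S a = (m + a)%nat.
Proof. induction m; simpl; congruence. Qed.

Lemma backward_trunc_nat (Z : nat -> R) (th c B : R) (m i : nat) :
  0 <= th < 1 -> 0 <= c -> (i <= m)%nat ->
  (forall j, (j < m)%nat -> Rabs (Z j) <= th * Rabs (Z (S j)) + c) ->
  Rabs (Z m) <= B ->
  Rabs (Z i) <= th ^ (m - i) * B + c / (1 - th).
Proof.
  intros Hth Hc Hi H HB. apply (backward_trunc S Z th c B Hth Hc).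
  - intros j Hj. rewrite !iter_S_nat. apply H. lia.
  - rewrite iter_S_nat. replace (m - i + i)%nat with m by lia. exact HB.
Qed.

(** The iterates started at 0 differ from the n-th one on by at most [th ^ n * (2 * M)], uniformly
    in the index, so they converge pointwise and the limit solves the system. *)
Lemma contraction_system {T : Type} (tau : T -> T) (phi : T -> R -> R) (th M : R) :
  0 <= th < 1 ->
  (forall a y z, Rabs (phi a y - phi a z) <= th * Rabs (y - z)) ->
  (forall a y, Rabs y <= M -> Rabs (phi a y) <= M) -> 0 <= M ->
  exists H : T -> R, (forall a, Rabs (H a) <= M) /\ forall a, H a = phi a (H (tau a)).
Proof.
  intros Hth Hc HM M0.
  set (u := fix u (n : nat) (a : T) : R :=
        match n with O => 0 | S n' => phi a (u n' (tau a)) end).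
  assert (UB : forall n a, Rabs (u n a) <= M).
  { induction n; intros a; simpl; [rewrite Rabs_R0; exact M0 | apply HM, IHn]. }
  assert (unif_Ck : forall n k a, Rabs (u (n + k)%nat a - u n a) <= th ^ n * (2 * M)).
  { induction n; intros k a; simpl.
    - rewrite Rminus_0_r. specialize (UB k a). lra.
    - eapply Rle_trans; [apply Hc|]. rewrite Rmult_assoc.
      apply Rmult_le_compat_l; [lra | apply IHn]. }
  assert (C : forall a, exists l : R, is_lim_seq (fun n => u n a) l).
  { intros a. apply ex_lim_seq_cauchy_corr. intros eps.
    destruct (pow_small th (2 * M) (eps / 2) Hth) as [N HN].
    { destruct eps; simpl; lra. }
    exists N. intros n m Hn Hm.
    pose proof (unif_Ck N (n - N)%nat a) as E1. pose proof (unif_Ck N (m - N)%nat a) as E2.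
    replace (N + (n - N))%nat with n in E1 by lia.
    replace (N + (m - N))%nat with m in E2 by lia.
    specialize (HN N (Nat.le_refl N)).
    replace (u n a - u m a) with ((u n a - u N a) - (u m a - u N a)) by ring.
    eapply Rle_lt_trans; [apply Rabs_triang|]. rewrite Rabs_Ropp. lra. }
  set (H := fun a => epsilon (inhabits 0) (fun l : R => is_lim_seq (fun n => u n a) l)).
  assert (HL : forall a, is_lim_seq (fun n => u n a) (H a)).
  { intros a. apply (epsilon_spec (inhabits 0) (fun l : R => is_lim_seq (fun n => u n a) l)).
    apply C. }
  exists H. split.
  - intros a. apply (is_lim_seq_le (fun n => Rabs (u n a)) (fun _ => M) (Rabs (H a)) M).
    + intros n; apply UB.
    + apply (is_lim_seq_abs _ (H a)), HL.
    + apply is_lim_seq_const.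
  - intros a.
    assert (L1 : is_lim_seq (fun n => u (S n) a) (H a)) by (exact (proj1 (is_lim_seq_incr_1 (fun n => u n a) (H a)) (HL a))).
    assert (L2 : is_lim_seq (fun n => u (S n) a) (phi a (H (tau a)))).
    { apply (is_lim_seq_continuous (phi a) (fun n => u n (tau a))).
      - apply continuity_pt_filterlim, continuous_eps. intros eps He.
        exists eps. split; [exact He|]. intros y Hy.
        eapply Rle_lt_trans; [apply Hc|].
        pose proof (Rabs_pos (y - H (tau a))).
        apply Rle_lt_trans with (1 * Rabs (y - H (tau a))); [|lra].
        apply Rmult_le_compat_r; lra.
      - apply HL. }
    pose proof (is_lim_seq_unique _ _ L1) as E1.
    pose proof (is_lim_seq_unique _ _ L2) as E2.
    rewrite E1 in E2. now injection E2.
Qed.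

(** * Pairs of expanding branches *)

Definition sg (b : bool) : R := if b then 1 else -1.

(** [true] is the left, increasing branch and [false] the right, decreasing one. The critical point
    is put on the right by convention, while [closed_side] lets it lie on both sides. *)
Definition side (x : R) : bool := if Rlt_dec x 0 then true else false.

Definition closed_side (b : bool) (x : R) : Prop := if b then x <= 0 else 0 <= x.

Lemma side_closed x : closed_side (side x) x.
Proof. unfold side, closed_side. destruct (Rlt_dec x 0); lra. Qed.

(** Expansion is expressed through increments on the whole line, so the topological part of the
    proof needs no derivatives. The condition that the critical value be at most 1 is kept apart,
    since it can fail for small perturbations. *)
Record expanding_pair (lam : R) (G : bool -> R -> R) : Prop := {
  ep_lam : 1 < lam;
  ep_cont : forall b x, continuous (G b) x;
  ep_exp : forall b x y, x <= y -> lam * (y - x) <= sg b * (G b y - G b x);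
  ep_l : G true (-1) = -1;
  ep_r : G false 1 = -1;
  ep_0 : G true 0 = G false 0 }.

Arguments ep_lam {_ _}.
Arguments ep_cont {_ _}.
Arguments ep_exp {_ _}.
Arguments ep_l {_ _}.
Arguments ep_r {_ _}.
Arguments ep_0 {_ _}.

Definition glue (G : bool -> R -> R) (x : R) : R := G (side x) x.

Lemma glue_closed lam G b x : expanding_pair lam G -> closed_side b x -> glue G x = G b x.
Proof.
  intros HG Hb. unfold glue, side. destruct (Rlt_dec x 0), b; simpl in Hb; try lra; auto.
  replace x with 0 by lra. symmetry; apply (ep_0 HG).
Qed.

Lemma ep_exp_abs lam G b x y : expanding_pair lam G ->
  lam * Rabs (y - x) <= Rabs (G b y - G b x).
Proof.
  intros HG. pose proof (ep_lam HG).
  destruct (Rle_dec x y) as [H0|H0].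
  - pose proof (ep_exp HG b x y H0). rewrite (Rabs_pos_eq (y - x)) by lra.
    eapply Rle_trans; [eassumption|]. destruct b; simpl.
    + rewrite Rmult_1_l. apply Rle_abs.
    + rewrite <- Rabs_Ropp. eapply Rle_trans; [|apply Rle_abs]. lra.
  - pose proof (ep_exp HG b y x ltac:(lra)).
    rewrite (Rabs_minus_sym y x), (Rabs_minus_sym (G b y)).
    rewrite (Rabs_pos_eq (x - y)) by lra.
    eapply Rle_trans; [eassumption|]. destruct b; simpl.
    + rewrite Rmult_1_l. apply Rle_abs.
    + rewrite <- Rabs_Ropp. eapply Rle_trans; [|apply Rle_abs]. lra.
Qed.

Lemma ep_inj lam G b x y : expanding_pair lam G -> G b x = G b y -> x = y.
Proof.
  intros HG E. pose proof (ep_exp_abs lam G b y x HG) as H.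
  pose proof (ep_lam HG). rewrite E, Rminus_diag, Rabs_R0 in H.
  destruct (Req_dec (x - y) 0) as [|Hn]; [lra|].
  apply Rabs_pos_lt in Hn.
  assert (0 < lam * Rabs (x - y)) by (apply Rmult_lt_0_compat; lra). lra.
Qed.

Lemma cont_within_of_continuous (S : R -> Prop) g x :
  continuous g x -> cont_within S g x.
Proof.
  intros H eps He. destruct (proj1 (continuous_eps g x) H eps He) as [d [Hd K]].
  exists d. split; [exact Hd|]. intros; apply K; assumption.
Qed.

Lemma ep_surj lam G b y : expanding_pair lam G -> exists x, G b x = y.
Proof.
  intros HG. pose proof (ep_lam HG) as Hl.
  set (K := Rabs (y - G b 0)).
  assert (K0 : 0 <= K) by apply Rabs_pos.
  assert (HK : K <= lam * K) by (rewrite <- (Rmult_1_l K) at 1; apply Rmult_le_compat_r; lra).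
  pose proof (ep_exp HG b 0 K K0) as E1.
  pose proof (ep_exp HG b (-K) 0 ltac:(lra)) as E2.
  assert (A : y - G b 0 <= K /\ - (y - G b 0) <= K).
  { split; unfold K; [apply Rle_abs | rewrite <- Rabs_Ropp; apply Rle_abs]. }
  destruct (ivt_within (G b) (- K) K y) as [x [_ Ex]]; [lra| | |exists x; exact Ex].
  - intros x _. apply cont_within_of_continuous, (ep_cont HG).
  - destruct b; simpl in *; lra.
Qed.

Definition binv (G : bool -> R -> R) (b : bool) (y : R) : R :=
  epsilon (inhabits 0) (fun x => G b x = y).

Lemma binv_r lam G b y : expanding_pair lam G -> G b (binv G b y) = y.
Proof.
  intros HG. apply (epsilon_spec (inhabits 0) (fun x => G b x = y)).
  exact (ep_surj lam G b y HG).
Qed.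

Lemma binv_l lam G b x : expanding_pair lam G -> binv G b (G b x) = x.
Proof. intros HG. apply (ep_inj lam G b _ _ HG). now apply (binv_r lam). Qed.

Lemma binv_lip lam G b y z : expanding_pair lam G ->
  Rabs (binv G b y - binv G b z) <= / lam * Rabs (y - z).
Proof.
  intros HG. pose proof (ep_lam HG).
  pose proof (ep_exp_abs lam G b (binv G b z) (binv G b y) HG) as E.
  rewrite !(binv_r lam) in E by exact HG.
  apply (Rmult_le_reg_l lam); [lra|]. rewrite <- Rmult_assoc, Rinv_r, Rmult_1_l by lra.
  exact E.
Qed.

Lemma binv_mono lam G b y z : expanding_pair lam G -> y <= z ->
  0 <= sg b * (binv G b z - binv G b y).
Proof.
  intros HG Hyz. pose proof (ep_lam HG) as Hl.
  destruct (Rle_dec 0 (sg b * (binv G b z - binv G b y))) as [|Hn]; [assumption|].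
  exfalso. destruct b; simpl in Hn.
  - pose proof (ep_exp HG true (binv G true z) (binv G true y) ltac:(lra)) as E.
    rewrite !(binv_r lam) in E by exact HG. simpl in E.
    assert (0 < lam * (binv G true y - binv G true z)) by (apply Rmult_lt_0_compat; lra).
    lra.
  - pose proof (ep_exp HG false (binv G false y) (binv G false z) ltac:(lra)) as E.
    rewrite !(binv_r lam) in E by exact HG. simpl in E.
    assert (0 < lam * (binv G false z - binv G false y)) by (apply Rmult_lt_0_compat; lra).
    lra.
Qed.

(** The solution M of M = (M + 1) / lam + 1. An inverse branch sends -1 to a point of modulus 1 and
    contracts by 1 / lam, hence maps [-M, M] into itself. *)
Definition orbit_bound (lam : R) : R := (lam + 1) / (lam - 1).

Lemma orbit_bound_gt_1 lam : 1 < lam -> 1 < orbit_bound lam.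
Proof.
  intros H. unfold orbit_bound. apply (Rmult_lt_reg_r (lam - 1)); [lra|].
  unfold Rdiv. rewrite Rmult_assoc, Rinv_l; lra.
Qed.

Lemma inv_lam lam : 1 < lam -> 0 < / lam < 1.
Proof.
  intros H. split; [apply Rinv_0_lt_compat; lra|].
  rewrite <- Rinv_1. apply Rinv_lt_contravar; lra.
Qed.

Lemma binv_bound lam G b y : expanding_pair lam G -> Rabs y <= orbit_bound lam -> Rabs (binv G b y) <= orbit_bound lam.
Proof.
  intros HG Hy. pose proof (ep_lam HG) as Hl.
  assert (E : Rabs (binv G b y - binv G b (-1)) <= / lam * (orbit_bound lam + 1)).
  { eapply Rle_trans; [apply (binv_lip lam); exact HG|].
    apply Rmult_le_compat_l; [left; apply inv_lam; lra|].
    replace (y - -1) with (y + 1) by ring.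
    eapply Rle_trans; [apply Rabs_triang|]. rewrite Rabs_R1. lra. }
  assert (E1 : Rabs (binv G b (-1)) = 1).
  { destruct b.
    - rewrite <- (ep_l HG) at 1. rewrite (binv_l lam) by exact HG.
      rewrite Rabs_left; lra.
    - rewrite <- (ep_r HG) at 1. rewrite (binv_l lam) by exact HG. apply Rabs_R1. }
  replace (binv G b y) with ((binv G b y - binv G b (-1)) + binv G b (-1)) by ring.
  eapply Rle_trans; [apply Rabs_triang|]. rewrite E1.
  replace (orbit_bound lam) with (/ lam * (orbit_bound lam + 1) + 1); [lra|].
  unfold orbit_bound. field. lra.
Qed.

Lemma orbit_exists lam G (eps : nat -> bool) : expanding_pair lam G ->
  exists X : nat -> R, (forall i, Rabs (X i) <= orbit_bound lam) /\
    forall i, G (eps i) (X i) = X (S i).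
Proof.
  intros HG. pose proof (ep_lam HG) as Hl.
  destruct (contraction_system S (fun i y => binv G (eps i) y) (/ lam) (orbit_bound lam))
    as [X [XB XE]].
  - pose proof (inv_lam lam Hl). lra.
  - intros. now apply binv_lip.
  - intros. now apply binv_bound.
  - pose proof (orbit_bound_gt_1 lam Hl). lra.
  - exists X. split; [exact XB|]. intros i. rewrite XE. now apply (binv_r lam).
Qed.

Lemma abs_le_inv lam a b : 1 < lam -> lam * Rabs a <= Rabs b -> Rabs a <= / lam * Rabs b.
Proof.
  intros Hl H. apply (Rmult_le_reg_l lam); [lra|].
  rewrite <- Rmult_assoc, Rinv_r, Rmult_1_l by lra. exact H.
Qed.

Lemma orbit_unique lam G (eps : nat -> bool) X Y B : expanding_pair lam G ->
  (forall i, Rabs (X i) <= B) -> (forall i, Rabs (Y i) <= B) ->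
  (forall i, G (eps i) (X i) = X (S i)) -> (forall i, G (eps i) (Y i) = Y (S i)) ->
  forall i, X i = Y i.
Proof.
  intros HG XB YB XE YE i. pose proof (ep_lam HG) as Hl.
  pose proof (inv_lam lam Hl).
  assert (E : Rabs (X i - Y i) <= 0 / (1 - / lam)).
  { apply (backward_bound S (fun i => X i - Y i) (/ lam) 0 (2 * B)); try lra.
    - intros j. unfold Rminus. eapply Rle_trans; [apply Rabs_triang|].
      rewrite Rabs_Ropp. specialize (XB j). specialize (YB j). lra.
    - intros j. rewrite Rplus_0_r. apply abs_le_inv; [exact Hl|].
      rewrite <- XE, <- YE. now apply ep_exp_abs. }
  unfold Rdiv in E. rewrite Rmult_0_l in E.
  pose proof (Rabs_pos (X i - Y i)).
  destruct (Req_dec (X i - Y i) 0) as [|Hn]; [lra|].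
  apply Rabs_pos_lt in Hn. lra.
Qed.

(** Vanishing is compared too: the two equivalences together give [a = 0] iff [b = 0]. The code
    alone would not separate a return to the critical point from a visit to the right half. *)
Definition same_sign (a b : R) : Prop := (a < 0 <-> b < 0) /\ (0 < a <-> 0 < b).

Lemma glue_cont lam G x : expanding_pair lam G -> continuous (glue G) x.
Proof.
  intros HG. apply continuous_eps. intros eps He.
  destruct (proj1 (continuous_eps (G true) x) (ep_cont HG true x) eps He) as [d1 [D1 K1]].
  destruct (proj1 (continuous_eps (G false) x) (ep_cont HG false x) eps He) as [d2 [D2 K2]].
  assert (D : 0 < Rmin d1 d2) by (now apply Rmin_pos).
  pose proof (Rmin_l d1 d2). pose proof (Rmin_r d1 d2).
  destruct (Req_dec x 0) as [->|Hx].
  - exists (Rmin d1 d2). split; [exact D|]. intros y Hy.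
    rewrite (glue_closed lam G (side y) y HG (side_closed y)).
    rewrite (glue_closed lam G (side y) 0 HG) by (destruct (side y); simpl; lra).
    destruct (side y); [apply K1 | apply K2]; lra.
  - exists (Rmin (Rmin d1 d2) (Rabs x)). split; [apply Rmin_pos; [exact D| now apply Rabs_pos_lt]|].
    intros y Hy. pose proof (Rmin_l (Rmin d1 d2) (Rabs x)). pose proof (Rmin_r (Rmin d1 d2) (Rabs x)).
    assert (S : side y = side x).
    { assert (A : Rabs (y - x) < Rabs x) by lra. apply Rabs_def2 in A.
      unfold side. unfold Rabs in A. destruct (Rcase_abs x), (Rlt_dec y 0), (Rlt_dec x 0); auto; lra. }
    unfold glue. rewrite S. destruct (side x); [apply K1 | apply K2]; lra.
Qed.

Lemma glue_range lam G x : expanding_pair lam G -> inI x -> -1 <= glue G x <= G true 0.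
Proof.
  intros HG [H1 H2]. pose proof (ep_lam HG) as Hl.
  unfold glue, side. destruct (Rlt_dec x 0) as [Hx|Hx].
  - pose proof (ep_exp HG true (-1) x H1) as E1. rewrite (ep_l HG) in E1.
    pose proof (ep_exp HG true x 0 ltac:(lra)) as E2. simpl in *.
    assert (0 <= lam * (x - -1)) by (apply Rmult_le_pos; lra).
    assert (0 <= lam * (0 - x)) by (apply Rmult_le_pos; lra). lra.
  - pose proof (ep_exp HG false x 1 H2) as E1. rewrite (ep_r HG) in E1.
    pose proof (ep_exp HG false 0 x ltac:(lra)) as E2. simpl in *.
    rewrite (ep_0 HG).
    assert (0 <= lam * (1 - x)) by (apply Rmult_le_pos; lra).
    assert (0 <= lam * (x - 0)) by (apply Rmult_le_pos; lra). lra.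
Qed.

Lemma glue_inI lam G x : expanding_pair lam G -> G true 0 <= 1 -> inI x -> inI (glue G x).
Proof. intros HG H1 Hx. pose proof (glue_range lam G x HG Hx). unfold inI. lra. Qed.

Lemma iter_inI lam G i : expanding_pair lam G -> G true 0 <= 1 -> inI (iter i (glue G) 0).
Proof.
  intros HG H1. induction i; simpl.
  - unfold inI; lra.
  - now apply (glue_inI lam).
Qed.

(* The branch inverse, clamped to the closed half of I it should land in. *)
Definition cinv (G : bool -> R -> R) (b : bool) (y : R) : R :=
  if b then clamp (-1) 0 (binv G true y) else clamp 0 1 (binv G false y).

Lemma cinv_in G b y : closed_side b (cinv G b y) /\ inI (cinv G b y).
Proof.
  destruct b; simpl; unfold inI.
  - destruct (clamp_in (-1) 0 (binv G true y)); lra.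
  - destruct (clamp_in 0 1 (binv G false y)); lra.
Qed.

Lemma cinv_lip lam G b y z : expanding_pair lam G ->
  Rabs (cinv G b y - cinv G b z) <= / lam * Rabs (y - z).
Proof.
  intros HG. eapply Rle_trans; [|apply (binv_lip lam G b); exact HG].
  destruct b; apply clamp_lip.
Qed.

Lemma cinv_mono lam G b y z : expanding_pair lam G -> y <= z ->
  0 <= sg b * (cinv G b z - cinv G b y).
Proof.
  intros HG H. pose proof (binv_mono lam G b y z HG H) as E.
  destruct b; simpl in *.
  - destruct (clamp_mono (-1) 0 (binv G true y) (binv G true z)); lra.
  - destruct (clamp_mono 0 1 (binv G false z) (binv G false y)); lra.
Qed.

Lemma cinv_l lam G b x : expanding_pair lam G -> closed_side b x -> inI x -> cinv G b (glue G x) = x.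
Proof.
  intros HG Hb Hx. rewrite (glue_closed lam G b x HG Hb).
  destruct b; simpl in *; rewrite (binv_l lam) by exact HG; apply clamp_id;
    unfold inCC, inI in *; lra.
Qed.

Lemma cinv_r lam G b y : expanding_pair lam G -> -1 <= y <= G true 0 -> glue G (cinv G b y) = y.
Proof.
  intros HG [H1 H2]. rewrite (glue_closed lam G b _ HG (proj1 (cinv_in G b y))).
  pose proof (binv_mono lam G b (-1) y HG H1) as E1.
  destruct b; simpl in *.
  - rewrite <- (ep_l HG) in E1 at 1. rewrite (binv_l lam) in E1 by exact HG.
    pose proof (binv_mono lam G true _ _ HG H2) as E2. rewrite (binv_l lam) in E2 by exact HG.
    simpl in E2. rewrite clamp_id by (unfold inCC; lra). now apply (binv_r lam).
  - rewrite <- (ep_r HG) in E1 at 2. rewrite (binv_l lam) in E1 by exact HG.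
    rewrite (ep_0 HG) in H2.
    pose proof (binv_mono lam G false _ _ HG H2) as E2. rewrite (binv_l lam) in E2 by exact HG.
    simpl in E2. rewrite clamp_id by (unfold inCC; lra). now apply (binv_r lam).
Qed.

(** * Conjugacy and the signs of the critical orbit *)

Lemma iter_shift (g : R -> R) (i : nat) x : iter (S i) g x = iter i g (g x).
Proof. induction i; simpl in *; congruence. Qed.

Lemma iter_add (g : R -> R) (i j : nat) x : iter (i + j) g x = iter i g (iter j g x).
Proof. induction i; simpl; congruence. Qed.

Lemma same_sign_side x y : same_sign x y -> side x = side y.
Proof. intros [H1 H2]. unfold side. destruct (Rlt_dec x 0), (Rlt_dec y 0); tauto. Qed.

Lemma closed_zero b : closed_side b 0.
Proof. destruct b; simpl; lra. Qed.

(** [H] is the fixed point of H(x) = (inverse branch of [G] on the side of x)(H(F x)). The inverse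
    branches are clamped so that this makes sense before [H (F x)] is known to lie in the range of
    [G]. The fixed point equation sends c_i to d_i, and since [H] does not invert the order relative
    to the critical orbit, H(F x) stays below the critical value of [G]; then no clamp is active and
    the equation becomes the semiconjugacy. *)
Lemma semiconjugacy lam F G :
  expanding_pair lam F -> expanding_pair lam G -> F true 0 <= 1 -> G true 0 <= 1 ->
  (forall i, same_sign (iter i (glue F) 0) (iter i (glue G) 0)) ->
  exists H : R -> R,
    (forall x, inI x -> inI (H x)) /\
    (forall b x, inI x -> closed_side b x -> closed_side b (H x)) /\
    (forall x, inI x -> cont_within inI H x) /\
    (forall x, inI x -> H (glue F x) = glue G (H x)).
Proof.
  intros HF HG F1 G1 SS.
  pose proof (ep_lam HF) as Hl. pose proof (inv_lam lam Hl) as Hi.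
  set (th := / lam) in *.
  set (c := fun i => iter i (glue F) 0). set (d := fun i => iter i (glue G) 0).
  destruct (contraction_system (glue F) (fun x => cinv G (side x)) th 1) as [H [HB HE]].
  { lra. } { intros; now apply cinv_lip. }
  { intros x y _. destruct (cinv_in G (side x) y) as [_ [A1 A2]]. apply Rabs_le; lra. }
  { lra. }
  assert (cI : forall i, inI (c i)) by (intros; now apply (iter_inI lam)).
  assert (dI : forall i, inI (d i)) by (intros; now apply (iter_inI lam)).
  assert (cS : forall i, c (S i) = glue F (c i)) by reflexivity.
  assert (dS : forall i, d (S i) = glue G (d i)) by reflexivity.
  assert (Hs : forall x, closed_side (side x) (H x) /\ inI (H x)).
  { intros x. rewrite HE. apply cinv_in. }
  assert (dE : forall i, d i = cinv G (side (c i)) (d (S i))).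
  { intros i. rewrite dS. symmetry. apply (cinv_l lam); auto.
    rewrite (same_sign_side (c i) (d i) (SS i)). apply side_closed. }
  assert (Hcd : forall i, H (c i) = d i).
  { intros i.
    assert (E : Rabs (H (c i) - d i) <= 0 / (1 - th)).
    { apply (backward_bound S (fun i => H (c i) - d i) th 0 2); try lra.
      - intros j. destruct (Hs (c j)) as [_ [A1 A2]]. destruct (dI j). apply Rabs_le. lra.
      - intros j. rewrite Rplus_0_r. rewrite (HE (c j)), (dE j). simpl. now apply cinv_lip. }
    unfold Rdiv in E. rewrite Rmult_0_l in E.
    destruct (Req_dec (H (c i) - d i) 0) as [|Hn]; [lra|]. apply Rabs_pos_lt in Hn. lra. }
  set (Inv := fun a : R * nat => inI (fst a) /\
     ((fst a < c (snd a) /\ d (snd a) < H (fst a)) \/ (c (snd a) < fst a /\ H (fst a) < d (snd a)))).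
  (* An inversion between x and c_i is pushed forward to an inversion between f x and c_(i+1), larger by the factor lam; bounded sizes then exclude inversions. *)
  assert (NoInv : forall a, ~ Inv a).
  { set (Z := fun a : R * nat => if excluded_middle_informative (Inv a) then H (fst a) - d (snd a) else 0).
    assert (E : forall a, Rabs (Z a) <= 0 / (1 - th)).
    { apply (backward_bound (fun a => (glue F (fst a), S (snd a))) Z th 0 2); try lra.
      - intros [x i]. unfold Z. destruct (excluded_middle_informative _).
        + simpl. destruct (Hs x) as [_ [A1 A2]]. destruct (dI i). apply Rabs_le. lra.
        + rewrite Rabs_R0. lra.
      - intros [x i]. unfold Z at 1. destruct (excluded_middle_informative (Inv (x, i))) as [[HxI HI]|].
        2: { rewrite Rabs_R0. pose proof (Rabs_pos (Z (glue F (fst (x,i)), S (snd (x,i))))).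
             apply Rplus_le_le_0_compat; [apply Rmult_le_pos; lra | lra]. }
        simpl in HxI, HI. simpl fst; simpl snd. rewrite Rplus_0_r.
        destruct (Hs x) as [Cx Ix].
        assert (Cd : closed_side (side (c i)) (d i)).
        { rewrite (same_sign_side (c i) (d i) (SS i)). apply side_closed. }
        assert (Sd : side x = side (c i)).
        { unfold side in *. destruct (Rlt_dec x 0), (Rlt_dec (c i) 0); simpl in Cx, Cd; auto; lra. }
        assert (I2 : Inv (glue F x, S i)).
        { split; [now apply (glue_inI lam)|]. simpl fst; simpl snd. rewrite cS.
          assert (M1 : forall y z, y < z -> side y = side z -> 0 < sg (side y) * (glue F z - glue F y)).
          { intros y z Hyz Es. unfold glue. rewrite <- Es.
            pose proof (ep_exp HF (side y) y z ltac:(lra)) as E.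
            assert (0 < lam * (z - y)) by (apply Rmult_lt_0_compat; lra). lra. }
          assert (M2 : forall y z, cinv G (side x) y < cinv G (side x) z -> 0 < sg (side x) * (z - y)).
          { intros y z Hyz. destruct (Rle_dec y z) as [Q|Q].
            - pose proof (cinv_mono lam G (side x) y z HG Q) as E.
              assert (y <> z) by (intros ->; lra).
              destruct (side x); simpl in *; lra.
            - pose proof (cinv_mono lam G (side x) z y HG ltac:(lra)) as E.
              destruct (side x); simpl in *; lra. }
          rewrite (HE x), (dE i), <- Sd in HI.
          destruct HI as [[P1 P2]|[P1 P2]]; apply M2 in P2.
          - apply (M1 _ _) in P1; [|exact Sd]. destruct (side x); simpl in *; [left|right]; lra.
          - apply (M1 _ _) in P1; [|now symmetry]. rewrite <- Sd in P1.
            destruct (side x); simpl in *; [right|left]; lra. }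
        unfold Z. destruct (excluded_middle_informative (Inv (glue F x, S i))); [|tauto].
        simpl fst; simpl snd. rewrite (HE x), (dE i), <- Sd. now apply cinv_lip. }
    intros a Ha. specialize (E a). unfold Z in E.
    destruct (excluded_middle_informative (Inv a)); [|tauto].
    unfold Rdiv in E. rewrite Rmult_0_l in E.
    assert (Hn : H (fst a) - d (snd a) <> 0) by (destruct Ha as [_ [?|?]]; lra).
    apply Rabs_pos_lt in Hn. lra. }
  assert (d1 : d 1%nat = G true 0).
  { simpl. apply (glue_closed lam); [exact HG | simpl; lra]. }
  assert (c1 : c 1%nat = F true 0).
  { simpl. apply (glue_closed lam); [exact HF | simpl; lra]. }
  (* The first critical image c_1 is the maximum of [F] on I, so a value [H (glue F x)] above d_1
     would be an inversion at time 1. *)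
  assert (Hle : forall x, inI x -> -1 <= H (glue F x) <= G true 0).
  { intros x Hx. split; [destruct (Hs (glue F x)) as [_ [A1 A2]]; exact A1|].
    pose proof (glue_range lam F x HF Hx) as [_ R2]. rewrite <- d1.
    destruct (Rle_dec (H (glue F x)) (d 1%nat)) as [|Q]; [assumption|]. exfalso.
    destruct (Req_dec (glue F x) (c 1%nat)) as [E|E].
    - rewrite E, Hcd in Q. lra.
    - apply (NoInv (glue F x, 1%nat)). split; [now apply (glue_inI lam)|].
      left. simpl fst; simpl snd. rewrite c1 in *. lra. }
  assert (H0 : H 0 = 0) by exact (Hcd 0%nat).
  exists H. split; [intros x _; apply Hs|]. split; [|split].
  - intros b x Hx Hb. destruct (Hs x) as [Cx _].
    destruct (Req_dec x 0) as [->|Hn]; [rewrite H0; apply closed_zero|].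
    unfold side in Cx. destruct (Rlt_dec x 0), b; simpl in *; lra.
  (* Continuity is proved scale by scale: near [x], the oscillation of [H] at level [S n] is at most
     [th] times its oscillation at level [n] near the image of [x]. *)
  - assert (K : forall n x, inI x -> exists dl, 0 < dl /\ forall y, inI y -> Rabs (y - x) < dl ->
        Rabs (H y - H x) <= th ^ n * 2).
    { induction n; intros x Hx.
      - exists 1. split; [lra|]. intros y _ _. simpl.
        destruct (Hs x) as [_ [A1 A2]], (Hs y) as [_ [A3 A4]]. apply Rabs_le. lra.
      - destruct (IHn (glue F x)) as [d1' [D1 K1]]; [now apply (glue_inI lam)|].
        destruct (proj1 (continuous_eps _ x) (glue_cont lam F x HF) d1' D1) as [d2 [D2 K2]].
        set (dx := if Req_dec_T x 0 then 1 else Rabs x).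
        assert (Dx : 0 < dx).
        { unfold dx. destruct (Req_dec_T x 0); [lra | now apply Rabs_pos_lt]. }
        exists (Rmin d2 dx). split; [now apply Rmin_pos|]. intros y Hy Hd.
        pose proof (Rmin_l d2 dx). pose proof (Rmin_r d2 dx).
        (* Away from 0 the radius [dx] keeps [y] on the side of [x]. At 0 both inverse branches send
           the critical value of [G] to 0, so the side of [y] does not matter. *)
        assert (E : H x = cinv G (side y) (H (glue F x))).
        { destruct (Req_dec x 0) as [->|Hn].
          - rewrite H0. change (glue F 0) with (c 1%nat). rewrite Hcd.
            change (d 1%nat) with (glue G 0). symmetry. apply (cinv_l lam); auto.
            + apply closed_zero.
          - rewrite (HE x) at 1. f_equal.
            unfold dx in *. destruct (Req_dec_T x 0); [tauto|].
            assert (A : Rabs (y - x) < Rabs x) by lra. apply Rabs_def2 in A.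
            unfold side. unfold Rabs in A.
            destruct (Rcase_abs x), (Rlt_dec y 0), (Rlt_dec x 0); auto; lra. }
        rewrite E, (HE y). eapply Rle_trans; [apply (cinv_lip lam); exact HG|].
        fold th. simpl. rewrite Rmult_assoc. apply Rmult_le_compat_l; [lra|].
        apply K1; [now apply (glue_inI lam)|]. apply K2. lra. }
    intros x Hx eps He. destruct (pow_small th 2 eps) as [N HN]; [lra|exact He|].
    destruct (K N x Hx) as [dl [D Kd]]. exists dl. split; [exact D|].
    intros y Hy Hd. eapply Rle_lt_trans; [now apply Kd | now apply HN].
  - intros x Hx. rewrite (HE x) at 1. symmetry. apply (cinv_r lam); auto.
    Unshelve. all: auto.
Qed.

(** Expansivity: [u x] and [x] lie on the same branch at all times, so their distance grows by the
    factor [lam] under iteration while remaining at most 2. *)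
Lemma self_semiconjugacy_id lam F u :
  expanding_pair lam F -> F true 0 <= 1 ->
  (forall x, inI x -> inI (u x)) ->
  (forall b x, inI x -> closed_side b x -> closed_side b (u x)) ->
  (forall x, inI x -> u (glue F x) = glue F (u x)) ->
  forall x, inI x -> u x = x.
Proof.
  intros HF F1 HI HS HE x Hx. pose proof (ep_lam HF) as Hl. pose proof (inv_lam lam Hl) as Hi.
  set (Z := fun x => if excluded_middle_informative (inI x) then u x - x else 0).
  assert (E : forall x, Rabs (Z x) <= 0 / (1 - / lam)).
  { apply (backward_bound (glue F) Z (/ lam) 0 2); try lra.
    - intros y. unfold Z. destruct (excluded_middle_informative (inI y)) as [Hy|].
      + destruct (HI y Hy), Hy. apply Rabs_le. lra.
      + rewrite Rabs_R0. lra.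
    - intros y. unfold Z. destruct (excluded_middle_informative (inI y)) as [Hy|].
      2:{ rewrite Rabs_R0, Rplus_0_r. apply Rmult_le_pos; [lra|apply Rabs_pos]. }
      destruct (excluded_middle_informative (inI (glue F y))) as [_|N].
      2:{ exfalso; apply N. now apply (glue_inI lam). }
      rewrite Rplus_0_r. apply abs_le_inv; [exact Hl|]. rewrite HE by exact Hy.
      rewrite (glue_closed lam F (side y) (u y) HF) by (apply HS; [exact Hy | apply side_closed]).
      apply ep_exp_abs; exact HF. }
  specialize (E x). unfold Z in E. destruct (excluded_middle_informative (inI x)); [|tauto].
  unfold Rdiv in E. rewrite Rmult_0_l in E.
  destruct (Req_dec (u x - x) 0) as [|Hn]; [lra|]. apply Rabs_pos_lt in Hn. lra.
Qed.

Lemma same_sign_sym a b : same_sign a b -> same_sign b a.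
Proof. unfold same_sign; tauto. Qed.

(** The semiconjugacies in the two directions are inverse to each other, because their compositions
    preserve sides and commute with the maps. *)
Lemma conj_of_same_signs lam F G f g :
  expanding_pair lam F -> expanding_pair lam G -> F true 0 <= 1 -> G true 0 <= 1 ->
  (forall x, inI x -> f x = glue F x) -> (forall x, inI x -> g x = glue G x) ->
  (forall i, same_sign (iter i (glue F) 0) (iter i (glue G) 0)) ->
  top_conj f g.
Proof.
  intros HF HG F1 G1 Ef Eg SS.
  destruct (semiconjugacy lam F G HF HG F1 G1 SS) as [h [h1 [h2 [h3 h4]]]].
  destruct (semiconjugacy lam G F HG HF G1 F1 (fun i => same_sign_sym _ _ (SS i)))
    as [k [k1 [k2 [k3 k4]]]].
  split; [intros x Hx; rewrite Ef by exact Hx; now apply (glue_inI lam)|].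
  split; [intros x Hx; rewrite Eg by exact Hx; now apply (glue_inI lam)|].
  exists h, k. repeat split; try (now apply h1); try (now apply k1); auto.
  - apply (self_semiconjugacy_id lam F (fun x => k (h x))); auto.
    intros y Hy. rewrite h4, k4; auto.
  - apply (self_semiconjugacy_id lam G (fun x => h (k x))); auto.
    intros y Hy. rewrite k4, h4; auto.
  - intros x Hx. rewrite Ef, Eg by auto. auto.
Qed.

Lemma cont_within_sub (S T : R -> Prop) g x :
  (forall y, T y -> S y) -> cont_within S g x -> cont_within T g x.
Proof.
  intros HS H eps He. destruct (H eps He) as [d [Hd K]]. exists d. split; auto.
Qed.

Lemma glue_top_pos lam G : expanding_pair lam G -> 0 < G true 0.
Proof.
  intros HG. pose proof (ep_lam HG).
  pose proof (ep_exp HG true (-1) 0 ltac:(lra)) as E. rewrite (ep_l HG) in E.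
  simpl in E. lra.
Qed.

Lemma glue_other_preimage lam G x : expanding_pair lam G -> inI x -> x <> 0 ->
  exists y, inI y /\ y <> x /\ glue G y = glue G x.
Proof.
  intros HG Hx Hn. pose proof (glue_range lam G x HG Hx) as Hr.
  destruct (cinv_in G true (glue G x)) as [C1 I1].
  destruct (cinv_in G false (glue G x)) as [C2 I2].
  destruct (Rlt_dec x 0).
  - exists (cinv G false (glue G x)). split; [exact I2|]. split; [intros Q; rewrite Q in C2; simpl in C2; lra|].
    now apply (cinv_r lam).
  - exists (cinv G true (glue G x)). split; [exact I1|]. split; [intros Q; rewrite Q in C1; simpl in C1; lra|].
    now apply (cinv_r lam).
Qed.

Lemma glue_top_unique lam G x : expanding_pair lam G -> inI x -> glue G x = glue G 0 -> x = 0.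
Proof.
  intros HG Hx E.
  rewrite <- (cinv_l lam G (side x) x HG (side_closed x) Hx), E.
  apply (cinv_l lam); [exact HG | apply closed_zero | unfold inI; lra].
Qed.

(** An injective continuous map fixing 0 cannot change sign on the positive half, so one point [p]
    with a positive image decides its orientation. *)
Lemma conj_pos (h k : R -> R) (p : R) :
  (forall x, inI x -> inI (h x)) -> (forall x, inI x -> k (h x) = x) ->
  (forall x, inI x -> cont_within inI h x) -> h 0 = 0 -> inI p -> 0 < p -> 0 < h p ->
  forall x, inI x -> 0 < x -> 0 < h x.
Proof.
  intros hI hk hc h0 Hp p0 hp x Hx x0.
  destruct (Rlt_dec 0 (h x)) as [|Hn]; [assumption|]. exfalso.
  assert (Z : forall z, inI z -> 0 < z -> h z <> 0).
  { intros z Hz Hz0 E. pose proof (hk z Hz) as E1. rewrite E, <- h0 in E1.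
    rewrite hk in E1 by (unfold inI; lra). lra. }
  unfold inI in *.
  destruct (Rle_dec x p).
  - destruct (ivt_within h x p 0) as [z [[z1 z2] Ez]]; [lra| |left; lra|].
    + intros y [y1 y2]. apply (cont_within_sub inI); [unfold inI, inCC; intros; lra|].
      apply hc. unfold inI; lra.
    + apply (Z z); lra.
  - destruct (ivt_within h p x 0) as [z [[z1 z2] Ez]]; [lra| |right; lra|].
    + intros y [y1 y2]. apply (cont_within_sub inI); [unfold inI, inCC; intros; lra|].
      apply hc. unfold inI; lra.
    + apply (Z z); lra.
Qed.

(** A conjugacy fixes the critical point and maps the critical value, which is positive, to a
    positive critical value; it therefore preserves the order around 0 and the signs of the critical
    orbit. *)
Lemma same_signs_of_conj lam F G f g :
  expanding_pair lam F -> expanding_pair lam G ->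
  (forall x, inI x -> f x = glue F x) -> (forall x, inI x -> g x = glue G x) ->
  top_conj f g ->
  F true 0 <= 1 /\ G true 0 <= 1 /\
  forall i, same_sign (iter i (glue F) 0) (iter i (glue G) 0).
Proof.
  intros HF HG Ef Eg (fI & gI & h & k & hI & kI & hk & kh & hc & kc & E).
  assert (I0 : inI 0) by (unfold inI; lra).
  assert (f0 : f 0 = F true 0) by (rewrite Ef by auto; apply (glue_closed lam); simpl; auto; lra).
  assert (g0 : g 0 = G true 0) by (rewrite Eg by auto; apply (glue_closed lam); simpl; auto; lra).
  assert (F1 : F true 0 <= 1) by (rewrite <- f0; apply fI; auto).
  assert (G1 : G true 0 <= 1) by (rewrite <- g0; apply gI; auto).
  pose proof (glue_top_pos lam F HF) as Fp. pose proof (glue_top_pos lam G HG) as Gp.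
  (* The critical point is the only point of I whose image has no second preimage in I, and a
     conjugacy preserves this property. *)
  assert (h0 : h 0 = 0).
  { destruct (Req_dec (h 0) 0) as [|Hn]; [assumption|]. exfalso.
    destruct (glue_other_preimage lam G (h 0) HG (hI 0 I0) Hn) as [y [Hy [Hny Ey]]].
    rewrite <- !Eg, <- E in Ey by auto.
    rewrite <- (kh y Hy), <- E in Ey by auto.
    assert (Ek : f (k y) = f 0).
    { rewrite <- (hk (f (k y))), Ey, hk; auto. }
    rewrite !Ef in Ek by auto. apply (glue_top_unique lam) in Ek; auto.
    apply Hny. rewrite <- (kh y Hy), Ek. reflexivity. }
  assert (k0 : k 0 = 0) by (rewrite <- h0 at 1; now apply hk).
  assert (hf : h (f 0) = g 0) by (rewrite E, h0 by auto; reflexivity).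
  assert (kg : k (g 0) = f 0) by (rewrite <- hf; apply hk; auto).
  assert (hp : forall x, inI x -> 0 < x -> 0 < h x).
  { apply (conj_pos h k (f 0)); auto; [lra|]. rewrite hf; lra. }
  assert (kp : forall x, inI x -> 0 < x -> 0 < k x).
  { apply (conj_pos k h (g 0)); auto; [lra|]. rewrite kg; lra. }
  assert (hS : forall x, inI x -> same_sign x (h x)).
  { intros x Hx.
    assert (P : 0 < x <-> 0 < h x).
    { split; [now apply hp|]. intros Q. rewrite <- (hk x Hx). apply kp; auto. }
    assert (Q : x = 0 <-> h x = 0).
    { split; [now intros ->|]. intros Q. rewrite <- (hk x Hx), Q. exact k0. }
    split; [|exact P]. split; intros; destruct (Rtotal_order x 0) as [|[|]], (Rtotal_order (h x) 0) as [|[|]]; auto;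
      try tauto; try lra. }
  split; [exact F1|]. split; [exact G1|].
  assert (cI : forall i, inI (iter i (glue F) 0)) by (intros; now apply (iter_inI lam)).
  assert (hi : forall i, h (iter i (glue F) 0) = iter i (glue G) 0).
  { induction i; simpl; [exact h0|]. rewrite <- Ef, E, IHi, Eg; auto. now apply (iter_inI lam). }
  intros i. rewrite <- hi. apply hS. auto.
Qed.

(** * Piecewise smooth functions *)

Lemma deriv_within_eps a b g x l :
  deriv_within a b g x l <->
  (forall eps, 0 < eps -> exists d, 0 < d /\ forall y, inCC a b y -> Rabs (y - x) < d ->
     Rabs (g y - g x - l * (y - x)) <= eps * Rabs (y - x)).
Proof.
  split.
  - intros H eps He. destruct (H eps He) as [d [Hd K]]. exists d. split; [exact Hd|].
    intros y Hy Hyd. destruct (Req_dec y x) as [->|Hn].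
    { rewrite !Rminus_diag, Rmult_0_r, Rminus_0_r, Rabs_R0. lra. }
    specialize (K y Hy Hn Hyd).
    replace (g y - g x - l * (y - x)) with (((g y - g x) / (y - x) - l) * (y - x))
      by (field; lra).
    rewrite Rabs_mult. apply Rmult_le_compat_r; [apply Rabs_pos | lra].
  - intros H eps He. destruct (H (eps / 2) ltac:(lra)) as [d [Hd K]].
    exists d. split; [exact Hd|]. intros y Hy Hn Hyd. specialize (K y Hy Hyd).
    assert (P : 0 < Rabs (y - x)) by (apply Rabs_pos_lt; lra).
    apply (Rmult_lt_reg_r (Rabs (y - x))); [exact P|].
    rewrite <- Rabs_mult.
    replace (((g y - g x) / (y - x) - l) * (y - x)) with (g y - g x - l * (y - x))
      by (field; lra).
    assert (0 < eps / 2 * Rabs (y - x)) by (apply Rmult_lt_0_compat; lra). lra.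
Qed.

Lemma deriv_within_ext a b g g' x l :
  inCC a b x -> (forall y, inCC a b y -> g y = g' y) ->
  deriv_within a b g x l -> deriv_within a b g' x l.
Proof.
  intros Hx E H eps He. destruct (H eps He) as [d [Hd K]]. exists d. split; [exact Hd|].
  intros y Hy. rewrite <- !E by assumption. now apply K.
Qed.

Lemma deriv_within_unique a b g x l l' :
  a < b -> inCC a b x -> deriv_within a b g x l -> deriv_within a b g x l' -> l = l'.
Proof.
  intros Hab [Hx1 Hx2] H H'. destruct (Req_dec l l') as [|Hn]; [assumption|]. exfalso.
  assert (He : 0 < Rabs (l - l') / 2).
  { assert (0 < Rabs (l - l')) by (apply Rabs_pos_lt; lra). lra. }
  destruct (H _ He) as [d [Hd K]], (H' _ He) as [d' [Hd' K']].
  assert (Y : exists y, inCC a b y /\ y <> x /\ Rabs (y - x) < Rmin d d').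
  { assert (M : 0 < Rmin d d') by (now apply Rmin_pos).
    set (m := Rmin d d') in *.
    destruct (Rlt_dec x b).
    - exists (Rmin b (x + m / 2)). unfold inCC.
      assert (x < Rmin b (x + m / 2)) by (apply Rmin_glb_lt; lra).
      pose proof (Rmin_l b (x + m / 2)). pose proof (Rmin_r b (x + m / 2)).
      rewrite Rabs_pos_eq by lra. repeat split; try lra.
    - exists (Rmax a (x - m / 2)). unfold inCC.
      assert (Rmax a (x - m / 2) < x) by (apply Rmax_lub_lt; lra).
      pose proof (Rmax_l a (x - m / 2)). pose proof (Rmax_r a (x - m / 2)).
      rewrite Rabs_left by lra. repeat split; try lra. }
  destruct Y as [y [Hy [Hyx Hd1]]].
  pose proof (Rmin_l d d'). pose proof (Rmin_r d d').
  specialize (K y Hy Hyx ltac:(lra)). specialize (K' y Hy Hyx ltac:(lra)).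
  set (q := (g y - g x) / (y - x)) in *.
  replace (l - l') with ((q - l') - (q - l)) in * by ring.
  pose proof (Rabs_triang (q - l') (- (q - l))) as T. rewrite Rabs_Ropp in T.
  unfold Rminus at 1 in K. unfold Rminus in *. lra.
Qed.

Lemma Dwithin_eq a b g x l :
  a < b -> inCC a b x -> deriv_within a b g x l -> Dwithin a b g x = l.
Proof.
  intros Hab Hx H. apply (deriv_within_unique a b g x); auto.
  apply (epsilon_spec (inhabits 0) (fun l => deriv_within a b g x l)). now exists l.
Qed.

(** [Dpiece] picks derivatives by choice, but derivatives within a nondegenerate interval are
    unique. Any explicit chain of successive derivatives therefore both proves smoothness and
    computes [Dpiece]. *)
Lemma CkOn_intro k a b g (D : nat -> R -> R) :
  a < b -> (forall x, inCC a b x -> D O x = g x) ->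
  (forall i x, (i < k)%nat -> inCC a b x -> deriv_within a b (D i) x (D (S i) x)) ->
  (forall x, inCC a b x -> cont_within (inCC a b) (D k) x) ->
  CkOn k a b g /\ forall i x, (i <= k)%nat -> inCC a b x -> Dpiece a b i g x = D i x.
Proof.
  intros Hab H0 HD Hc.
  assert (E : forall i x, (i <= k)%nat -> inCC a b x -> Dpiece a b i g x = D i x).
  { induction i; intros x Hi Hx; simpl; [symmetry; auto|].
    apply Dwithin_eq; auto. apply (deriv_within_ext a b (D i)); auto.
    intros y Hy. symmetry. apply IHi; [lia|exact Hy]. }
  split; [|exact E]. split.
  - intros i Hi x Hx. rewrite (E (S i)) by (auto; lia).
    apply (deriv_within_ext a b (D i)); auto. intros y Hy. symmetry. apply E; [lia|auto].
  - intros x Hx eps He. destruct (Hc x Hx eps He) as [d [Hd K]]. exists d. split; [exact Hd|].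
    intros y Hy. rewrite !E by auto. auto.
Qed.

Lemma deriv_within_lin a b f g x l m c e :
  deriv_within a b f x l -> deriv_within a b g x m ->
  deriv_within a b (fun y => c * f y + e * g y) x (c * l + e * m).
Proof.
  intros Hf Hg. apply deriv_within_eps. intros eps He.
  set (K := Rabs c + Rabs e + 1).
  assert (HK : 0 < K) by (unfold K; pose proof (Rabs_pos c); pose proof (Rabs_pos e); lra).
  assert (He' : 0 < eps / K) by (apply Rdiv_lt_0_compat; lra).
  destruct (proj1 (deriv_within_eps _ _ _ _ _) Hf _ He') as [d [Hd Kf]].
  destruct (proj1 (deriv_within_eps _ _ _ _ _) Hg _ He') as [d' [Hd' Kg]].
  exists (Rmin d d'). split; [now apply Rmin_pos|]. intros y Hy Hyd.
  pose proof (Rmin_l d d'). pose proof (Rmin_r d d').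
  specialize (Kf y Hy ltac:(lra)). specialize (Kg y Hy ltac:(lra)).
  replace (c * f y + e * g y - (c * f x + e * g x) - (c * l + e * m) * (y - x))
    with (c * (f y - f x - l * (y - x)) + e * (g y - g x - m * (y - x))) by ring.
  eapply Rle_trans; [apply Rabs_triang|]. rewrite !Rabs_mult.
  apply Rle_trans with (Rabs c * (eps / K * Rabs (y - x)) + Rabs e * (eps / K * Rabs (y - x))).
  - apply Rplus_le_compat; (apply Rmult_le_compat_l; [apply Rabs_pos|assumption]).
  - apply Rle_trans with (K * (eps / K * Rabs (y - x))).
    + unfold K at 3. assert (0 <= eps / K * Rabs (y - x)) by (apply Rmult_le_pos; [lra|apply Rabs_pos]). lra.
    + right. field. lra.
Qed.

Lemma cont_within_lin S f g x c e :
  cont_within S f x -> cont_within S g x ->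
  cont_within S (fun y => c * f y + e * g y) x.
Proof.
  intros Hf Hg eps He.
  set (K := Rabs c + Rabs e + 1).
  assert (HK : 0 < K) by (unfold K; pose proof (Rabs_pos c); pose proof (Rabs_pos e); lra).
  assert (He' : 0 < eps / K) by (apply Rdiv_lt_0_compat; lra).
  destruct (Hf _ He') as [d [Hd Kf]]. destruct (Hg _ He') as [d' [Hd' Kg]].
  exists (Rmin d d'). split; [now apply Rmin_pos|]. intros y Hy Hyd.
  pose proof (Rmin_l d d'). pose proof (Rmin_r d d').
  specialize (Kf y Hy ltac:(lra)). specialize (Kg y Hy ltac:(lra)).
  replace (c * f y + e * g y - (c * f x + e * g x))
    with (c * (f y - f x) + e * (g y - g x)) by ring.
  eapply Rle_lt_trans; [apply Rabs_triang|]. rewrite !Rabs_mult.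
  apply Rle_lt_trans with (Rabs c * (eps / K) + Rabs e * (eps / K)).
  - apply Rplus_le_compat; (apply Rmult_le_compat_l; [apply Rabs_pos|lra]).
  - apply Rlt_le_trans with (K * (eps / K)); [|right; field; lra]. unfold K at 3. lra.
Qed.

Lemma CkOn_lin k a b f g c e :
  a < b -> CkOn k a b f -> CkOn k a b g ->
  CkOn k a b (fun x => c * f x + e * g x) /\
  forall i x, (i <= k)%nat -> inCC a b x ->
    Dpiece a b i (fun x => c * f x + e * g x) x = c * Dpiece a b i f x + e * Dpiece a b i g x.
Proof.
  intros Hab [Df Cf] [Dg Cg].
  apply (CkOn_intro k a b _ (fun i x => c * Dpiece a b i f x + e * Dpiece a b i g x)); auto.
  - intros i x Hi Hx. apply deriv_within_lin; auto.
  - intros x Hx. apply cont_within_lin; auto.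
Qed.

Lemma CkOn_ext k a b f g :
  a < b -> (forall x, inCC a b x -> f x = g x) -> CkOn k a b f ->
  CkOn k a b g /\
  forall i x, (i <= k)%nat -> inCC a b x -> Dpiece a b i g x = Dpiece a b i f x.
Proof.
  intros Hab E [Df Cf]. apply (CkOn_intro k a b g (fun i => Dpiece a b i f)); auto.
Qed.

Lemma deriv_within_cont a b g x l : deriv_within a b g x l -> cont_within (inCC a b) g x.
Proof.
  intros H eps He. destruct (proj1 (deriv_within_eps _ _ _ _ _) H 1 Rlt_0_1) as [d [Hd K]].
  set (L := Rabs l + 1). assert (HL : 0 < L) by (unfold L; pose proof (Rabs_pos l); lra).
  exists (Rmin d (eps / L)). split; [apply Rmin_pos; [exact Hd | now apply Rdiv_lt_0_compat]|].
  intros y Hy Hyd. pose proof (Rmin_l d (eps / L)). pose proof (Rmin_r d (eps / L)).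
  specialize (K y Hy ltac:(lra)).
  replace (g y - g x) with ((g y - g x - l * (y - x)) + l * (y - x)) by ring.
  eapply Rle_lt_trans; [apply Rabs_triang|]. rewrite Rabs_mult.
  apply Rle_lt_trans with (L * Rabs (y - x)); [unfold L; lra|].
  apply Rlt_le_trans with (L * (eps / L)); [|right; field; lra].
  apply Rmult_lt_compat_l; lra.
Qed.

Lemma CkOn_cont k a b g i x : CkOn k a b g -> (i <= k)%nat -> inCC a b x ->
  cont_within (inCC a b) (Dpiece a b i g) x.
Proof.
  intros [Hd Hc] Hi Hx. destruct (Nat.eq_dec i k) as [->|]; [auto|].
  eapply deriv_within_cont. apply Hd; [lia|exact Hx].
Qed.

Lemma CkOn_mono k k' a b g : (k' <= k)%nat -> CkOn k a b g -> CkOn k' a b g.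
Proof.
  intros Hk H. split.
  - intros i Hi x Hx. apply (proj1 H); [lia|exact Hx].
  - intros x Hx. apply (CkOn_cont k); auto.
Qed.

Lemma cont_within_bounded a b g : a <= b ->
  (forall x, inCC a b x -> cont_within (inCC a b) g x) ->
  exists M, 0 <= M /\ forall x, inCC a b x -> Rabs (g x) <= M.
Proof.
  intros Hab H.
  destruct (bounded_continuity (fun x => g (clamp a b x)) a b) as [M HM].
  - intros x _. change (continuous (fun x => g (clamp a b x)) x).
    apply continuous_eps. intros eps He.
    destruct (H (clamp a b x) (clamp_in a b x Hab) eps He) as [d [Hd K]].
    exists d. split; [exact Hd|]. intros z Hz. apply K.
    + now apply clamp_in.
    + eapply Rle_lt_trans; [apply clamp_lip | exact Hz].
  - exists (Rabs M). split; [apply Rabs_pos|]. intros x Hx. specialize (HM x Hx).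
    rewrite clamp_id in HM by exact Hx. pose proof (Rle_abs M).
    unfold norm in HM; simpl in HM. unfold abs in HM; simpl in HM. lra.
Qed.

Definition lo (b : bool) : R := if b then -1 else 0.
Definition hi (b : bool) : R := if b then 0 else 1.
Definition half (b : bool) : R -> Prop := inCC (lo b) (hi b).
Definition Dhalf (b : bool) (i : nat) (g : R -> R) : R -> R := Dpiece (lo b) (hi b) i g.
Definition Ck_half (k : nat) (b : bool) (g : R -> R) : Prop := CkOn k (lo b) (hi b) g.

Lemma lo_hi b : lo b < hi b.
Proof. destruct b; simpl; lra. Qed.

Lemma half_inI b x : half b x -> inI x.
Proof. destruct b; unfold half, inCC, inI; simpl; lra. Qed.

Lemma half_of b x : closed_side b x -> inI x -> half b x.
Proof. destruct b; unfold half, inCC, inI; simpl; lra. Qed.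

Lemma in_Bk_half k g b : in_Bk k g -> Ck_half k b g.
Proof. intros [H1 [H2 _]]. destruct b; assumption. Qed.

Lemma in_Bk_intro k g : (forall b, Ck_half k b g) -> g (-1) = g 1 -> in_Bk k g.
Proof. intros H E. split; [apply (H true)|]. split; [apply (H false)|exact E]. Qed.

Lemma normk_le_iff k g M :
  normk_le k g M <-> (forall b, Ck_half k b g) /\
    forall b i x, (i <= k)%nat -> half b x -> Rabs (Dhalf b i g x) <= M.
Proof.
  split.
  - intros [H1 [H2 H3]]. split; [intros []; assumption|].
    intros b i x Hi Hx. destruct (H3 i Hi) as [A B]. destruct b; [apply A|apply B]; exact Hx.
  - intros [H1 H2]. split; [apply (H1 true)|]. split; [apply (H1 false)|].
    intros i Hi. split; intros x Hx; [apply (H2 true)|apply (H2 false)]; auto.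
Qed.

Lemma Ck_half_lin k b f g c e : Ck_half k b f -> Ck_half k b g ->
  Ck_half k b (fun x => c * f x + e * g x) /\
  forall i x, (i <= k)%nat -> half b x ->
    Dhalf b i (fun x => c * f x + e * g x) x = c * Dhalf b i f x + e * Dhalf b i g x.
Proof. intros. apply CkOn_lin; auto. apply lo_hi. Qed.

Lemma Ck_half_ext k b f g : (forall x, half b x -> f x = g x) -> Ck_half k b f ->
  Ck_half k b g /\ forall i x, (i <= k)%nat -> half b x -> Dhalf b i g x = Dhalf b i f x.
Proof. intros. apply CkOn_ext; auto. apply lo_hi. Qed.

Lemma in_Bk_lin k f g c e : in_Bk k f -> in_Bk k g -> in_Bk k (fun x => c * f x + e * g x).
Proof.
  intros Hf Hg. apply in_Bk_intro.
  - intros b. apply Ck_half_lin; now apply in_Bk_half.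
  - destruct Hf as [_ [_ Ef]], Hg as [_ [_ Eg]]. rewrite Ef, Eg. reflexivity.
Qed.

Lemma Ck_half_bounded k b g : Ck_half k b g ->
  exists M, 0 <= M /\ forall i x, (i <= k)%nat -> half b x -> Rabs (Dhalf b i g x) <= M.
Proof.
  intros H.
  assert (A : forall n, (n <= k)%nat -> exists M, 0 <= M /\
      forall i x, (i <= n)%nat -> half b x -> Rabs (Dhalf b i g x) <= M).
  { induction n; intros Hn.
    - destruct (cont_within_bounded (lo b) (hi b) (Dhalf b 0 g)) as [M [M0 HM]].
      + left; apply lo_hi.
      + intros x Hx. apply (CkOn_cont k); auto.
      + exists M. split; [exact M0|]. intros i x Hi Hx. replace i with O by lia. auto.
    - destruct (IHn ltac:(lia)) as [M [M0 HM]].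
      destruct (cont_within_bounded (lo b) (hi b) (Dhalf b (S n) g)) as [M' [M0' HM']].
      + left; apply lo_hi.
      + intros x Hx. apply (CkOn_cont k); auto.
      + exists (M + M'). split; [lra|]. intros i x Hi Hx.
        destruct (Nat.eq_dec i (S n)) as [->|].
        * specialize (HM' x Hx). lra.
        * specialize (HM i x ltac:(lia) Hx). lra. }
  exact (A k (Nat.le_refl k)).
Qed.

Lemma in_Bk_norm k g : in_Bk k g -> exists M, 0 <= M /\ normk_le k g M.
Proof.
  intros H. destruct (Ck_half_bounded k true g (in_Bk_half k g true H)) as [M [M0 HM]].
  destruct (Ck_half_bounded k false g (in_Bk_half k g false H)) as [M' [M0' HM']].
  exists (M + M'). split; [lra|]. apply normk_le_iff. split; [intros; now apply in_Bk_half|].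
  intros b i x Hi Hx. destruct b.
  - specialize (HM i x Hi Hx). lra.
  - specialize (HM' i x Hi Hx). lra.
Qed.

(* The C^1 extension of a branch to the whole line by its boundary tangents, linear in u. *)
Definition ext (b : bool) (u : R -> R) (x : R) : R :=
  let c := clamp (lo b) (hi b) x in u c + Dhalf b 1 u c * (x - c).

Definition Dext (b : bool) (u : R -> R) (x : R) : R := Dhalf b 1 u (clamp (lo b) (hi b) x).

Lemma clamp_half b x : half b (clamp (lo b) (hi b) x).
Proof. apply clamp_in. left; apply lo_hi. Qed.

Lemma ext_in b u x : half b x -> ext b u x = u x.
Proof. intros H. unfold ext. rewrite clamp_id by exact H. ring. Qed.

Lemma Dext_in b u x : half b x -> Dext b u x = Dhalf b 1 u x.
Proof. intros H. unfold Dext. rewrite clamp_id by exact H. ring. Qed.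

(** This dichotomy controls the cross term (D(cl y) - D(cl x)) (y - cl y) in the derivative of the
    tangent extension: either the first factor vanishes, or the second is at most [|y - x|] and the
    first is small by continuity. *)
Lemma clamp_far a b x y : clamp a b x = clamp a b y \/ Rabs (y - clamp a b y) <= Rabs (y - x).
Proof.
  unfold clamp, Rmax, Rmin, Rabs.
  repeat destruct (Rle_dec _ _); repeat destruct (Rcase_abs _);
   try (left; lra); right; lra.
Qed.

Lemma ext_derive b u x : Ck_half 1 b u -> is_derive (ext b u) x (Dext b u x).
Proof.
  intros H. apply is_derive_eps. intros eps He.
  set (cl := clamp (lo b) (hi b)).
  destruct (proj1 (deriv_within_eps _ _ _ _ _) (proj1 H O Nat.lt_0_1 _ (clamp_half b x)) (eps/2)) as [d [Hd K]]; [lra|].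
  destruct (proj2 H _ (clamp_half b x) (eps / 2)) as [d' [Hd' K']]; [lra|].
  exists (Rmin d d'). split; [now apply Rmin_pos|]. intros y Hy.
  pose proof (Rmin_l d d'). pose proof (Rmin_r d d').
  pose proof (clamp_lip (lo b) (hi b) x y) as L. fold cl in K, K', L.
  specialize (K (cl y) (clamp_half b y) ltac:(lra)).
  specialize (K' (cl y) (clamp_half b y) ltac:(lra)).
  unfold ext, Dext. fold cl. unfold Dhalf. simpl Dpiece in *.
  set (D := Dwithin (lo b) (hi b) u) in *.
  replace (u (cl y) + D (cl y) * (y - cl y) - (u (cl x) + D (cl x) * (x - cl x)) - D (cl x) * (y - x))
    with ((u (cl y) - u (cl x) - D (cl x) * (cl y - cl x)) + (D (cl y) - D (cl x)) * (y - cl y)) by ring.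
  eapply Rle_trans; [apply Rabs_triang|].
  assert (A1 : eps / 2 * Rabs (cl y - cl x) <= eps / 2 * Rabs (y - x)).
  { apply Rmult_le_compat_l; lra. }
  assert (A2 : Rabs ((D (cl y) - D (cl x)) * (y - cl y)) <= eps / 2 * Rabs (y - x)).
  { destruct (clamp_far (lo b) (hi b) x y) as [E|E]; fold cl in E.
    - rewrite E, Rminus_diag, Rmult_0_l, Rabs_R0.
      apply Rmult_le_pos; [lra|apply Rabs_pos].
    - rewrite Rabs_mult. apply Rmult_le_compat; try apply Rabs_pos; lra. }
  lra.
Qed.

(** * Coded orbits in a two-parameter family *)

(** The dependence on s is exactly affine, with direction [W]. The constant [C] bounds both [W] and
    the Lipschitz constant in t, only where bounded coded orbits can live. Continuity of [DG] is
    asked for at (0, 0) alone, with a radius depending on the point, because only finitely many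
    points of the reference orbit are ever compared. *)
Record parameter_family (lam C d : R) (G DG : R -> R -> bool -> R -> R) (W : bool -> R -> R) : Prop := {
  pf_d : 0 < d;
  pf_C : 0 <= C;
  pf_ep : forall t s, Rabs t < d -> Rabs s < d -> expanding_pair lam (G t s);
  pf_der : forall t s b x, Rabs t < d -> Rabs s < d -> is_derive (G t s b) x (DG t s b x);
  pf_big : forall t s b x, Rabs t < d -> Rabs s < d -> lam <= Rabs (DG t s b x);
  pf_s : forall t s s' b x, G t s b x - G t s' b x = (s - s') * W b x;
  pf_W : forall b x, Rabs x <= orbit_bound lam -> Rabs (W b x) <= C;
  pf_t : forall t t' s b x, Rabs t < d -> Rabs t' < d -> Rabs x <= orbit_bound lam ->
     Rabs (G t s b x - G t' s b x) <= C * Rabs (t - t');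
  pf_DGc : forall b x eps, 0 < eps -> exists eta, 0 < eta /\ forall t s y,
     Rabs t < d -> Rabs s < d -> Rabs t < eta -> Rabs s < eta -> Rabs (y - x) < eta ->
     Rabs (DG t s b y - DG 0 0 b x) < eps;
  pf_Wc : forall b x, continuous (W b) x }.

Arguments pf_d {_ _ _ _ _ _}.
Arguments pf_C {_ _ _ _ _ _}.
Arguments pf_ep {_ _ _ _ _ _}.
Arguments pf_der {_ _ _ _ _ _}.
Arguments pf_big {_ _ _ _ _ _}.
Arguments pf_s {_ _ _ _ _ _}.
Arguments pf_W {_ _ _ _ _ _}.
Arguments pf_t {_ _ _ _ _ _}.
Arguments pf_DGc {_ _ _ _ _ _}.
Arguments pf_Wc {_ _ _ _ _ _}.

Definition is_orbit (lam : R) (G : bool -> R -> R) (eps : nat -> bool) (X : nat -> R) : Prop :=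
  (forall i, Rabs (X i) <= orbit_bound lam) /\ forall i, G (eps i) (X i) = X (S i).

(* The unique bounded orbit of the extended branches with itinerary eps. *)
Definition coded_orbit (lam : R) (G : bool -> R -> R) (eps : nat -> bool) : nat -> R :=
  epsilon (inhabits (fun _ => 0)) (is_orbit lam G eps).

Lemma coded_orbit_spec lam G eps : expanding_pair lam G -> is_orbit lam G eps (coded_orbit lam G eps).
Proof. intros HG. apply (epsilon_spec (inhabits (fun _ => 0)) (is_orbit lam G eps)). now apply orbit_exists. Qed.

Lemma coded_orbit_eq lam G eps X i : expanding_pair lam G -> is_orbit lam G eps X -> coded_orbit lam G eps i = X i.
Proof.
  intros HG [XB XE]. destruct (coded_orbit_spec lam G eps HG) as [YB YE].
  apply (orbit_unique lam G eps _ _ (orbit_bound lam) HG); auto.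
Qed.

Lemma finite_uniform_radius (P : nat -> R -> Prop) :
  (forall i, exists eta, 0 < eta /\ forall eta', 0 < eta' -> eta' <= eta -> P i eta') ->
  forall m, exists eta, 0 < eta /\ forall i eta', (i < m)%nat -> 0 < eta' -> eta' <= eta -> P i eta'.
Proof.
  intros H m. induction m.
  - exists 1. split; [lra|]. intros; lia.
  - destruct IHm as [e1 [E1 K1]]. destruct (H m) as [e2 [E2 K2]].
    exists (Rmin e1 e2). split; [now apply Rmin_pos|]. intros i eta' Hi H0 Hle.
    pose proof (Rmin_l e1 e2). pose proof (Rmin_r e1 e2).
    destruct (Nat.eq_dec i m) as [->|]; [apply K2; lra|apply K1; [lia|lra|lra]].
Qed.

(** The linearisation of the orbit in s, solved backwards: X_(i+1) = G(X_i) gives Z_(i+1) = DG Z_i +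
    W, hence this form with [r] = 1 / DG and [p] = W. Difference quotients in s satisfy it as well,
    with DG taken at mean value points. *)
Definition lin_sol (r p Z : nat -> R) : Prop := forall i, Z i = r i * (Z (S i) - p i).

Lemma lin_sol_exists r p th C : 0 <= th < 1 -> 0 <= C ->
  (forall i, Rabs (r i) <= th) -> (forall i, Rabs (p i) <= C) ->
  exists Z, lin_sol r p Z /\ forall i, Rabs (Z i) <= th * C / (1 - th).
Proof.
  intros Hth HC Hr Hp.
  assert (M0 : 0 <= th * C / (1 - th)).
  { apply Rmult_le_pos; [apply Rmult_le_pos; lra|]. left; apply Rinv_0_lt_compat; lra. }
  destruct (contraction_system S (fun i y => r i * (y - p i)) th (th * C / (1 - th))) as [Z [ZB ZE]]; auto.
  - intros i y z. replace (r i * (y - p i) - r i * (z - p i)) with (r i * (y - z)) by ring.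
    rewrite Rabs_mult. apply Rmult_le_compat_r; [apply Rabs_pos|apply Hr].
  - intros i y Hy. rewrite Rabs_mult.
    replace (th * C / (1 - th)) with (th * (th * C / (1 - th) + C)) by (field; lra).
    apply Rmult_le_compat; try apply Rabs_pos; auto.
    eapply Rle_trans; [apply Rabs_minus_le|].
    specialize (Hp i). apply Rplus_le_compat; assumption.
  - exists Z. split; auto.
Qed.

Lemma lin_sol_bound r p Z th C B : 0 <= th < 1 -> 0 <= C ->
  (forall i, Rabs (r i) <= th) -> (forall i, Rabs (p i) <= C) ->
  lin_sol r p Z -> (forall i, Rabs (Z i) <= B) ->
  forall i, Rabs (Z i) <= th * C / (1 - th).
Proof.
  intros Hth HC Hr Hp HZ HB.
  apply (backward_bound S Z th (th * C) B); auto.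
  - apply Rmult_le_pos; lra.
  - intros i. rewrite (HZ i) at 1. rewrite Rabs_mult.
    rewrite <- Rmult_plus_distr_l. apply Rmult_le_compat; try apply Rabs_pos; auto.
    eapply Rle_trans; [apply Rabs_minus_le|].
    specialize (Hp i). lra.
Qed.

(** Coefficients beyond time [m] enter [Z 0] with the weight [th ^ m]. Closeness of finitely many
    coefficients is therefore enough, although nothing is known about the others except their
    bounds. *)
Lemma lin_sol_close r0 p0 Z0 th C B kap :
  0 <= th < 1 -> 0 <= C -> 0 < kap ->
  (forall i, Rabs (p0 i) <= C) -> (forall i, Rabs (Z0 i) <= B) -> lin_sol r0 p0 Z0 ->
  exists m eta, 0 < eta /\ forall r p Z,
    (forall i, Rabs (r i) <= th) -> (forall i, Rabs (Z i) <= B) -> lin_sol r p Z ->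
    (forall i, (i < m)%nat -> Rabs (r i - r0 i) <= eta /\ Rabs (p i - p0 i) <= eta) ->
    Rabs (Z 0%nat - Z0 0%nat) < kap.
Proof.
  intros Hth HC Hk Hp0 HB0 H0.
  assert (B0 : 0 <= B) by (eapply Rle_trans; [apply Rabs_pos|apply (HB0 0%nat)]).
  destruct (pow_small th (2 * B) (kap / 2) Hth) as [m Hm]; [lra|].
  (* An error [eta] in each coefficient produces a forcing of at most [eta * (B + C + 1)]; after
     summation this is below [kap / 2], and the tail uses the other half. *)
  set (eta := kap / 2 * (1 - th) / (B + C + 2)).
  assert (He : 0 < eta).
  { unfold eta. apply Rdiv_lt_0_compat; [apply Rmult_lt_0_compat; lra|lra]. }
  exists m, eta. split; [exact He|]. intros r p Z Hr HB HZ Hc.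
  assert (E : Rabs (Z 0%nat - Z0 0%nat) <= th ^ (m - 0) * (2 * B) + eta * (B + C + 1) / (1 - th)).
  { apply (backward_trunc_nat (fun i => Z i - Z0 i)); auto; try lia.
    - apply Rmult_le_pos; lra.
    - intros j Hj. destruct (Hc j Hj) as [C1 C2]. rewrite (HZ j), (H0 j) at 1.
      replace (r j * (Z (S j) - p j) - r0 j * (Z0 (S j) - p0 j))
        with (r j * (Z (S j) - Z0 (S j)) + (r j * - (p j - p0 j) + (r j - r0 j) * (Z0 (S j) - p0 j))) by ring.
      eapply Rle_trans; [apply Rabs_triang|]. apply Rplus_le_compat.
      + rewrite Rabs_mult. apply Rmult_le_compat_r; [apply Rabs_pos|auto].
      + eapply Rle_trans; [apply Rabs_triang|]. rewrite !Rabs_mult, Rabs_Ropp.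
        replace (eta * (B + C + 1)) with (1 * eta + eta * (B + C)) by ring.
        apply Rplus_le_compat.
        * apply Rmult_le_compat; try apply Rabs_pos; auto. specialize (Hr j). lra.
        * apply Rmult_le_compat; try apply Rabs_pos; auto.
          eapply Rle_trans; [apply Rabs_minus_le|].
          apply Rplus_le_compat; auto.
    - eapply Rle_trans; [apply Rabs_minus_le|].
      specialize (HB m). specialize (HB0 m). lra. }
  specialize (Hm (m - 0)%nat ltac:(lia)).
  assert (E2 : eta * (B + C + 1) / (1 - th) <= kap / 2).
  { replace (eta * (B + C + 1) / (1 - th)) with (kap / 2 * ((B + C + 1) / (B + C + 2)))
      by (unfold eta; field; lra).
    rewrite <- (Rmult_1_r (kap / 2)) at 2. apply Rmult_le_compat_l; [lra|].
    apply Rmult_le_reg_r with (B + C + 2); [lra|]. unfold Rdiv.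
    rewrite Rmult_assoc, Rinv_l; lra. }
  lra.
Qed.

Lemma inv_close lam a b : 1 < lam -> lam <= Rabs a -> lam <= Rabs b ->
  Rabs (/ a - / b) <= Rabs (a - b).
Proof.
  intros Hl Ha Hb.
  assert (a <> 0) by (intros ->; rewrite Rabs_R0 in Ha; lra).
  assert (b <> 0) by (intros ->; rewrite Rabs_R0 in Hb; lra).
  replace (/ a - / b) with ((b - a) * (/ a * / b)) by (field; auto).
  rewrite Rabs_mult, (Rabs_minus_sym b). apply Rle_trans with (Rabs (a - b) * 1); [|lra].
  apply Rmult_le_compat_l; [apply Rabs_pos|]. rewrite Rabs_mult, !Rabs_inv.
  rewrite <- (Rmult_1_l 1).
  assert (/ Rabs a <= 1) by (rewrite <- Rinv_1; apply Rinv_le_contravar; lra).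
  assert (/ Rabs b <= 1) by (rewrite <- Rinv_1; apply Rinv_le_contravar; lra).
  assert (0 < / Rabs a) by (apply Rinv_0_lt_compat; lra).
  assert (0 < / Rabs b) by (apply Rinv_0_lt_compat; lra).
  apply Rmult_le_compat; lra.
Qed.

Lemma inv_small lam a : 1 < lam -> lam <= Rabs a -> Rabs (/ a) <= / lam.
Proof. intros Hl Ha. rewrite Rabs_inv. apply Rinv_le_contravar; lra. Qed.

Section Parameter_family.
Variables (lam C d : R) (G DG : R -> R -> bool -> R -> R) (W : bool -> R -> R).
Hypothesis PF : parameter_family lam C d G DG W.
Variables (e0 : nat -> bool) (c : nat -> R).
Hypothesis cO : is_orbit lam (G 0 0) e0 c.

Let th := / lam.
Let X (e : nat -> bool) (t s : R) : nat -> R := coded_orbit lam (G t s) e.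

Lemma pf_lam : 1 < lam.
Proof.
  pose proof (pf_d PF).
  apply (@ep_lam lam (G 0 0)), (pf_ep PF); rewrite Rabs_R0; auto.
Qed.

Lemma th_bnd : 0 < th < 1.
Proof. apply inv_lam, pf_lam. Qed.

Lemma coded_orbit_is_orbit e t s : Rabs t < d -> Rabs s < d -> is_orbit lam (G t s) e (X e t s).
Proof. intros. apply coded_orbit_spec, (pf_ep PF); auto. Qed.

(** The reference orbit is a pseudo-orbit of the perturbed branches with error C (|t| + |s|).
    Agreement of the codes for [m + n0] steps leaves at least [n0] contracting steps after each
    index below [m], which absorbs the unknown tail. *)
Lemma coded_orbit_close (m : nat) (eta : R) : 0 < eta ->
  exists N dl, 0 < dl /\ dl <= d /\ forall e t s, (forall i, (i < N)%nat -> e i = e0 i) ->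
    Rabs t < dl -> Rabs s < dl -> forall i, (i < m)%nat -> Rabs (X e t s i - c i) < eta.
Proof.
  intros He. pose proof th_bnd as Ht. pose proof pf_lam as Hl. pose proof (pf_d PF) as Hd.
  pose proof (pf_C PF) as HC.
  destruct (pow_small th (2 * orbit_bound lam) (eta / 2)) as [n0 Hn0]; [lra|lra|].
  set (dl := Rmin d (eta / 8 * (1 - th) / (C + 1))).
  assert (D1 : 0 < eta / 8 * (1 - th) / (C + 1)).
  { apply Rdiv_lt_0_compat; [apply Rmult_lt_0_compat; lra|lra]. }
  exists (m + n0)%nat, dl. split; [now apply Rmin_pos|]. split; [apply Rmin_l|].
  intros e t s Hag Hts Hss i Hi.
  pose proof (Rmin_l d (eta / 8 * (1 - th) / (C + 1))).
  pose proof (Rmin_r d (eta / 8 * (1 - th) / (C + 1))). fold dl in H, H0.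
  assert (Ht1 : Rabs t < d) by lra. assert (Hs1 : Rabs s < d) by lra.
  destruct (coded_orbit_is_orbit e t s Ht1 Hs1) as [XB XE]. destruct cO as [cB cE].
  assert (E : Rabs (X e t s i - c i) <= th ^ (m + n0 - i) * (2 * orbit_bound lam) + C * (Rabs t + Rabs s) / (1 - th)).
  { apply (backward_trunc_nat (fun i => X e t s i - c i)); try lra; try lia.
    - apply Rmult_le_pos; [lra|]. pose proof (Rabs_pos t). pose proof (Rabs_pos s). lra.
    - intros j Hj.
      set (P := G t s (e j) (c j) - G 0 0 (e j) (c j)).
      assert (HP : Rabs P <= C * (Rabs t + Rabs s)).
      { unfold P. replace (G t s (e j) (c j) - G 0 0 (e j) (c j)) with
          ((G t s (e j) (c j) - G 0 s (e j) (c j)) + (G 0 s (e j) (c j) - G 0 0 (e j) (c j))) by ring.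
        eapply Rle_trans; [apply Rabs_triang|]. rewrite Rmult_plus_distr_l. apply Rplus_le_compat.
        - pose proof (pf_t PF t 0 s (e j) (c j)) as Q. rewrite Rminus_0_r in Q.
          apply Q; auto. rewrite Rabs_R0; auto.
        - rewrite (pf_s PF), Rminus_0_r, Rabs_mult, Rmult_comm.
          apply Rmult_le_compat_r; [apply Rabs_pos|]. apply (pf_W PF); auto. }
      assert (Q : Rabs (X e t s j - c j) <= th * Rabs (X e t s (S j) - c (S j) - P)).
      { apply abs_le_inv; [exact Hl|].
        eapply Rle_trans; [apply (ep_exp_abs lam (G t s) (e j)), (pf_ep PF); auto|].
        right. f_equal. unfold P. rewrite XE, (Hag j Hj), cE. ring. }
      eapply Rle_trans; [exact Q|].
      assert (Q2 : Rabs (X e t s (S j) - c (S j) - P) <= Rabs (X e t s (S j) - c (S j)) + C * (Rabs t + Rabs s)).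
      { unfold Rminus at 1. eapply Rle_trans; [apply Rabs_triang|]. rewrite Rabs_Ropp. lra. }
      apply (Rmult_le_compat_l th) in Q2; [|lra]. pose proof (Rabs_pos P).
      assert (th * (C * (Rabs t + Rabs s)) <= 1 * (C * (Rabs t + Rabs s))) by (apply Rmult_le_compat_r; lra).
      lra.
    - eapply Rle_trans; [apply Rabs_minus_le|].
      specialize (XB (m + n0)%nat). specialize (cB (m + n0)%nat). lra. }
  specialize (Hn0 (m + n0 - i)%nat ltac:(lia)).
  assert (E2 : C * (Rabs t + Rabs s) / (1 - th) < eta / 2).
  { apply (Rmult_lt_reg_r (1 - th)); [lra|]. unfold Rdiv at 1. rewrite Rmult_assoc, Rinv_l, Rmult_1_r by lra.
    apply Rle_lt_trans with ((C + 1) * (2 * (eta / 8 * (1 - th) / (C + 1)))).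
    - pose proof (Rabs_pos t). pose proof (Rabs_pos s). apply Rmult_le_compat; lra.
    - replace ((C + 1) * (2 * (eta / 8 * (1 - th) / (C + 1)))) with (eta / 4 * (1 - th)) by (field; lra).
      apply Rmult_lt_compat_r; lra. }
  lra.
Qed.

Definition inv_slopes (i : nat) : R := / DG 0 0 (e0 i) (c i).
Definition forcing (i : nat) : R := W (e0 i) (c i).
Variable Z0 : nat -> R.
Hypothesis HZ0 : lin_sol inv_slopes forcing Z0.
Hypothesis BZ0 : forall i, Rabs (Z0 i) <= th * C / (1 - th).

(** The slopes are taken at points [xi] and the forcing at points [y], so that one statement covers
    both the derivative, where these coincide, and the difference quotient, where [xi] comes from
    the mean value theorem. *)
Lemma trans_close (kap : R) : 0 < kap ->
  exists m eta, 0 < eta /\ forall e t s xi y Z B,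
    (forall i, (i < m)%nat -> e i = e0 i) ->
    Rabs t < d -> Rabs s < d -> Rabs t < eta -> Rabs s < eta ->
    (forall i, (i < m)%nat -> Rabs (xi i - c i) < eta /\ Rabs (y i - c i) < eta) ->
    (forall i, Rabs (y i) <= orbit_bound lam) -> (forall i, Rabs (Z i) <= B) ->
    lin_sol (fun i => / DG t s (e i) (xi i)) (fun i => W (e i) (y i)) Z ->
    Rabs (Z 0%nat - Z0 0%nat) < kap.
Proof.
  intros Hk. pose proof th_bnd as Ht. pose proof pf_lam as Hl. pose proof (pf_d PF) as Hd.
  pose proof (pf_C PF) as HC. destruct cO as [cB cE].
  destruct (lin_sol_close inv_slopes forcing Z0 th C (th * C / (1 - th)) kap) as [m [eta1 [He1 K]]]; auto; try lra.
  { intros i. apply (pf_W PF); auto. }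
  destruct (finite_uniform_radius (fun i eta =>
     (forall t s y, Rabs t < d -> Rabs s < d -> Rabs t < eta -> Rabs s < eta -> Rabs (y - c i) < eta ->
       Rabs (DG t s (e0 i) y - DG 0 0 (e0 i) (c i)) < eta1) /\
     (forall y, Rabs (y - c i) < eta -> Rabs (W (e0 i) y - W (e0 i) (c i)) < eta1))) with m as [eta [He KE]].
  { intros i. destruct (pf_DGc PF (e0 i) (c i) eta1 He1) as [a [Ha Ka]].
    destruct (proj1 (continuous_eps _ _) (pf_Wc PF (e0 i) (c i)) eta1 He1) as [a' [Ha' Ka']].
    exists (Rmin a a'). split; [now apply Rmin_pos|]. intros eta' _ Hle.
    pose proof (Rmin_l a a'). pose proof (Rmin_r a a'). split.
    - intros. apply Ka; auto; lra.
    - intros. apply Ka'; lra. }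
  exists m, eta. split; [exact He|]. intros e t s xi y Z B Hag Ht1 Hs1 Ht2 Hs2 Hxy Hy HB HZ.
  assert (Hr : forall i, Rabs (/ DG t s (e i) (xi i)) <= th).
  { intros i. apply inv_small; [exact Hl|]. apply (pf_big PF); auto. }
  apply (K (fun i => / DG t s (e i) (xi i)) (fun i => W (e i) (y i))); auto.
  - apply (lin_sol_bound (fun i => / DG t s (e i) (xi i)) (fun i => W (e i) (y i)) Z th C B); auto; try lra.
    intros i. apply (pf_W PF); auto.
  - intros i Hi. destruct (KE i eta Hi He (Rle_refl _)) as [K1 K2]. destruct (Hxy i Hi) as [A1 A2].
    rewrite (Hag i Hi). split.
    + unfold inv_slopes. eapply Rle_trans; [apply (inv_close lam); auto; apply (pf_big PF); auto; rewrite Rabs_R0; auto|].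
      left. apply K1; auto.
    + left. apply K2; auto.
Qed.

(** Shadowing: an orbit of one map is a pseudo-orbit of the other with error [K], and backward
    contraction sums the errors. *)
Lemma coded_orbit_perturb e t t' s s' K : Rabs t < d -> Rabs t' < d -> Rabs s < d -> Rabs s' < d -> 0 <= K ->
  (forall b x, Rabs x <= orbit_bound lam -> Rabs (G t s b x - G t' s' b x) <= K) ->
  forall i, Rabs (X e t s i - X e t' s' i) <= K / (1 - th).
Proof.
  intros Ht1 Ht1' Hs1 Hs1' HK HG. pose proof th_bnd as Ht. pose proof pf_lam as Hl.
  destruct (coded_orbit_is_orbit e t s Ht1 Hs1) as [XB XE]. destruct (coded_orbit_is_orbit e t' s' Ht1' Hs1') as [YB YE].
  apply (backward_bound S (fun i => X e t s i - X e t' s' i) th K (2 * orbit_bound lam)); try lra.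
  - intros j. eapply Rle_trans; [apply Rabs_minus_le|].
    specialize (XB j). specialize (YB j). lra.
  - intros j.
    set (P := G t s (e j) (X e t' s' j) - G t' s' (e j) (X e t' s' j)).
    assert (HP : Rabs P <= K) by (apply HG; auto).
    assert (Q : Rabs (X e t s j - X e t' s' j) <= th * Rabs (X e t s (S j) - X e t' s' (S j) - P)).
    { apply abs_le_inv; [exact Hl|].
      eapply Rle_trans; [apply (ep_exp_abs lam (G t s) (e j)), (pf_ep PF); auto|].
      right. f_equal. unfold P. rewrite XE, YE. ring. }
    eapply Rle_trans; [exact Q|].
    assert (Q2 : Rabs (X e t s (S j) - X e t' s' (S j) - P) <= Rabs (X e t s (S j) - X e t' s' (S j)) + K).
    { unfold Rminus at 1. eapply Rle_trans; [apply Rabs_triang|]. rewrite Rabs_Ropp. lra. }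
    apply (Rmult_le_compat_l th) in Q2; [|lra].
    assert (th * K <= 1 * K) by (apply Rmult_le_compat_r; lra).
    lra.
Qed.

Lemma coded_orbit_lip_t e t t' s i : Rabs t < d -> Rabs t' < d -> Rabs s < d ->
  Rabs (X e t s i - X e t' s i) <= C * Rabs (t - t') / (1 - th).
Proof.
  intros Ht1 Ht1' Hs1. pose proof (pf_C PF) as HC.
  apply coded_orbit_perturb; auto.
  - apply Rmult_le_pos; [lra|apply Rabs_pos].
  - intros b x Hx. apply (pf_t PF); auto.
Qed.

Lemma coded_orbit_lip_s e t s s' i : Rabs t < d -> Rabs s < d -> Rabs s' < d ->
  Rabs (X e t s i - X e t s' i) <= C * Rabs (s - s') / (1 - th).
Proof.
  intros Ht1 Hs1 Hs1'. pose proof (pf_C PF) as HC.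
  apply coded_orbit_perturb; auto.
  - apply Rmult_le_pos; [lra|apply Rabs_pos].
  - intros b x Hx. rewrite (pf_s PF), Rabs_mult, Rmult_comm.
    apply Rmult_le_compat_r; [apply Rabs_pos|]. apply (pf_W PF); auto.
Qed.

Lemma coded_orbit_agree e e' t s N i : Rabs t < d -> Rabs s < d -> (i <= N)%nat ->
  (forall j, (j < N)%nat -> e j = e' j) ->
  Rabs (X e t s i - X e' t s i) <= th ^ (N - i) * (2 * orbit_bound lam).
Proof.
  intros Ht1 Hs1 HiN Hag. pose proof th_bnd as Ht. pose proof pf_lam as Hl.
  destruct (coded_orbit_is_orbit e t s Ht1 Hs1) as [XB XE]. destruct (coded_orbit_is_orbit e' t s Ht1 Hs1) as [YB YE].
  replace (th ^ (N - i) * (2 * orbit_bound lam)) with (th ^ (N - i) * (2 * orbit_bound lam) + 0 / (1 - th)) by (field; lra).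
  apply (backward_trunc_nat (fun i => X e t s i - X e' t s i)); try lra; auto.
  - intros j Hj. rewrite Rplus_0_r. apply abs_le_inv; [exact Hl|].
    eapply Rle_trans; [apply (ep_exp_abs lam (G t s) (e j)), (pf_ep PF); auto|].
    right. rewrite XE, (Hag j Hj), YE. reflexivity.
  - eapply Rle_trans; [apply Rabs_minus_le|].
    specialize (XB N). specialize (YB N). lra.
Qed.

Lemma pf_mvt t s b x y : Rabs t < d -> Rabs s < d ->
  exists xi, (Rmin x y <= xi <= Rmax x y) /\ G t s b y - G t s b x = DG t s b xi * (y - x).
Proof.
  intros Ht Hs. apply MVT_gen.
  - intros z _. apply (pf_der PF); auto.
  - intros z _. apply continuity_pt_filterlim.
    change (continuous (G t s b) z).
    apply (ex_derive_continuous (G t s b) z). eexists. apply (pf_der PF); auto.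
Qed.

Lemma between_close x y xi a eta : Rmin x y <= xi <= Rmax x y ->
  Rabs (x - a) < eta -> Rabs (y - a) < eta -> Rabs (xi - a) < eta.
Proof.
  intros H Hx Hy. apply Rabs_def2 in Hx. apply Rabs_def2 in Hy. apply Rabs_def1;
  unfold Rmin, Rmax in H; destruct (Rle_dec x y); lra.
Qed.

(** The two conclusions serve different ends: control of the difference quotients gives existence,
    uniqueness and Lipschitz dependence of the root in s, and control of the linearised solutions
    gives the nonzero denominator in the formula for its derivative. Both hold for all codes with
    the same first [N] symbols. *)
Lemma coded_orbit_transversal (kap : R) : 0 < kap ->
  exists N dl, 0 < dl /\ dl <= d /\ forall e t s, (forall i, (i < N)%nat -> e i = e0 i) ->
    Rabs t < dl -> Rabs s < dl ->
    (forall s', Rabs s' < dl -> exists q, Rabs (q - Z0 0%nat) < kap /\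
        X e t s 0%nat - X e t s' 0%nat = (s - s') * q) /\
    (forall V B, (forall i, Rabs (V i) <= B) ->
       lin_sol (fun i => / DG t s (e i) (X e t s i)) (fun i => W (e i) (X e t s i)) V ->
       Rabs (V 0%nat - Z0 0%nat) < kap).
Proof.
  intros Hk. destruct (trans_close kap Hk) as [m [eta [He K]]].
  destruct (coded_orbit_close m eta He) as [N [dl [Hd [Hdd KB]]]].
  pose proof pf_lam as Hl.
  exists (m + N)%nat, (Rmin eta dl). split; [now apply Rmin_pos|].
  pose proof (Rmin_l eta dl). pose proof (Rmin_r eta dl). split; [lra|].
  intros e t s Hag Ht Hs.
  assert (A1 : forall i, (i < m)%nat -> e i = e0 i) by (intros; apply Hag; lia).
  assert (A2 : forall i, (i < N)%nat -> e i = e0 i) by (intros; apply Hag; lia).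
  destruct (coded_orbit_is_orbit e t s) as [XB XE]; try lra.
  split.
  - intros s' Hs'. destruct (Req_dec s s') as [->|Hn].
    { exists (Z0 0%nat). rewrite !Rminus_diag, Rabs_R0, Rmult_0_l. split; [exact Hk|reflexivity]. }
    destruct (coded_orbit_is_orbit e t s') as [YB YE]; try lra.
    set (Z := fun i => (X e t s i - X e t s' i) / (s - s')).
    assert (Hss : s - s' <> 0) by lra.
    exists (Z 0%nat). split; [|unfold Z; field; exact Hss].
    (* Mean value points turn the exact difference of two orbits into a linear recursion; they lie
       between two points near c_i, hence near c_i. *)
    set (Pxi := fun i xi => (Rmin (X e t s' i) (X e t s i) <= xi <= Rmax (X e t s' i) (X e t s i)) /\
      G t s (e i) (X e t s i) - G t s (e i) (X e t s' i) = DG t s (e i) xi * (X e t s i - X e t s' i)).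
    set (xi := fun i => epsilon (inhabits 0) (Pxi i)).
    assert (Hxi : forall i, Pxi i (xi i)).
    { intros i. apply (epsilon_spec (inhabits 0) (Pxi i)). apply pf_mvt; lra. }
    apply (K e t s xi (X e t s') Z (2 * orbit_bound lam / Rabs (s - s'))); auto; try lra.
    + intros i Hi. assert (Rabs (X e t s' i - c i) < eta) by (apply KB; auto; lra).
      split; [|assumption]. destruct (Hxi i) as [Q _].
      eapply between_close; [exact Q|assumption|]. apply KB; auto; lra.
    + intros i. unfold Z, Rdiv. rewrite Rabs_mult, Rabs_inv.
      apply Rmult_le_compat_r; [left; apply Rinv_0_lt_compat, Rabs_pos_lt; exact Hss|].
      eapply Rle_trans; [apply Rabs_minus_le|].
      specialize (XB i). specialize (YB i). lra.
    + intros i. destruct (Hxi i) as [_ Q].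
      assert (E : X e t s (S i) - X e t s' (S i) - (s - s') * W (e i) (X e t s' i) =
         DG t s (e i) (xi i) * (X e t s i - X e t s' i)).
      { rewrite <- Q, <- XE, <- YE, <- (pf_s PF t). ring. }
      assert (DG t s (e i) (xi i) <> 0).
      { intros E0. pose proof (pf_big PF t s (e i) (xi i) ltac:(lra) ltac:(lra)) as E1.
        rewrite E0, Rabs_R0 in E1. lra. }
      unfold Z.
      replace ((X e t s (S i) - X e t s' (S i)) / (s - s') - W (e i) (X e t s' i))
        with ((X e t s (S i) - X e t s' (S i) - (s - s') * W (e i) (X e t s' i)) / (s - s'))
        by (field; exact Hss).
      rewrite E. field. auto.
  - intros V B HB HV. apply (K e t s (X e t s) (X e t s) V B); auto; try lra.
    intros i Hi. split; apply KB; auto; lra.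
Qed.

(** Changing t moves [X e t s0 0] by less than [dl / 8 * |Z0 0|]. Moving s by [dl / 4] on either
    side of [s0] changes it by more than [dl / 4 * (|Z0 0| / 2)], with opposite signs, so the
    intermediate value theorem gives a root within [dl / 4] of [s0]. *)
Lemma coded_orbit_root (dl : R) (Hdl : 0 < dl) (Hdd : dl <= d) (e : nat -> bool) (s0 : R) t :
  Z0 0%nat <> 0 ->
  (forall t s, Rabs t < dl -> Rabs s < dl -> forall s', Rabs s' < dl ->
     exists q, Rabs (q - Z0 0%nat) < Rabs (Z0 0%nat) / 2 /\
        X e t s 0%nat - X e t s' 0%nat = (s - s') * q) ->
  Rabs s0 < dl / 4 -> X e 0 s0 0%nat = 0 -> Rabs t < dl ->
  C * Rabs t / (1 - th) < dl / 8 * Rabs (Z0 0%nat) ->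
  exists s, Rabs s < dl / 2 /\ X e t s 0%nat = 0.
Proof.
  intros Hz HS Hs0 H0 Ht Hsmall. pose proof th_bnd as Hth. pose proof (pf_d PF) as Hd.
  pose proof (pf_C PF) as HC.
  assert (Hz' : 0 < Rabs (Z0 0%nat)) by (now apply Rabs_pos_lt).
  apply Rabs_def2 in Hs0.
  assert (L : Rabs (X e t s0 0%nat) < dl / 8 * Rabs (Z0 0%nat)).
  { pose proof (coded_orbit_lip_t e t 0 s0 0%nat) as Q. rewrite H0, !Rminus_0_r in Q.
    eapply Rle_lt_trans; [apply Q|exact Hsmall]; try lra; [rewrite Rabs_R0; lra|apply Rabs_def1; lra]. }
  assert (As0 : Rabs s0 < dl) by (apply Rabs_def1; lra).
  assert (Asp : Rabs (s0 + dl / 4) < dl) by (apply Rabs_def1; lra).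
  assert (Asm : Rabs (s0 - dl / 4) < dl) by (apply Rabs_def1; lra).
  destruct (HS t (s0 + dl / 4) Ht Asp s0 As0) as [q1 [Q1 E1]].
  destruct (HS t (s0 - dl / 4) Ht Asm s0 As0) as [q2 [Q2 E2]].
  replace (s0 + dl / 4 - s0) with (dl / 4) in E1 by ring.
  replace (s0 - dl / 4 - s0) with (- (dl / 4)) in E2 by ring.
  assert (Sg : forall q, Rabs (q - Z0 0%nat) < Rabs (Z0 0%nat) / 2 ->
     (0 < Z0 0%nat /\ Rabs (Z0 0%nat) / 2 < q) \/ (Z0 0%nat < 0 /\ q < - (Rabs (Z0 0%nat) / 2))).
  { intros q Hq. apply Rabs_def2 in Hq. unfold Rabs in *. destruct (Rcase_abs (Z0 0%nat)); [right|left]; lra. }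
  apply Sg in Q1. apply Sg in Q2. apply Rabs_def2 in L.
  set (z := Rabs (Z0 0%nat)) in *.
  destruct (ivt_within (fun s => X e t s 0%nat) (s0 - dl / 4) (s0 + dl / 4) 0) as [s [[S1 S2] Es]]; [lra| | |].
  - intros s [S1 S2] eps He.
    exists (eps * (1 - th) / (C + 1)). split.
    { apply Rdiv_lt_0_compat; [apply Rmult_lt_0_compat; lra|lra]. }
    intros y [Y1 Y2] Hy. eapply Rle_lt_trans.
    { apply coded_orbit_lip_s; [lra| |]; apply Rabs_def1; lra. }
    apply (Rmult_lt_reg_r (1 - th)); [lra|]. unfold Rdiv at 1. rewrite Rmult_assoc, Rinv_l, Rmult_1_r by lra.
    apply Rle_lt_trans with ((C + 1) * Rabs (y - s)).
    { apply Rmult_le_compat_r; [apply Rabs_pos|lra]. }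
    apply Rlt_le_trans with ((C + 1) * (eps * (1 - th) / (C + 1))); [|right; field; lra].
    apply Rmult_lt_compat_l; lra.
  - assert (M : forall q, z / 2 < q -> dl / 8 * z < dl / 4 * q).
    { intros q Hq. apply (Rmult_lt_compat_l (dl / 4)) in Hq; lra. }
    assert (M' : forall q, q < - (z / 2) -> dl / 4 * q < - (dl / 8 * z)).
    { intros q Hq. apply (Rmult_lt_compat_l (dl / 4)) in Hq; lra. }
    destruct Q1 as [[P1 P2]|[P1 P2]], Q2 as [[P3 P4]|[P3 P4]]; try lra.
    + apply M in P2. apply M in P4. left. lra.
    + apply M' in P2. apply M' in P4. right. lra.
  - exists s. split; [apply Rabs_def1; lra|exact Es].
Qed.

End Parameter_family.

(** * Backward affine recursions depending smoothly on a parameter *)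

Lemma inD_open d t : inD d t -> exists r, 0 < r /\ forall y, Rabs (y - t) < r -> inD d y.
Proof.
  intros [H1 H2]. exists (Rmin (t + d) (d - t)). split; [apply Rmin_pos; lra|].
  intros y Hy. pose proof (Rmin_l (t + d) (d - t)). pose proof (Rmin_r (t + d) (d - t)).
  apply Rabs_def2 in Hy. unfold inD. lra.
Qed.

Lemma inD_locally d t : inD d t -> locally t (inD d).
Proof.
  intros H. destruct (inD_open d t H) as [r [Hr K]]. exists (mkposreal r Hr).
  intros y Hy. apply K. exact Hy.
Qed.

Lemma cont_within_inD d g t : inD d t -> (cont_within (inD d) g t <-> continuous g t).
Proof.
  intros Ht. split; [|apply cont_within_of_continuous].
  intros H. apply continuous_eps. intros eps He. destruct (H eps He) as [dl [Hd K]].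
  destruct (inD_open d t Ht) as [r [Hr Kr]].
  exists (Rmin dl r). split; [now apply Rmin_pos|]. intros y Hy.
  pose proof (Rmin_l dl r). pose proof (Rmin_r dl r). apply K; [apply Kr|]; lra.
Qed.

(** Carathéodory's form of differentiability. It suits quantities such as b whose increment is known
    to factor through t - t0 before any derivative is known. *)
Lemma caratheodory d g t0 (Q : R -> R) : inD d t0 -> continuous Q t0 ->
  locally t0 (fun t => g t - g t0 = Q t * (t - t0)) -> is_derive g t0 (Q t0).
Proof.
  intros Ht HQ [r Hr]. apply is_derive_eps. intros eps He.
  destruct (proj1 (continuous_eps Q t0) HQ eps He) as [dl [Hd K]].
  exists (Rmin dl r). split; [apply Rmin_pos; [exact Hd | apply cond_pos]|]. intros y Hy.
  pose proof (Rmin_l dl r). pose proof (Rmin_r dl r).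
  rewrite (Hr y) by (change (Rabs (y - t0) < r); lra).
  replace (Q y * (y - t0) - Q t0 * (y - t0)) with ((Q y - Q t0) * (y - t0)) by ring.
  rewrite Rabs_mult. apply Rmult_le_compat_r; [apply Rabs_pos|]. left. apply K. lra.
Qed.

Definition diff_quot (g : R -> R) (t0 l t : R) : R :=
  if Req_dec_T t t0 then l else (g t - g t0) / (t - t0).

Lemma diff_quot_eq g t0 l t : g t - g t0 = diff_quot g t0 l t * (t - t0).
Proof. unfold diff_quot. destruct (Req_dec_T t t0) as [->|]; [ring|field; lra]. Qed.

Lemma diff_quot_t0 g t0 l : diff_quot g t0 l t0 = l.
Proof. unfold diff_quot. destruct (Req_dec_T t0 t0); tauto. Qed.

Lemma diff_quot_cont g t0 l : is_derive g t0 l -> continuous (diff_quot g t0 l) t0.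
Proof.
  intros H. apply continuous_eps. intros eps He.
  destruct (proj1 (is_derive_eps _ _ _) H (eps / 2)) as [d [Hd K]]; [lra|].
  exists d. split; [exact Hd|]. intros y Hy. rewrite diff_quot_t0. unfold diff_quot.
  destruct (Req_dec_T y t0) as [->|Hn]; [rewrite Rminus_diag, Rabs_R0; exact He|].
  specialize (K y Hy).
  replace ((g y - g t0) / (y - t0) - l) with ((g y - g t0 - l * (y - t0)) / (y - t0)) by (field; lra).
  unfold Rdiv. rewrite Rabs_mult, Rabs_inv.
  assert (P : 0 < Rabs (y - t0)) by (apply Rabs_pos_lt; lra).
  apply Rle_lt_trans with (eps / 2 * Rabs (y - t0) * / Rabs (y - t0)).
  - apply Rmult_le_compat_r; [left; now apply Rinv_0_lt_compat|exact K].
  - rewrite Rmult_assoc, Rinv_r; lra.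
Qed.

Lemma mvt_inD d g g' M s t : (forall u, inD d u -> is_derive g u (g' u)) ->
  (forall u, inD d u -> Rabs (g' u) <= M) -> inD d s -> inD d t ->
  Rabs (g s - g t) <= M * Rabs (s - t).
Proof.
  intros Hd HM Hs Ht.
  destruct (MVT_gen g t s g') as [c [Hc E]].
  - intros x Hx. apply Hd. unfold inD, Rmin, Rmax in *. destruct (Rle_dec t s); lra.
  - intros x Hx. apply continuity_pt_filterlim. change (continuous g x).
    apply (ex_derive_continuous g x). exists (g' x). apply Hd.
    unfold inD, Rmin, Rmax in *. destruct (Rle_dec t s); lra.
  - rewrite E, Rabs_mult. apply Rmult_le_compat_r; [apply Rabs_pos|]. apply HM.
    unfold inD, Rmin, Rmax in *. destruct (Rle_dec t s); lra.
Qed.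

Lemma diff_quot_bound d g g' M t0 t : (forall u, inD d u -> is_derive g u (g' u)) ->
  (forall u, inD d u -> Rabs (g' u) <= M) -> inD d t0 -> inD d t ->
  Rabs (diff_quot g t0 (g' t0) t) <= M.
Proof.
  intros Hd HM Hs Ht. unfold diff_quot. destruct (Req_dec_T t t0) as [->|Hn]; [auto|].
  unfold Rdiv. rewrite Rabs_mult, Rabs_inv.
  assert (P : 0 < Rabs (t - t0)) by (apply Rabs_pos_lt; lra).
  apply (Rmult_le_reg_r (Rabs (t - t0))); [exact P|].
  rewrite Rmult_assoc, Rinv_l, Rmult_1_r by lra. now apply (mvt_inD d g g').
Qed.

(** Bounds are uniform in the index, because a backward recursion sums over all later indices;
    continuity is only required index by index, since tails are damped. *)
Fixpoint unif_Ck (d : R) (n : nat) (Y : nat -> R -> R) : Prop :=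
  (exists M, forall i t, inD d t -> Rabs (Y i t) <= M) /\
  (forall i t, inD d t -> continuous (Y i) t) /\
  match n with
  | O => True
  | S n' => exists Y', (forall i t, inD d t -> is_derive (Y i) t (Y' i t)) /\ unif_Ck d n' Y'
  end.

Lemma unif_Ck_bounded d n Y : unif_Ck d n Y -> exists M, forall i t, inD d t -> Rabs (Y i t) <= M.
Proof. destruct n; intros [H _]; exact H. Qed.

Lemma unif_Ck_cont d n Y i t : unif_Ck d n Y -> inD d t -> continuous (Y i) t.
Proof. destruct n; intros [_ [H _]]; auto. Qed.

Lemma unif_Ck_pred d n Y : unif_Ck d (S n) Y -> unif_Ck d n Y.
Proof.
  revert Y. induction n; intros Y [H1 [H2 [Y' [H3 H4]]]].
  - split; [exact H1|]. split; auto.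
  - split; [exact H1|]. split; [exact H2|]. exists Y'. auto.
Qed.

Lemma unif_Ck_ext d n Y Z : (forall i t, inD d t -> Y i t = Z i t) -> unif_Ck d n Y -> unif_Ck d n Z.
Proof.
  intros E H.
  assert (B : exists M, forall i t, inD d t -> Rabs (Z i t) <= M).
  { destruct (unif_Ck_bounded _ _ _ H) as [M HM]. exists M. intros. rewrite <- E; auto. }
  assert (Cn : forall i t, inD d t -> continuous (Z i) t).
  { intros i t Ht. apply (continuous_ext_loc _ (Y i)).
    - apply (filter_imp (inD d)); [intros; apply E; auto|]. now apply inD_locally.
    - now apply (unif_Ck_cont d n). }
  destruct n; (split; [exact B|split; [exact Cn|]]); [exact I|].
  destruct H as [_ [_ [Y' [H3 H4]]]]. exists Y'. split; [|exact H4].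
  intros i t Ht. apply (is_derive_ext_loc (Y i)); auto.
  apply (filter_imp (inD d)); [intros; apply E; auto|]. now apply inD_locally.
Qed.

Lemma unif_Ck_reindex d n Y (f : nat -> nat) : unif_Ck d n Y -> unif_Ck d n (fun i => Y (f i)).
Proof.
  revert Y. induction n; intros Y [[M HM] [H2 H3]].
  - split; [exists M; auto|]. auto.
  - destruct H3 as [Y' [H3 H4]]. split; [exists M; auto|]. split; [auto|].
    exists (fun i => Y' (f i)). split; auto.
Qed.

Lemma unif_Ck_plus d n Y Z : unif_Ck d n Y -> unif_Ck d n Z -> unif_Ck d n (fun i t => Y i t + Z i t).
Proof.
  revert Y Z. induction n; intros Y Z [[M HM] [H2 H3]] [[M' HM'] [H2' H3']];
  (split; [exists (M + M'); intros i t Ht; eapply Rle_trans; [apply Rabs_triang|];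
     specialize (HM i t Ht); specialize (HM' i t Ht); lra|]);
  (split; [intros i t Ht; apply (continuous_plus (Y i) (Z i)); auto|]); [exact I|].
  destruct H3 as [Y' [H3 H4]], H3' as [Z' [H3' H4']].
  exists (fun i t => Y' i t + Z' i t). split; [|auto].
  intros i t Ht. apply (is_derive_plus (Y i) (Z i)); auto.
Qed.

Lemma unif_Ck_mult d n Y Z : unif_Ck d n Y -> unif_Ck d n Z -> unif_Ck d n (fun i t => Y i t * Z i t).
Proof.
  revert Y Z. induction n; intros Y Z HY HZ.
  all: assert (B : exists M, forall i t, inD d t -> Rabs (Y i t * Z i t) <= M) by
    (destruct (unif_Ck_bounded _ _ _ HY) as [M HM], (unif_Ck_bounded _ _ _ HZ) as [M' HM'];
     exists (M * M'); intros i t Ht; rewrite Rabs_mult; apply Rmult_le_compat; try apply Rabs_pos; auto).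
  all: assert (Cn : forall i t, inD d t -> continuous (fun t => Y i t * Z i t) t) by
   (intros i t Ht; apply (continuous_mult (Y i) (Z i)); [eapply unif_Ck_cont|eapply unif_Ck_cont]; eauto).
  - split; auto.
  - split; [exact B|]. split; [exact Cn|].
    pose proof (unif_Ck_pred _ _ _ HY) as HYp. pose proof (unif_Ck_pred _ _ _ HZ) as HZp.
    destruct HY as [_ [_ [Y' [H3 H4]]]], HZ as [_ [_ [Z' [H3' H4']]]].
    exists (fun i t => Y' i t * Z i t + Y i t * Z' i t). split.
    + intros i t Ht. apply (is_derive_mult (Y i) (Z i)); auto. intros; apply Rmult_comm.
    + apply unif_Ck_plus; apply IHn; auto.
Qed.

Lemma unif_Ck_const d n (c : nat -> R) M : (forall i, Rabs (c i) <= M) -> unif_Ck d n (fun i _ => c i).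
Proof.
  revert c M. induction n; intros c M HM.
  - split; [exists M; auto|]. split; [|exact I]. intros; apply continuous_const.
  - split; [exists M; auto|]. split; [intros; apply continuous_const|].
    exists (fun _ _ => 0). split; [intros; apply (is_derive_const (K:=R_AbsRing) (V:=R_NormedModule))|].
    apply (IHn (fun _ => 0) 0). intros; rewrite Rabs_R0; lra.
Qed.

Lemma unif_Ck_opp d n Y : unif_Ck d n Y -> unif_Ck d n (fun i t => - Y i t).
Proof.
  intros H. apply (unif_Ck_ext d n (fun i t => (-1) * Y i t)); [intros; ring|].
  apply (unif_Ck_mult d n (fun _ _ => -1)); [|exact H].
  apply (unif_Ck_const d n (fun _ => -1) 1). intros. rewrite Rabs_left; lra.
Qed.

Lemma unif_Ck_inv d n Y kap : 0 < kap -> (forall i t, inD d t -> kap <= Rabs (Y i t)) ->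
  unif_Ck d n Y -> unif_Ck d n (fun i t => / Y i t).
Proof.
  intros Hk HK. revert Y HK. induction n; intros Y HK HY.
  all: assert (N0 : forall i t, inD d t -> Y i t <> 0) by
    (intros i t Ht E; specialize (HK i t Ht); rewrite E, Rabs_R0 in HK; lra).
  all: assert (B : exists M, forall i t, inD d t -> Rabs (/ Y i t) <= M) by
    (exists (/ kap); intros i t Ht; rewrite Rabs_inv; apply Rinv_le_contravar; auto).
  all: assert (Cn : forall i t, inD d t -> continuous (fun t => / Y i t) t) by
   (intros i t Ht; apply (continuous_Rinv_comp (Y i)); [eapply unif_Ck_cont; eauto|auto]).
  - split; auto.
  - split; [exact B|]. split; [exact Cn|].
    pose proof (unif_Ck_pred _ _ _ HY) as HYp.
    destruct HY as [_ [_ [Y' [H3 H4]]]].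
    exists (fun i t => - (Y' i t * (/ Y i t * / Y i t))). split.
    + intros i t Ht. pose proof (is_derive_inv (Y i) t _ (H3 i t Ht) (N0 i t Ht)) as Q.
      replace (- (Y' i t * (/ Y i t * / Y i t))) with (- Y' i t / Y i t ^ 2); [exact Q|].
      field. auto.
    + apply unif_Ck_opp. apply unif_Ck_mult; [exact H4|]. apply unif_Ck_mult; auto.
Qed.

(** [lin_sol] with [q] = - r p. The general forcing is needed because differentiating the recursion
    in t adds the term r'_i Z_(i+1). *)
Definition aff_sol (r q Z : nat -> R) : Prop := forall i, Z i = r i * Z (S i) + q i.

Lemma aff_sol_exists r q th C : 0 <= th < 1 -> 0 <= C ->
  (forall i, Rabs (r i) <= th) -> (forall i, Rabs (q i) <= C) ->
  exists Z, aff_sol r q Z /\ forall i, Rabs (Z i) <= C / (1 - th).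
Proof.
  intros Hth HC Hr Hp.
  assert (M0 : 0 <= C / (1 - th)).
  { apply Rmult_le_pos; [lra|]. left; apply Rinv_0_lt_compat; lra. }
  destruct (contraction_system S (fun i y => r i * y + q i) th (C / (1 - th))) as [Z [ZB ZE]]; auto.
  - intros i y z. replace (r i * y + q i - (r i * z + q i)) with (r i * (y - z)) by ring.
    rewrite Rabs_mult. apply Rmult_le_compat_r; [apply Rabs_pos|apply Hr].
  - intros i y Hy. eapply Rle_trans; [apply Rabs_triang|]. rewrite Rabs_mult.
    replace (C / (1 - th)) with (th * (C / (1 - th)) + C) by (field; lra).
    apply Rplus_le_compat; [|apply Hp]. apply Rmult_le_compat; try apply Rabs_pos; auto.
  - exists Z. split; auto.
Qed.

Lemma aff_sol_bound r q Z th C B : 0 <= th < 1 -> 0 <= C ->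
  (forall i, Rabs (r i) <= th) -> (forall i, Rabs (q i) <= C) ->
  aff_sol r q Z -> (forall i, Rabs (Z i) <= B) ->
  forall i, Rabs (Z i) <= C / (1 - th).
Proof.
  intros Hth HC Hr Hp HZ HB.
  apply (backward_bound S Z th C B); auto.
  intros i. rewrite (HZ i) at 1. eapply Rle_trans; [apply Rabs_triang|]. rewrite Rabs_mult.
  apply Rplus_le_compat; [|apply Hp]. apply Rmult_le_compat_r; [apply Rabs_pos|apply Hr].
Qed.

Lemma aff_sol_unique r q Z Z' th B B' : 0 <= th < 1 -> (forall i, Rabs (r i) <= th) ->
  aff_sol r q Z -> (forall i, Rabs (Z i) <= B) -> aff_sol r q Z' -> (forall i, Rabs (Z' i) <= B') ->
  forall i, Z i = Z' i.
Proof.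
  intros Hth Hr HZ HB HZ' HB' i.
  assert (E : Rabs (Z i - Z' i) <= 0 / (1 - th)).
  { apply (aff_sol_bound r (fun _ => 0) (fun i => Z i - Z' i) th 0 (B + B')); auto; try lra.
    - intros; rewrite Rabs_R0; lra.
    - intros j. rewrite (HZ j), (HZ' j) at 1. ring.
    - intros j. eapply Rle_trans; [apply Rabs_minus_le|].
      specialize (HB j). specialize (HB' j). lra. }
  unfold Rdiv in E. rewrite Rmult_0_l in E.
  destruct (Req_dec (Z i - Z' i) 0) as [|Hn]; [lra|]. apply Rabs_pos_lt in Hn. lra.
Qed.

(** Unrolling [m] steps involves only finitely many coefficients, whose moduli of continuity may
    differ; the remainder is at most [th ^ m * (2 * B)]. *)
Lemma aff_sol_cont (S0 : R -> Prop) (r q Z : nat -> R -> R) th B t0 :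
  0 <= th < 1 -> 0 <= B -> S0 t0 ->
  (forall i t, S0 t -> Rabs (r i t) <= th) ->
  (forall i t, S0 t -> Rabs (Z i t) <= B) ->
  (forall t, S0 t -> aff_sol (fun i => r i t) (fun i => q i t) (fun i => Z i t)) ->
  (forall i, cont_within S0 (r i) t0) -> (forall i, cont_within S0 (q i) t0) ->
  forall i, cont_within S0 (Z i) t0.
Proof.
  intros Hth HB H0 Hr HZB HZ Cr Cq.
  assert (K : forall m i eps, 0 < eps -> exists dl, 0 < dl /\ forall t, S0 t -> Rabs (t - t0) < dl ->
      Rabs (Z i t - Z i t0) <= th ^ m * (2 * B) + eps).
  { induction m; intros i eps He.
    - exists 1. split; [lra|]. intros t Ht _. simpl. eapply Rle_trans; [apply Rabs_minus_le|].
      pose proof (HZB i t Ht). pose proof (HZB i t0 H0). lra.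
    - destruct (IHm (S i) (eps / 3)) as [d1 [D1 K1]]; [lra|].
      assert (He2 : 0 < eps / 3 / (B + 1)) by (apply Rdiv_lt_0_compat; lra).
      destruct (Cr i _ He2) as [d2 [D2 K2]].
      destruct (Cq i (eps / 3)) as [d3 [D3 K3]]; [lra|].
      exists (Rmin d1 (Rmin d2 d3)). split; [repeat apply Rmin_pos; auto|].
      intros t Ht Hd. pose proof (Rmin_l d1 (Rmin d2 d3)). pose proof (Rmin_r d1 (Rmin d2 d3)).
      pose proof (Rmin_l d2 d3). pose proof (Rmin_r d2 d3).
      specialize (K1 t Ht ltac:(lra)). specialize (K2 t Ht ltac:(lra)). specialize (K3 t Ht ltac:(lra)).
      rewrite (HZ t Ht i), (HZ t0 H0 i).
      replace (r i t * Z (S i) t + q i t - (r i t0 * Z (S i) t0 + q i t0)) with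
        (r i t * (Z (S i) t - Z (S i) t0) + ((r i t - r i t0) * Z (S i) t0 + (q i t - q i t0))) by ring.
      eapply Rle_trans; [apply Rabs_triang|].
      assert (A1 : Rabs (r i t * (Z (S i) t - Z (S i) t0)) <= th * (th ^ m * (2 * B) + eps / 3)).
      { rewrite Rabs_mult. apply Rmult_le_compat; try apply Rabs_pos; auto. }
      assert (A2 : Rabs ((r i t - r i t0) * Z (S i) t0) <= eps / 3).
      { rewrite Rabs_mult. replace (eps / 3) with (eps / 3 / (B + 1) * (B + 1)) by (field; lra).
        apply Rmult_le_compat; try apply Rabs_pos; [lra|]. pose proof (HZB (S i) t0 H0). lra. }
      assert (A3 : th * (eps / 3) <= 1 * (eps / 3)) by (apply Rmult_le_compat_r; lra).
      pose proof (Rabs_triang ((r i t - r i t0) * Z (S i) t0) (q i t - q i t0)).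
      simpl. lra. }
  intros i eps He. destruct (pow_small th (2 * B) (eps / 2) Hth) as [m Hm]; [lra|].
  destruct (K m i (eps / 3)) as [dl [D Kd]]; [lra|]. exists dl. split; [exact D|].
  intros t Ht Hd. specialize (Kd t Ht Hd). specialize (Hm m (Nat.le_refl m)). lra.
Qed.

(** The difference quotients of [Z], completed by [D] at t0, solve an affine recursion whose
    coefficients are continuous at t0. They are thus continuous at t0, which is differentiability in
    Carathéodory's sense. *)
Lemma aff_sol_deriv d (r q Z r' q' : nat -> R -> R) th B M t0 D :
  0 <= th < 1 -> 0 <= B -> inD d t0 ->
  (forall i t, inD d t -> Rabs (r i t) <= th) ->
  (forall i t, inD d t -> Rabs (Z i t) <= B) ->
  (forall t, inD d t -> aff_sol (fun i => r i t) (fun i => q i t) (fun i => Z i t)) ->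
  (forall i t, inD d t -> is_derive (r i) t (r' i t)) ->
  (forall i t, inD d t -> is_derive (q i) t (q' i t)) ->
  (forall i t, inD d t -> Rabs (r' i t) <= M) -> (forall i t, inD d t -> Rabs (q' i t) <= M) ->
  aff_sol (fun i => r i t0) (fun i => r' i t0 * Z (S i) t0 + q' i t0) D ->
  (forall i, Rabs (D i) <= B) ->
  forall i, is_derive (Z i) t0 (D i).
Proof.
  intros Hth HB H0 Hr HZB HZ Dr Dq Br Bq HD BD i.
  assert (HM : 0 <= M) by (eapply Rle_trans; [apply Rabs_pos|apply (Br 0%nat t0 H0)]).
  set (qt := fun i t => diff_quot (r i) t0 (r' i t0) t * Z (S i) t0 + diff_quot (q i) t0 (q' i t0) t).
  set (C := M * B + M).
  assert (HC : 0 <= C) by (unfold C; assert (0 <= M * B) by (apply Rmult_le_pos; lra); lra).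
  set (Q := fun i t => diff_quot (Z i) t0 (D i) t).
  assert (QS : forall t, inD d t -> aff_sol (fun i => r i t) (fun i => qt i t) (fun i => Q i t)).
  { intros t Ht j. unfold Q, qt. destruct (Req_dec t t0) as [->|Hn].
    - rewrite !diff_quot_t0. apply HD.
    - apply (Rmult_eq_reg_r (t - t0)); [|lra]. rewrite <- diff_quot_eq.
      rewrite !Rmult_plus_distr_r, Rmult_assoc, <- diff_quot_eq.
      rewrite (HZ t Ht j), (HZ t0 H0 j).
      replace (diff_quot (r j) t0 (r' j t0) t * Z (S j) t0 * (t - t0)) with
        (diff_quot (r j) t0 (r' j t0) t * (t - t0) * Z (S j) t0) by ring.
      rewrite <- !diff_quot_eq. ring. }
  assert (qB : forall j t, inD d t -> Rabs (qt j t) <= C).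
  { intros j t Ht. unfold qt, C. eapply Rle_trans; [apply Rabs_triang|]. apply Rplus_le_compat.
    - rewrite Rabs_mult. apply Rmult_le_compat; try apply Rabs_pos; auto.
      apply (diff_quot_bound d (r j) (r' j)); auto.
    - apply (diff_quot_bound d (q j) (q' j)); auto. }
  (* The bound [2 * B / |t - t0|] blows up at t0, but it only serves as the a priori bound; the
     recursion replaces it by one that is uniform in t. *)
  assert (QB : forall j t, inD d t -> Rabs (Q j t) <= C / (1 - th)).
  { intros j t Ht. destruct (Req_dec t t0) as [->|Hn].
    - apply (aff_sol_bound (fun i => r i t0) (fun i => qt i t0) (fun i => Q i t0) th C B); auto.
      intros l. unfold Q. rewrite diff_quot_t0. apply BD.
    - apply (aff_sol_bound (fun i => r i t) (fun i => qt i t) (fun i => Q i t) th C (2 * B / Rabs (t - t0))); auto.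
      intros l. unfold Q, diff_quot. destruct (Req_dec_T t t0); [tauto|].
      unfold Rdiv. rewrite Rabs_mult, Rabs_inv. apply Rmult_le_compat_r.
      { left. apply Rinv_0_lt_compat, Rabs_pos_lt. lra. }
      eapply Rle_trans; [apply Rabs_minus_le|].
      pose proof (HZB l t Ht). pose proof (HZB l t0 H0). lra. }
  assert (Cn : cont_within (inD d) (Q i) t0).
  { apply (aff_sol_cont (inD d) r qt Q th (C / (1 - th)) t0); auto.
    - apply Rmult_le_pos; [exact HC|]. left; apply Rinv_0_lt_compat; lra.
    - intros j. apply cont_within_of_continuous. apply (ex_derive_continuous (r j) t0).
      eexists; apply Dr; auto.
    - intros j. apply cont_within_of_continuous. unfold qt.
      apply (continuous_plus (fun t => diff_quot (r j) t0 (r' j t0) t * Z (S j) t0) (diff_quot (q j) t0 (q' j t0))).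
      + apply (continuous_mult (diff_quot (r j) t0 (r' j t0)) (fun _ => Z (S j) t0)).
        * apply diff_quot_cont; auto.
        * apply continuous_const.
      + apply diff_quot_cont; auto. }
  replace (D i) with (Q i t0) by (unfold Q; apply diff_quot_t0).
  apply (caratheodory d); auto.
  - now apply (cont_within_inD d).
  - exists (mkposreal 1 Rlt_0_1). intros t _. apply diff_quot_eq.
Qed.

(** The derivative of [Z] solves the same recursion with forcing r'_i Z_(i+1) + q'_i. The induction
    hypothesis is used twice: for [Z], which makes this forcing of class C^n, and then for the
    derivative. *)
Lemma unif_Ck_aff d n (r q Z : nat -> R -> R) th B :
  0 <= th < 1 ->
  (forall i t, inD d t -> Rabs (r i t) <= th) ->
  (forall i t, inD d t -> Rabs (Z i t) <= B) ->
  (forall t, inD d t -> aff_sol (fun i => r i t) (fun i => q i t) (fun i => Z i t)) ->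
  unif_Ck d n r -> unif_Ck d n q -> unif_Ck d n Z.
Proof.
  intros Hth Hr. revert q Z B. induction n; intros q Z B HZB HZ Ur Uq.
  all: assert (CZ : forall i t, inD d t -> continuous (Z i) t) by
    (intros i t Ht; apply (cont_within_inD d); auto;
     apply (aff_sol_cont (inD d) r q Z th B t); auto;
      [eapply Rle_trans; [apply Rabs_pos | apply (HZB 0%nat t Ht)]
      |intros; apply cont_within_of_continuous; eapply unif_Ck_cont; eauto
      |intros; apply cont_within_of_continuous; eapply unif_Ck_cont; eauto]).
  - split; [exists B; auto|]. split; auto.
  - split; [exists B; auto|]. split; [exact CZ|].
    pose proof (unif_Ck_pred _ _ _ Ur) as Urp. pose proof (unif_Ck_pred _ _ _ Uq) as Uqp.
    assert (UZ : unif_Ck d n Z) by (apply (IHn q Z B); auto).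
    destruct Ur as [_ [_ [r' [Dr Ur']]]], Uq as [_ [_ [q' [Dq Uq']]]].
    set (qt := fun i t => r' i t * Z (S i) t + q' i t).
    assert (Uqt : unif_Ck d n qt).
    { apply unif_Ck_plus; [|exact Uq']. apply unif_Ck_mult; [exact Ur'|]. apply (unif_Ck_reindex d n Z S UZ). }
    destruct (unif_Ck_bounded _ _ _ Uqt) as [C HC].
    set (C' := Rabs C).
    assert (HC' : forall i t, inD d t -> Rabs (qt i t) <= C').
    { intros i t Ht. eapply Rle_trans; [apply HC; auto|]. apply Rle_abs. }
    assert (C0 : 0 <= C') by apply Rabs_pos.
    set (Pd := fun t D => aff_sol (fun i => r i t) (fun i => qt i t) D /\ forall i, Rabs (D i) <= C' / (1 - th)).
    set (D := fun t => epsilon (inhabits (fun _ : nat => 0)) (Pd t)).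
    assert (HD : forall t, inD d t -> Pd t (D t)).
    { intros t Ht. apply (epsilon_spec (inhabits (fun _ : nat => 0)) (Pd t)).
      apply aff_sol_exists; auto. }
    destruct (unif_Ck_bounded _ _ _ Ur') as [M1 HM1]. destruct (unif_Ck_bounded _ _ _ Uq') as [M2 HM2].
    assert (P0 : 0 <= C' / (1 - th)).
    { apply Rmult_le_pos; [exact C0|]. left; apply Rinv_0_lt_compat; lra. }
    exists (fun i t => D t i). split.
    + intros i t Ht. destruct (HD t Ht) as [D1 D2].
      pose proof (Rle_abs B). pose proof (Rabs_pos B).
      apply (aff_sol_deriv d r q Z r' q' th (Rabs B + C' / (1 - th)) (Rmax M1 M2) t (D t)); auto; try lra.
      * intros j s Hs. specialize (HZB j s Hs). lra.
      * intros j s Hs. eapply Rle_trans; [apply HM1; auto|apply Rmax_l].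
      * intros j s Hs. eapply Rle_trans; [apply HM2; auto|apply Rmax_r].
      * intros j. specialize (D2 j). lra.
    + apply (IHn qt (fun i t => D t i) (C' / (1 - th))); auto.
      * intros i t Ht. apply (proj2 (HD t Ht)).
      * intros t Ht. apply (proj1 (HD t Ht)).
Qed.

(** * Regularity of the implicitly defined parameter *)

(* [A b a l t x] stands for the a-th x-derivative on the branch b of the l-th t-derivative of a curve of maps. *)
Record field_jet (d : R) (k : nat) (A : bool -> nat -> nat -> R -> R -> R) : Prop := {
  fj_t : forall b a l t0, (a <= k)%nat -> (l < k)%nat -> inD d t0 ->
    forall eps, 0 < eps -> exists dl, 0 < dl /\ forall t, inD d t -> Rabs (t - t0) < dl ->
    forall x, half b x ->
      Rabs (A b a l t x - A b a l t0 x - (t - t0) * A b a (S l) t0 x) <= eps * Rabs (t - t0);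
  fj_x : forall b a l t x, (a < k)%nat -> (l <= k)%nat -> inD d t -> half b x ->
    deriv_within (lo b) (hi b) (A b a l t) x (A b (S a) l t x);
  fj_B : exists C, forall b a l t x, (a <= k)%nat -> (l <= k)%nat -> inD d t -> half b x ->
    Rabs (A b a l t x) <= C;
  fj_ct : forall b a l t0, (a <= k)%nat -> (l <= k)%nat -> inD d t0 ->
    forall eps, 0 < eps -> exists dl, 0 < dl /\ forall t, inD d t -> Rabs (t - t0) < dl ->
    forall x, half b x -> Rabs (A b a l t x - A b a l t0 x) <= eps;
  fj_cx : forall b a l t x, (a <= k)%nat -> (l <= k)%nat -> inD d t -> half b x ->
    cont_within (half b) (A b a l t) x }.

Arguments fj_t {_ _ _}.
Arguments fj_x {_ _ _}.
Arguments fj_B {_ _ _}.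
Arguments fj_ct {_ _ _}.
Arguments fj_cx {_ _ _}.

Lemma jet_comp_cont d k A b a l y t0 : field_jet d k A -> (a <= k)%nat -> (l <= k)%nat ->
  inD d t0 -> (forall t, inD d t -> half b (y t)) -> continuous y t0 ->
  continuous (fun t => A b a l t (y t)) t0.
Proof.
  intros HA Ha Hl H0 Hy Cy. apply (cont_within_inD d); auto. intros eps He.
  destruct (fj_ct HA b a l t0 Ha Hl H0 (eps / 3)) as [d1 [D1 K1]]; [lra|].
  destruct (fj_cx HA b a l t0 (y t0) Ha Hl H0 (Hy t0 H0) (eps / 3)) as [d2 [D2 K2]]; [lra|].
  destruct (proj1 (continuous_eps y t0) Cy d2 D2) as [d3 [D3 K3]].
  exists (Rmin d1 d3). split; [now apply Rmin_pos|]. intros t Ht Hd.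
  pose proof (Rmin_l d1 d3). pose proof (Rmin_r d1 d3).
  specialize (K1 t Ht ltac:(lra) (y t) (Hy t Ht)).
  specialize (K2 (y t) (Hy t Ht) (K3 t ltac:(lra))).
  replace (A b a l t (y t) - A b a l t0 (y t0)) with
    ((A b a l t (y t) - A b a l t0 (y t)) + (A b a l t0 (y t) - A b a l t0 (y t0))) by ring.
  eapply Rle_lt_trans; [apply Rabs_triang|]. lra.
Qed.

(** The t-expansion in [fj_t] is uniform in x, so it may be evaluated at the moving point [y t]; all
    x-variation is then taken at the fixed time t0. *)
Lemma jet_comp_deriv d k A b a l y y' t0 : field_jet d k A -> (a < k)%nat -> (l < k)%nat ->
  inD d t0 -> (forall t, inD d t -> half b (y t)) -> is_derive y t0 y' ->
  is_derive (fun t => A b a l t (y t)) t0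
    (A b a (S l) t0 (y t0) + A b (S a) l t0 (y t0) * y').
Proof.
  intros HA Ha Hl H0 Hy Dy. apply is_derive_eps. intros eps He.
  set (Ax := A b (S a) l t0 (y t0)). set (Y := Rabs y' + 1).
  assert (HY : 0 < Y) by (unfold Y; pose proof (Rabs_pos y'); lra).
  set (X := Rabs Ax + 1). assert (HX : 0 < X) by (unfold X; pose proof (Rabs_pos Ax); lra).
  destruct (fj_t HA b a l t0 ltac:(lia) Hl H0 (eps / 4)) as [d1 [D1 K1]]; [lra|].
  assert (Cy : continuous y t0) by (apply (ex_derive_continuous y); eexists; exact Dy).
  assert (E3 : 0 < eps / 4 / Y) by (apply Rdiv_lt_0_compat; lra).
  destruct (proj1 (deriv_within_eps _ _ _ _ _) (fj_x HA b a l t0 (y t0) Ha ltac:(lia) H0 (Hy t0 H0)) _ E3)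
    as [d3 [D3 K3]].
  destruct (fj_cx HA b a (S l) t0 (y t0) ltac:(lia) ltac:(lia) H0 (Hy t0 H0) (eps / 4)) as [d2 [D2 K2]]; [lra|].
  destruct (proj1 (continuous_eps y t0) Cy (Rmin d2 d3)) as [d4 [D4 K4]]; [now apply Rmin_pos|].
  assert (E5 : 0 < eps / 4 / X) by (apply Rdiv_lt_0_compat; lra).
  destruct (proj1 (is_derive_eps _ _ _) Dy _ E5) as [d5 [D5 K5]].
  destruct (proj1 (is_derive_eps _ _ _) Dy 1 Rlt_0_1) as [d6 [D6 K6]].
  destruct (inD_open d t0 H0) as [d7 [D7 K7]].
  exists (Rmin d1 (Rmin d4 (Rmin d5 (Rmin d6 d7)))). split; [repeat apply Rmin_pos; auto|].
  intros t Hd.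
  pose proof (Rmin_l d1 (Rmin d4 (Rmin d5 (Rmin d6 d7)))).
  pose proof (Rmin_r d1 (Rmin d4 (Rmin d5 (Rmin d6 d7)))).
  pose proof (Rmin_l d4 (Rmin d5 (Rmin d6 d7))). pose proof (Rmin_r d4 (Rmin d5 (Rmin d6 d7))).
  pose proof (Rmin_l d5 (Rmin d6 d7)). pose proof (Rmin_r d5 (Rmin d6 d7)).
  pose proof (Rmin_l d6 d7). pose proof (Rmin_r d6 d7).
  pose proof (Rmin_l d2 d3). pose proof (Rmin_r d2 d3).
  assert (Ht : inD d t) by (apply K7; lra).
  specialize (K4 t ltac:(lra)).
  specialize (K1 t Ht ltac:(lra) (y t) (Hy t Ht)).
  specialize (K2 (y t) (Hy t Ht) ltac:(lra)).
  specialize (K3 (y t) (Hy t Ht) ltac:(lra)).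
  specialize (K5 t ltac:(lra)). specialize (K6 t ltac:(lra)). fold Ax in K3.
  set (h := t - t0) in *.
  assert (Ly : Rabs (y t - y t0) <= Y * Rabs h).
  { replace (y t - y t0) with ((y t - y t0 - y' * h) + y' * h) by ring.
    eapply Rle_trans; [apply Rabs_triang|]. rewrite Rabs_mult. unfold Y. lra. }
  replace (A b a l t (y t) - A b a l t0 (y t0) - (A b a (S l) t0 (y t0) + Ax * y') * h) with
   ((A b a l t (y t) - A b a l t0 (y t) - h * A b a (S l) t0 (y t)) +
    (h * (A b a (S l) t0 (y t) - A b a (S l) t0 (y t0)) +
    ((A b a l t0 (y t) - A b a l t0 (y t0) - Ax * (y t - y t0)) + Ax * (y t - y t0 - y' * h)))) by ring.
  assert (B2 : Rabs (h * (A b a (S l) t0 (y t) - A b a (S l) t0 (y t0))) <= eps / 4 * Rabs h).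
  { rewrite Rabs_mult, Rmult_comm. apply Rmult_le_compat_r; [apply Rabs_pos|lra]. }
  assert (B3 : eps / 4 / Y * Rabs (y t - y t0) <= eps / 4 * Rabs h).
  { replace (eps / 4 * Rabs h) with (eps / 4 / Y * (Y * Rabs h)) by (field; lra).
    apply Rmult_le_compat_l; lra. }
  assert (B4 : Rabs (Ax * (y t - y t0 - y' * h)) <= eps / 4 * Rabs h).
  { rewrite Rabs_mult. replace (eps / 4 * Rabs h) with (X * (eps / 4 / X * Rabs h)) by (field; lra).
    apply Rmult_le_compat; try apply Rabs_pos; [unfold X; lra|exact K5]. }
  eapply Rle_trans; [apply Rabs_triang|].
  eapply Rle_trans; [apply Rplus_le_compat_l, Rabs_triang|].
  eapply Rle_trans; [apply Rplus_le_compat_l, Rplus_le_compat_l, Rabs_triang|].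
  lra.
Qed.

Lemma jet_deriv_t d k A b a l x t : field_jet d k A -> (a <= k)%nat -> (l < k)%nat ->
  inD d t -> half b x -> is_derive (fun t => A b a l t x) t (A b a (S l) t x).
Proof.
  intros HA Ha Hl Ht Hx. apply is_derive_eps. intros eps He.
  destruct (fj_t HA b a l t Ha Hl Ht eps He) as [d1 [D1 K1]].
  destruct (inD_open d t Ht) as [d2 [D2 K2]].
  exists (Rmin d1 d2). split; [now apply Rmin_pos|]. intros y Hy.
  pose proof (Rmin_l d1 d2). pose proof (Rmin_r d1 d2).
  specialize (K1 y (K2 y ltac:(lra)) ltac:(lra) x Hx). rewrite (Rmult_comm (A b a (S l) t x)). exact K1.
Qed.

(** Each t-derivative of the composition consumes one derivative of the jet, either in t or in x;
    this is the count in [a + n <= k] and [l + n <= k]. *)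
Lemma unif_Ck_jet d k A (e : nat -> bool) n : field_jet d k A -> forall a l Y,
  (a + n <= k)%nat -> (l + n <= k)%nat ->
  (forall i t, inD d t -> half (e i) (Y i t)) -> unif_Ck d n Y ->
  unif_Ck d n (fun i t => A (e i) a l t (Y i t)).
Proof.
  intros HA. destruct (fj_B HA) as [C HC].
  induction n; intros a l Y Ha Hl HK HY.
  all: assert (B : exists M, forall i t, inD d t -> Rabs (A (e i) a l t (Y i t)) <= M) by
    (exists C; intros i t Ht; apply HC; auto; lia).
  all: assert (Cn : forall i t, inD d t -> continuous (fun t => A (e i) a l t (Y i t)) t) by
   (intros i t Ht; apply (jet_comp_cont d k); auto; try lia; eapply unif_Ck_cont; eauto).
  - split; auto.
  - split; [exact B|]. split; [exact Cn|].
    pose proof (unif_Ck_pred _ _ _ HY) as HYp.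
    destruct HY as [_ [_ [Y' [H3 H4]]]].
    exists (fun i t => A (e i) a (S l) t (Y i t) + A (e i) (S a) l t (Y i t) * Y' i t). split.
    + intros i t Ht. apply (jet_comp_deriv d k); auto; lia.
    + apply unif_Ck_plus; [apply IHn; auto; lia|]. apply unif_Ck_mult; [apply IHn; auto; lia|exact H4].
Qed.

Lemma mvt_within a b g g' x y : a <= b ->
  (forall z, inCC a b z -> deriv_within a b g z (g' z)) -> inCC a b x -> inCC a b y ->
  exists xi, (Rmin x y <= xi <= Rmax x y) /\ g y - g x = g' xi * (y - x).
Proof.
  intros Hab Hd Hx Hy.
  destruct (MVT_gen (fun z => g (clamp a b z)) x y g') as [c [Hc E]].
  - intros z Hz. apply is_derive_eps. intros eps He.
    assert (Hz' : a < z < b).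
    { unfold inCC, Rmin, Rmax in *. destruct (Rle_dec x y); lra. }
    destruct (proj1 (deriv_within_eps _ _ _ _ _) (Hd z ltac:(unfold inCC; lra)) eps He) as [dl [D K]].
    exists (Rmin dl (Rmin (z - a) (b - z))). split; [repeat apply Rmin_pos; lra|].
    intros u Hu. pose proof (Rmin_l dl (Rmin (z - a) (b - z))). pose proof (Rmin_r dl (Rmin (z - a) (b - z))).
    pose proof (Rmin_l (z - a) (b - z)). pose proof (Rmin_r (z - a) (b - z)).
    assert (Hu2 : inCC a b u) by (apply Rabs_def2 in Hu; unfold inCC; lra).
    rewrite !clamp_id by (auto; unfold inCC; lra). apply K; [exact Hu2|lra].
  - intros z _. apply continuity_pt_filterlim. change (continuous (fun z => g (clamp a b z)) z).
    apply continuous_eps. intros eps He.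
    destruct (deriv_within_cont _ _ _ _ _ (Hd _ (clamp_in a b z Hab)) eps He) as [dl [D K]].
    exists dl. split; [exact D|]. intros u Hu. apply K; [now apply clamp_in|].
    eapply Rle_lt_trans; [apply clamp_lip|exact Hu].
  - exists c. split; [exact Hc|]. rewrite !clamp_id in E by auto. exact E.
Qed.

Section Regularity.
Variables (d lam kap : R) (k : nat) (A AW : bool -> nat -> nat -> R -> R -> R).
Variables (e : nat -> bool) (beta : R -> R) (x : nat -> R -> R).
Hypothesis Hlam : 1 < lam.
Hypothesis Hkap : 0 < kap.
Hypothesis Hk : (1 <= k)%nat.
Hypothesis HA : field_jet d k A.
Hypothesis HW : field_jet d k AW.
Hypothesis AW0 : forall b t t' y, AW b 0%nat 0%nat t y = AW b 0%nat 0%nat t' y.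
Hypothesis Hx0 : forall t, inD d t -> x 0%nat t = 0.
Hypothesis HxK : forall i t, inD d t -> half (e i) (x i t).
Hypothesis HxS : forall i t, inD d t ->
  x (S i) t = A (e i) 0%nat 0%nat t (x i t) + beta t * AW (e i) 0%nat 0%nat t (x i t).
Hypothesis Hbc : forall t, inD d t -> continuous beta t.
Hypothesis Hbb : exists B, forall t, inD d t -> Rabs (beta t) <= B.
Hypothesis Hxc : forall i t, inD d t -> continuous (x i) t.
Let slope b t y := A b 1%nat 0%nat t y + beta t * AW b 1%nat 0%nat t y.
Hypothesis Hbig : forall b t y, inD d t -> half b y -> lam <= Rabs (slope b t y).
(** Coefficients of the two linearised recursions along the orbit: [pU] is the forcing from the
    explicit t-dependence with the parameter frozen, [pV] the forcing from the parameter itself. *)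
Let rr i t := / slope (e i) t (x i t).
Let pU i t := - (rr i t * A (e i) 0%nat 1%nat t (x i t)).
Let pV i t := - (rr i t * AW (e i) 0%nat 0%nat t (x i t)).
Hypothesis HV : forall t V B, inD d t -> (forall i, Rabs (V i) <= B) ->
  aff_sol (fun i => rr i t) (fun i => pV i t) V -> kap <= Rabs (V 0%nat).

Let th := / lam.

Lemma reg_th : 0 <= th < 1.
Proof. pose proof (inv_lam lam Hlam). unfold th; lra. Qed.

Lemma reg_bounds : exists C, 0 <= C /\ forall i t, inD d t -> forall y, half (e i) y ->
  forall r, Rabs r <= th -> Rabs (- (r * A (e i) 0%nat 1%nat t y)) <= C /\
    Rabs (- (r * AW (e i) 0%nat 0%nat t y)) <= C.
Proof.
  destruct (fj_B HA) as [C1 H1]. destruct (fj_B HW) as [C2 H2].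
  pose proof reg_th as Ht.
  exists (Rabs C1 + Rabs C2). split; [pose proof (Rabs_pos C1); pose proof (Rabs_pos C2); lra|].
  intros i t Ht0 y Hy r Hr.
  assert (K : forall z Cz, Rabs z <= Cz -> Rabs (- (r * z)) <= Rabs Cz).
  { intros z Cz Hz. rewrite Rabs_Ropp, Rabs_mult. pose proof (Rle_abs Cz).
    replace (Rabs Cz) with (1 * Rabs Cz) by ring.
    apply Rmult_le_compat; try apply Rabs_pos; lra. }
  pose proof (Rabs_pos C1). pose proof (Rabs_pos C2).
  pose proof (K _ _ (H1 (e i) 0%nat 1%nat t y ltac:(lia) Hk Ht0 Hy)).
  pose proof (K _ _ (H2 (e i) 0%nat 0%nat t y ltac:(lia) ltac:(lia) Ht0 Hy)).
  split; lra.
Qed.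

Lemma slope_cont i (y : R -> R) t : inD d t -> (forall s, inD d s -> half (e i) (y s)) ->
  continuous y t -> continuous (fun s => slope (e i) s (y s)) t.
Proof.
  intros Ht Hy Cy. unfold slope.
  apply (continuous_plus (fun s => A (e i) 1%nat 0%nat s (y s)) (fun s => beta s * AW (e i) 1%nat 0%nat s (y s))).
  - apply (jet_comp_cont d k); auto; lia.
  - apply (continuous_mult beta (fun s => AW (e i) 1%nat 0%nat s (y s))); [auto|].
    apply (jet_comp_cont d k); auto; lia.
Qed.

Lemma slope_mvt b t u v : inD d t -> half b u -> half b v ->
  exists xi, (Rmin u v <= xi <= Rmax u v) /\
   (A b 0%nat 0%nat t v + beta t * AW b 0%nat 0%nat t v) - (A b 0%nat 0%nat t u + beta t * AW b 0%nat 0%nat t u)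
     = slope b t xi * (v - u).
Proof.
  intros Ht Hu Hv.
  apply (mvt_within (lo b) (hi b) (fun y => A b 0%nat 0%nat t y + beta t * AW b 0%nat 0%nat t y)); auto.
  - left; apply lo_hi.
  - intros z Hz. unfold slope.
    replace (A b 1%nat 0%nat t z) with (1 * A b 1%nat 0%nat t z) by ring.
    apply (deriv_within_ext (lo b) (hi b) (fun y => 1 * A b 0%nat 0%nat t y + beta t * AW b 0%nat 0%nat t y)); auto.
    + intros; ring.
    + apply deriv_within_lin; [apply (fj_x HA)|apply (fj_x HW)]; auto; lia.
Qed.

(** Formally x' = U + beta' V, and x_0 = 0 gives beta' = - U_0 / V_0. Since differentiability of
    [beta] is not known, the same identity is first proved for increments, with slopes at mean value
    points, and then passed to the limit. *)
Lemma reg_derivative t0 U V BU BV : inD d t0 ->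
  aff_sol (fun i => rr i t0) (fun i => pU i t0) U -> (forall i, Rabs (U i) <= BU) ->
  aff_sol (fun i => rr i t0) (fun i => pV i t0) V -> (forall i, Rabs (V i) <= BV) ->
  is_derive beta t0 (- U 0%nat * / V 0%nat) /\
  forall i, is_derive (x i) t0 (U i + (- U 0%nat * / V 0%nat) * V i).
Proof.
  intros H0 SU BdU SV BdV. pose proof reg_th as Hth.
  set (Px := fun i t xi => (Rmin (x i t0) (x i t) <= xi <= Rmax (x i t0) (x i t)) /\
    (A (e i) 0%nat 0%nat t (x i t) + beta t * AW (e i) 0%nat 0%nat t (x i t))
     - (A (e i) 0%nat 0%nat t (x i t0) + beta t * AW (e i) 0%nat 0%nat t (x i t0))
     = slope (e i) t xi * (x i t - x i t0)).
  set (xi := fun i t => epsilon (inhabits 0) (Px i t)).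
  assert (Hxi : forall i t, inD d t -> Px i t (xi i t)).
  { intros i t Ht. apply (epsilon_spec (inhabits 0) (Px i t)). apply slope_mvt; auto. }
  assert (xiK : forall i t, inD d t -> half (e i) (xi i t)).
  { intros i t Ht. destruct (Hxi i t Ht) as [Q _]. pose proof (HxK i t Ht) as K1. pose proof (HxK i t0 H0) as K2.
    unfold half, inCC, Rmin, Rmax in *. destruct (Rle_dec (x i t0) (x i t)); lra. }
  assert (xi0 : forall i, xi i t0 = x i t0).
  { intros i. destruct (Hxi i t0 H0) as [Q _]. rewrite Rmin_left, Rmax_left in Q by lra. lra. }
  (* The chosen mean value points need not vary continuously in t, but at t0 they are squeezed
     between [x i t0] and [x i t]. *)
  assert (xiC : forall i, continuous (xi i) t0).
  { intros i. apply (cont_within_inD d); auto. intros eps He.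
    destruct (proj1 (continuous_eps _ _) (Hxc i t0 H0) eps He) as [dl [D K]].
    exists dl. split; [exact D|]. intros t Ht Hd. rewrite xi0.
    destruct (Hxi i t Ht) as [Q _].
    eapply between_close; [exact Q| |apply K; exact Hd]. rewrite Rminus_diag, Rabs_R0. exact He. }
  set (r := fun i t => / slope (e i) t (xi i t)).
  assert (rB : forall i t, inD d t -> Rabs (r i t) <= th).
  { intros i t Ht. apply inv_small; auto. }
  assert (sN : forall i t, inD d t -> slope (e i) t (xi i t) <> 0).
  { intros i t Ht E. pose proof (Hbig (e i) t (xi i t) Ht (xiK i t Ht)) as Q. rewrite E, Rabs_R0 in Q. lra. }
  assert (r0 : forall i, r i t0 = rr i t0) by (intros; unfold r, rr; rewrite xi0; reflexivity).
  assert (rC : forall i, continuous (r i) t0).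
  { intros i. apply (continuous_Rinv_comp (fun t => slope (e i) t (xi i t))); auto.
    apply (slope_cont i (xi i)); auto. }
  set (pa := fun i t => diff_quot (fun s => A (e i) 0%nat 0%nat s (x i t0)) t0 (A (e i) 0%nat 1%nat t0 (x i t0)) t).
  set (pw := fun i (t : R) => AW (e i) 0%nat 0%nat t0 (x i t0)).
  assert (DA : forall i u, inD d u -> is_derive (fun s => A (e i) 0%nat 0%nat s (x i t0)) u (A (e i) 0%nat 1%nat u (x i t0))).
  { intros i u Hu. apply (jet_deriv_t d k); auto; lia. }
  destruct (fj_B HA) as [CA HCA]. destruct (fj_B HW) as [CW HCW].
  assert (paB : forall i t, inD d t -> Rabs (pa i t) <= CA).
  { intros i t Ht. apply (diff_quot_bound d (fun s => A (e i) 0%nat 0%nat s (x i t0)) (fun u => A (e i) 0%nat 1%nat u (x i t0))); auto.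
    intros u Hu. apply HCA; auto; lia. }
  assert (pwB : forall i t, Rabs (pw i t) <= CW) by (intros; apply HCW; auto; lia).
  set (C := Rabs CA + Rabs CW).
  assert (C0 : 0 <= C) by (unfold C; pose proof (Rabs_pos CA); pose proof (Rabs_pos CW); lra).
  assert (qB : forall i t z, inD d t -> Rabs z <= C -> Rabs (- (r i t * z)) <= C).
  { intros i t z Ht Hz. rewrite Rabs_Ropp, Rabs_mult. replace C with (1 * C) by ring.
    apply Rmult_le_compat; try apply Rabs_pos; auto. specialize (rB i t Ht). lra. }
  assert (paC : forall i t, inD d t -> Rabs (pa i t) <= C).
  { intros i t Ht. specialize (paB i t Ht). unfold C. pose proof (Rle_abs CA). pose proof (Rabs_pos CW). lra. }
  assert (pwC : forall i t, Rabs (pw i t) <= C).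
  { intros i t. specialize (pwB i t). unfold C. pose proof (Rle_abs CW). pose proof (Rabs_pos CA). lra. }
  assert (P0 : 0 <= C / (1 - th)).
  { apply Rmult_le_pos; [exact C0|]. left; apply Rinv_0_lt_compat; lra. }
  set (PU := fun t Z => aff_sol (fun i => r i t) (fun i => - (r i t * pa i t)) Z /\ forall i, Rabs (Z i) <= C / (1 - th)).
  set (PV := fun t Z => aff_sol (fun i => r i t) (fun i => - (r i t * pw i t)) Z /\ forall i, Rabs (Z i) <= C / (1 - th)).
  set (u := fun i t => epsilon (inhabits (fun _ : nat => 0)) (PU t) i).
  set (v := fun i t => epsilon (inhabits (fun _ : nat => 0)) (PV t) i).
  assert (HU : forall t, inD d t -> PU t (fun i => u i t)).
  { intros t Ht. apply (epsilon_spec (inhabits (fun _ : nat => 0)) (PU t)). apply aff_sol_exists; auto. }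
  assert (HVv : forall t, inD d t -> PV t (fun i => v i t)).
  { intros t Ht. apply (epsilon_spec (inhabits (fun _ : nat => 0)) (PV t)). apply aff_sol_exists; auto. }
  assert (uC : forall i, cont_within (inD d) (u i) t0).
  { apply (aff_sol_cont (inD d) r (fun i t => - (r i t * pa i t)) u th (C / (1 - th)) t0); auto.
    - intros i t Ht. apply (proj2 (HU t Ht)).
    - intros t Ht. apply (proj1 (HU t Ht)).
    - intros i. apply cont_within_of_continuous; auto.
    - intros i. apply cont_within_of_continuous.
      apply (continuous_opp (fun t => r i t * pa i t)). apply (continuous_mult (r i) (pa i)); auto.
      apply diff_quot_cont; auto. }
  assert (vC : forall i, cont_within (inD d) (v i) t0).
  { apply (aff_sol_cont (inD d) r (fun i t => - (r i t * pw i t)) v th (C / (1 - th)) t0); auto.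
    - intros i t Ht. apply (proj2 (HVv t Ht)).
    - intros t Ht. apply (proj1 (HVv t Ht)).
    - intros i. apply cont_within_of_continuous; auto.
    - intros i. apply cont_within_of_continuous.
      apply (continuous_opp (fun t => r i t * pw i t)). apply (continuous_mult (r i) (pw i)); auto.
      apply continuous_const. }
  assert (u0 : forall i, u i t0 = U i).
  { intros i. destruct (HU t0 H0) as [Q1 Q2].
    apply (aff_sol_unique (fun i => rr i t0) (fun i => pU i t0) (fun i => u i t0) U th (C / (1 - th)) BU); auto.
    - intros j. rewrite <- r0. auto.
    - intros j. rewrite (Q1 j). unfold pU. rewrite r0. unfold pa. rewrite diff_quot_t0. reflexivity. }
  assert (v0 : forall i, v i t0 = V i).
  { intros i. destruct (HVv t0 H0) as [Q1 Q2].
    apply (aff_sol_unique (fun i => rr i t0) (fun i => pV i t0) (fun i => v i t0) V th (C / (1 - th)) BV); auto.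
    - intros j. rewrite <- r0. auto.
    - intros j. rewrite (Q1 j). unfold pV. rewrite r0. reflexivity. }
  (* Both sides are bounded solutions of the same affine recursion, hence equal; index 0, where the
     left side vanishes, yields the increment of [beta]. *)
  assert (Rel : forall t, inD d t -> forall i, x i t - x i t0 = u i t * (t - t0) + (beta t - beta t0) * v i t).
  { intros t Ht. destruct (HU t Ht) as [Q1 Q2], (HVv t Ht) as [Q3 Q4].
    apply (aff_sol_unique (fun i => r i t)
       (fun i => - (r i t * (pa i t * (t - t0) + (beta t - beta t0) * pw i t)))
       (fun i => x i t - x i t0) (fun i => u i t * (t - t0) + (beta t - beta t0) * v i t) th 2
       (C / (1 - th) * Rabs (t - t0) + Rabs (beta t - beta t0) * (C / (1 - th)))); auto.
    - intros i. destruct (Hxi i t Ht) as [_ E].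
      unfold pa. rewrite <- diff_quot_eq. unfold pw. rewrite (HxS i t Ht), (HxS i t0 H0).
      apply (Rmult_eq_reg_l (slope (e i) t (xi i t))); [|auto].
      rewrite <- E. rewrite (AW0 (e i) t0 t). unfold r. field_simplify; [|auto].
      replace (AW (e i) 0%nat 0%nat t0 (x i t0)) with (AW (e i) 0%nat 0%nat t (x i t0)) by apply AW0.
      ring.
    - intros i. pose proof (half_inI _ _ (HxK i t Ht)) as [? ?]. pose proof (half_inI _ _ (HxK i t0 H0)) as [? ?].
      apply Rabs_le. lra.
    - intros i. rewrite (Q1 i), (Q3 i) at 1. ring.
    - intros i. eapply Rle_trans; [apply Rabs_triang|]. rewrite !Rabs_mult.
      apply Rplus_le_compat; [apply Rmult_le_compat_r|apply Rmult_le_compat_l]; try apply Rabs_pos; auto. }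
  assert (V0 : kap <= Rabs (V 0%nat)) by (apply (HV t0 V BV H0 BdV SV)).
  assert (vN : locally t0 (fun t => inD d t /\ v 0%nat t <> 0)).
  { assert (vC0 : continuous (v 0%nat) t0) by (apply (cont_within_inD d); auto).
    destruct (proj1 (continuous_eps _ _) vC0 kap Hkap) as [dl [D K]].
    destruct (inD_open d t0 H0) as [d7 [D7 K7]].
    exists (mkposreal (Rmin dl d7) (Rmin_pos _ _ D D7)). intros t Ht.
    change (Rabs (t - t0) < Rmin dl d7) in Ht. pose proof (Rmin_l dl d7). pose proof (Rmin_r dl d7).
    split; [apply K7; lra|]. intros E. specialize (K t ltac:(lra)). rewrite E, v0 in K.
    rewrite Rminus_0_l, Rabs_Ropp in K. lra. }
  assert (bq : forall t, inD d t -> v 0%nat t <> 0 ->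
     beta t - beta t0 = (- u 0%nat t * / v 0%nat t) * (t - t0)).
  { intros t Ht Hn. pose proof (Rel t Ht 0%nat) as E. rewrite !Hx0, Rminus_diag in E by auto.
    apply (Rmult_eq_reg_r (v 0%nat t)); [|exact Hn]. field_simplify; auto. lra. }
  assert (QC : continuous (fun t => - u 0%nat t * / v 0%nat t) t0).
  { apply (continuous_mult (fun t => - u 0%nat t) (fun t => / v 0%nat t)).
    - apply (continuous_opp (u 0%nat)). apply (cont_within_inD d); auto.
    - apply (continuous_Rinv_comp (v 0%nat)); [apply (cont_within_inD d); auto|].
      rewrite v0. intros E; rewrite E, Rabs_R0 in V0; lra. }
  split.
  - rewrite <- u0, <- v0.
    apply (caratheodory d beta t0 (fun t => - u 0%nat t * / v 0%nat t)); auto.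
    apply (filter_imp (fun t => inD d t /\ v 0%nat t <> 0)); [|exact vN].
    intros t [Ht Hn]. auto.
  - intros i. rewrite <- (u0 i), <- (v0 i), <- (u0 0%nat), <- (v0 0%nat).
    apply (caratheodory d (x i) t0 (fun t => u i t + (- u 0%nat t * / v 0%nat t) * v i t)); auto.
    + apply (continuous_plus (u i) (fun t => (- u 0%nat t * / v 0%nat t) * v i t)).
      * apply (cont_within_inD d); auto.
      * apply (continuous_mult (fun t => - u 0%nat t * / v 0%nat t) (v i)); auto.
        apply (cont_within_inD d); auto.
    + apply (filter_imp (fun t => inD d t /\ v 0%nat t <> 0)); [|exact vN].
      intros t [Ht Hn]. rewrite (Rel t Ht i), (bq t Ht Hn). ring.
Qed.

(** Bootstrap: if [beta] and the orbit are of class C^n, then so are the slopes and the linearised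
    solutions [u], [v], hence beta' = - u_0 / v_0 and x' = u + beta' v. The slopes and forcings
    already use one derivative of the field, so the step requires n + 1 <= k and the process ends
    exactly at C^k. *)
Lemma regularity : unif_Ck d k (fun _ => beta) /\ unif_Ck d k x.
Proof.
  pose proof reg_th as Hth. destruct reg_bounds as [C [C0 HC]].
  assert (sN : forall i t, inD d t -> slope (e i) t (x i t) <> 0).
  { intros i t Ht E. pose proof (Hbig (e i) t (x i t) Ht (HxK i t Ht)) as Q. rewrite E, Rabs_R0 in Q. lra. }
  assert (rB : forall i t, inD d t -> Rabs (rr i t) <= th).
  { intros i t Ht. apply inv_small; auto. }
  set (PU := fun t Z => aff_sol (fun i => rr i t) (fun i => pU i t) Z /\ forall i, Rabs (Z i) <= C / (1 - th)).
  set (PV := fun t Z => aff_sol (fun i => rr i t) (fun i => pV i t) Z /\ forall i, Rabs (Z i) <= C / (1 - th)).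
  set (u := fun i t => epsilon (inhabits (fun _ : nat => 0)) (PU t) i).
  set (v := fun i t => epsilon (inhabits (fun _ : nat => 0)) (PV t) i).
  assert (HU : forall t, inD d t -> PU t (fun i => u i t)).
  { intros t Ht. apply (epsilon_spec (inhabits (fun _ : nat => 0)) (PU t)). apply aff_sol_exists; auto.
    intros i. apply (HC i t Ht (x i t) (HxK i t Ht) (rr i t) (rB i t Ht)). }
  assert (HVv : forall t, inD d t -> PV t (fun i => v i t)).
  { intros t Ht. apply (epsilon_spec (inhabits (fun _ : nat => 0)) (PV t)). apply aff_sol_exists; auto.
    intros i. apply (HC i t Ht (x i t) (HxK i t Ht) (rr i t) (rB i t Ht)). }
  assert (Der : forall t, inD d t -> is_derive beta t (- u 0%nat t * / v 0%nat t) /\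
     forall i, is_derive (x i) t (u i t + (- u 0%nat t * / v 0%nat t) * v i t)).
  { intros t Ht. destruct (HU t Ht) as [Q1 Q2], (HVv t Ht) as [Q3 Q4].
    apply (reg_derivative t (fun i => u i t) (fun i => v i t) (C / (1 - th)) (C / (1 - th))); auto. }
  assert (V0 : forall t, inD d t -> kap <= Rabs (v 0%nat t)).
  { intros t Ht. destruct (HVv t Ht) as [Q3 Q4]. apply (HV t (fun i => v i t) (C / (1 - th)) Ht Q4 Q3). }
  assert (X0 : exists M, forall i t, inD d t -> Rabs (x i t) <= M).
  { exists 1. intros i t Ht. destruct (half_inI _ _ (HxK i t Ht)). apply Rabs_le; lra. }
  destruct Hbb as [B HB].
  assert (Ind : forall n, (n <= k)%nat -> unif_Ck d n (fun _ => beta) /\ unif_Ck d n x).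
  { induction n; intros Hn.
    - split; (split; [|split; [|exact I]]); auto. exists B; auto.
    - destruct (IHn ltac:(lia)) as [Ub Ux].
      assert (Us : unif_Ck d n (fun i t => slope (e i) t (x i t))).
      { apply unif_Ck_plus; [apply (unif_Ck_jet d k); auto; lia|]. apply unif_Ck_mult; [exact Ub|].
        apply (unif_Ck_jet d k); auto; lia. }
      assert (Ur : unif_Ck d n rr) by (apply (unif_Ck_inv d n _ lam); auto; lra).
      assert (Uu : unif_Ck d n u).
      { apply (unif_Ck_aff d n rr pU u th (C / (1 - th))); auto.
        - intros i t Ht. apply (proj2 (HU t Ht)).
        - intros t Ht. apply (proj1 (HU t Ht)).
        - apply unif_Ck_opp, unif_Ck_mult; [exact Ur|]. apply (unif_Ck_jet d k); auto; lia. }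
      assert (Uv : unif_Ck d n v).
      { apply (unif_Ck_aff d n rr pV v th (C / (1 - th))); auto.
        - intros i t Ht. apply (proj2 (HVv t Ht)).
        - intros t Ht. apply (proj1 (HVv t Ht)).
        - apply unif_Ck_opp, unif_Ck_mult; [exact Ur|]. apply (unif_Ck_jet d k); auto; lia. }
      assert (Uq : unif_Ck d n (fun _ t => - u 0%nat t * / v 0%nat t)).
      { apply unif_Ck_mult.
        - apply unif_Ck_opp. apply (unif_Ck_reindex d n u (fun _ => 0%nat) Uu).
        - apply (unif_Ck_inv d n (fun _ => v 0%nat) kap); auto. apply (unif_Ck_reindex d n v (fun _ => 0%nat) Uv). }
      split.
      + split; [exists B; auto|]. split; [auto|]. exists (fun _ t => - u 0%nat t * / v 0%nat t).
        split; [intros; apply Der; auto|exact Uq].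
      + split; [exact X0|]. split; [auto|]. exists (fun i t => u i t + (- u 0%nat t * / v 0%nat t) * v i t).
        split; [intros; apply Der; auto|]. apply unif_Ck_plus; [exact Uu|]. apply unif_Ck_mult; auto. }
  apply Ind. lia.
Qed.

End Regularity.

(** * The two-parameter family f_t + s w *)

Lemma inD_Rabs d t : inD d t <-> Rabs t < d.
Proof.
  unfold inD. split; [intros; now apply Rabs_def1|]. intros H; apply Rabs_def2 in H; lra.
Qed.

Lemma inD_le d d' t : d' <= d -> inD d' t -> inD d t.
Proof. unfold inD; lra. Qed.

Lemma in_Bk_ext k f g : (forall x, inI x -> f x = g x) -> in_Bk k f -> in_Bk k g.
Proof.
  intros E H. apply in_Bk_intro.
  - intros b. apply (Ck_half_ext k b f g); [|now apply in_Bk_half]. intros x Hx. apply E. now apply (half_inI b).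
  - destruct H as [_ [_ H]]. rewrite <- !E by (unfold inI; lra). exact H.
Qed.

Lemma normk_le_ext k f g M : (forall x, inI x -> f x = g x) -> normk_le k f M -> normk_le k g M.
Proof.
  intros E H. apply normk_le_iff in H. destruct H as [H1 H2]. apply normk_le_iff.
  assert (Q : forall b, Ck_half k b g /\ forall i x, (i <= k)%nat -> half b x -> Dhalf b i g x = Dhalf b i f x).
  { intros b. apply (Ck_half_ext k b f g); auto. intros x Hx. apply E. now apply (half_inI b). }
  split; [intros b; apply Q|]. intros b i x Hi Hx. rewrite (proj2 (Q b)); auto.
Qed.

Lemma Bk_deriv_ext k d F G t0 L : (forall t x, inD d t -> inI x -> F t x = G t x) -> inD d t0 ->
  Bk_deriv k d F t0 L -> Bk_deriv k d G t0 L.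
Proof.
  intros E H0 [H1 H2]. split; [exact H1|]. intros eps He. destruct (H2 eps He) as [dl [D K]].
  exists dl. split; [exact D|]. intros t Ht Hd. eapply normk_le_ext; [|apply K; eauto].
  intros x Hx. simpl. rewrite !E by auto. reflexivity.
Qed.

Lemma Bk_cont_ext k d F G t0 : (forall t x, inD d t -> inI x -> F t x = G t x) -> inD d t0 ->
  Bk_cont k d F t0 -> Bk_cont k d G t0.
Proof.
  intros E H0 H2 eps He. destruct (H2 eps He) as [dl [D K]].
  exists dl. split; [exact D|]. intros t Ht Hd. eapply normk_le_ext; [|apply K; eauto].
  intros x Hx. simpl. rewrite !E by auto. reflexivity.
Qed.

(** A curve prescribes [DF 0] only on I. Replacing it by [F] makes the two equal as functions, so
    that their chosen derivatives are literally the same. *)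
Lemma curve_normalize k j d F DF :
  (forall t, inD d t -> in_Bk k (F t)) -> Cj_curve_with k j d F DF ->
  Cj_curve_with k j d F (fun l => match l with O => F | S _ => DF l end).
Proof.
  intros HF (H1 & H2 & H3 & H4). split; [reflexivity|]. split; [|split].
  - intros [|i] t Hi Ht; auto.
  - intros i t Hi Ht. destruct i.
    + apply (Bk_deriv_ext k d (DF O)); auto.
    + apply H3; auto.
  - intros t Ht. destruct j; [|apply H4; auto]. apply (Bk_cont_ext k d (DF O)); auto.
Qed.

Lemma normk_diff_half k f g M b i x : (forall b, Ck_half k b f) -> (forall b, Ck_half k b g) ->
  normk_le k (fun x => f x - g x) M -> (i <= k)%nat -> half b x ->
  Rabs (Dhalf b i f x - Dhalf b i g x) <= M.
Proof.
  intros Hf Hg H Hi Hx. apply normk_le_iff in H. destruct H as [_ H].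
  specialize (H b i x Hi Hx).
  destruct (Ck_half_lin k b f g 1 (-1) (Hf b) (Hg b)) as [Q1 Q2].
  replace (Dhalf b i f x - Dhalf b i g x) with (Dhalf b i (fun x => f x - g x) x); [exact H|].
  rewrite (proj2 (Ck_half_ext k b (fun x => 1 * f x + -1 * g x) (fun x => f x - g x) ltac:(intros; cbv beta; ring) Q1)) by auto.
  rewrite Q2 by auto. ring.
Qed.

Lemma normk_lin k f g c e M : (forall b, Ck_half k b f) -> (forall b, Ck_half k b g) ->
  (forall b i x, (i <= k)%nat -> half b x -> Rabs (c * Dhalf b i f x + e * Dhalf b i g x) <= M) ->
  normk_le k (fun x => c * f x + e * g x) M.
Proof.
  intros Hf Hg H. apply normk_le_iff. split.
  - intros b. apply (Ck_half_lin k b f g c e (Hf b) (Hg b)).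
  - intros b i x Hi Hx. rewrite (proj2 (Ck_half_lin k b f g c e (Hf b) (Hg b))); auto.
Qed.

Definition jet (DF : nat -> R -> R -> R) (b : bool) (a l : nat) (t x : R) : R := Dhalf b a (DF l t) x.

(** The jet of the constant curve t -> w, which lets [w] be treated as a field on the same footing
    as f_t. *)
Definition wjet (w : R -> R) (b : bool) (a l : nat) (t x : R) : R :=
  match l with O => Dhalf b a w x | S _ => 0 end.

Lemma Ck_half_deriv k b g a x : Ck_half k b g -> (a < k)%nat -> half b x ->
  deriv_within (lo b) (hi b) (Dhalf b a g) x (Dhalf b (S a) g x).
Proof. intros H Ha Hx. apply (proj1 H); auto. Qed.

Lemma wjet_field k d w : in_Bk k w -> field_jet d k (wjet w).
Proof.
  intros Hw. assert (HC : forall b, Ck_half k b w) by (intros; now apply in_Bk_half).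
  destruct (in_Bk_norm k w Hw) as [M [M0 HM]]. apply normk_le_iff in HM. destruct HM as [_ HM].
  split.
  - intros b a l t0 Ha Hl H0 eps He. exists 1. split; [lra|]. intros t Ht Hd x Hx.
    replace (wjet w b a l t x - wjet w b a l t0 x - (t - t0) * wjet w b a (S l) t0 x) with 0
      by (destruct l; unfold wjet; ring).
    rewrite Rabs_R0. apply Rmult_le_pos; [lra|apply Rabs_pos].
  - intros b a l t x Ha Hl Ht Hx. destruct l; unfold wjet.
    + apply (Ck_half_deriv k); auto.
    + apply deriv_within_eps. intros eps He. exists 1. split; [lra|]. intros y _ _.
      replace (0 - 0 - 0 * (y - x)) with 0 by ring. rewrite Rabs_R0.
      apply Rmult_le_pos; [lra|apply Rabs_pos].
  - exists M. intros b a l t x Ha Hl Ht Hx. destruct l; unfold wjet; [apply HM; auto|rewrite Rabs_R0; exact M0].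
  - intros b a l t0 Ha Hl H0 eps He. exists 1. split; [lra|]. intros t Ht Hd x Hx.
    destruct l; unfold wjet; rewrite Rminus_diag, Rabs_R0; lra.
  - intros b a l t x Ha Hl Ht Hx. destruct l; unfold wjet.
    + apply (CkOn_cont k); [apply HC|exact Ha|exact Hx].
    + intros eps He. exists 1. split; [lra|]. intros. rewrite Rminus_diag, Rabs_R0. exact He.
Qed.

Lemma Bk_deriv_cont k d F t0 L : (forall t, inD d t -> in_Bk k (F t)) -> inD d t0 ->
  Bk_deriv k d F t0 L -> Bk_cont k d F t0.
Proof.
  intros HF H0 [HL H] eps He.
  destruct (in_Bk_norm k L HL) as [M [M0 HM]].
  destruct (H (eps / 2)) as [dl [D K]]; [lra|].
  assert (E1 : 0 < eps / 2 / (M + 1)) by (apply Rdiv_lt_0_compat; lra).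
  exists (Rmin dl (Rmin 1 (eps / 2 / (M + 1)))). split; [repeat apply Rmin_pos; auto; lra|].
  intros t Ht Hd. pose proof (Rmin_l dl (Rmin 1 (eps / 2 / (M + 1)))).
  pose proof (Rmin_r dl (Rmin 1 (eps / 2 / (M + 1)))).
  pose proof (Rmin_l 1 (eps / 2 / (M + 1))). pose proof (Rmin_r 1 (eps / 2 / (M + 1))).
  specialize (K t Ht ltac:(lra)).
  apply (normk_le_ext k (fun x => 1 * (F t x - F t0 x - (t - t0) * L x) + (t - t0) * L x)); [intros; ring|].
  apply normk_le_iff in K. destruct K as [K1 K2]. apply normk_le_iff in HM. destruct HM as [_ HM].
  apply normk_lin.
  - exact K1.
  - intros b. now apply in_Bk_half.
  - intros b i x Hi Hx. specialize (K2 b i x Hi Hx). specialize (HM b i x Hi Hx).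
    eapply Rle_trans; [apply Rabs_triang|]. rewrite Rmult_1_l, Rabs_mult.
    assert (Rabs (t - t0) * Rabs (Dhalf b i L x) <= eps / 2 / (M + 1) * (M + 1)).
    { apply Rmult_le_compat; try apply Rabs_pos; lra. }
    replace (eps / 2 / (M + 1) * (M + 1)) with (eps / 2) in H5 by (field; lra).
    assert (eps / 2 * Rabs (t - t0) <= eps / 2 * 1) by (apply Rmult_le_compat_l; lra).
    lra.
Qed.

Lemma curve_cont k d F DF l t0 : Cj_curve_with k k d F DF -> (l <= k)%nat -> inD d t0 ->
  Bk_cont k d (DF l) t0.
Proof.
  intros (H1 & H2 & H3 & H4) Hl H0. destruct (Nat.eq_dec l k) as [->|]; [auto|].
  apply (Bk_deriv_cont k d (DF l) t0 (DF (S l) t0)); auto. apply H3; auto; lia.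
Qed.

(** A curve that is continuous on an open interval may be unbounded there. Continuity at 0 of its
    finitely many derivatives bounds them all after shrinking the interval. *)
Lemma curve_bounded k e F DF : 0 < e -> Cj_curve_with k k e F DF ->
  exists d C, 0 < d /\ d <= e /\ forall l t b a x, (l <= k)%nat -> inD d t -> (a <= k)%nat ->
    half b x -> Rabs (Dhalf b a (DF l t) x) <= C.
Proof.
  intros He HC. pose proof HC as (H1 & H2 & H3 & H4).
  assert (I0 : inD e 0) by (unfold inD; lra).
  assert (Q : forall n, (n <= S k)%nat -> exists d C, 0 < d /\ d <= e /\ forall l t b a x, (l < n)%nat -> inD d t -> (a <= k)%nat ->
    half b x -> Rabs (Dhalf b a (DF l t) x) <= C).
  { induction n; intros Hn.
    - exists e, 0. split; [exact He|]. split; [lra|]. intros; lia.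
    - destruct (IHn ltac:(lia)) as [d [C [D [De K]]]].
      destruct (curve_cont k e F DF n 0 HC ltac:(lia) I0 1 Rlt_0_1) as [d1 [D1 K1]].
      destruct (in_Bk_norm k (DF n 0)) as [M [M0 HM]]; [apply H2; auto; lia|].
      apply normk_le_iff in HM. destruct HM as [_ HM].
      exists (Rmin d d1), (Rmax C (1 + M)). split; [now apply Rmin_pos|].
      pose proof (Rmin_l d d1). pose proof (Rmin_r d d1). split; [lra|].
      intros l t b a x Hl Ht Ha Hx.
      pose proof (Rmax_l C (1 + M)). pose proof (Rmax_r C (1 + M)).
      destruct (Nat.eq_dec l n) as [->|].
      + assert (Ht' : inD e t) by (apply (inD_le e (Rmin d d1)); auto; lra).
        assert (A1 : Rabs (t - 0) < d1) by (rewrite Rminus_0_r; apply inD_Rabs in Ht; lra).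
        pose proof (normk_diff_half k (DF n t) (DF n 0) 1 b a x) as Q.
        specialize (Q ltac:(intros; apply in_Bk_half, H2; auto; lia) ltac:(intros; apply in_Bk_half, H2; auto; lia)
          (K1 t Ht' A1) Ha Hx).
        specialize (HM b a x Ha Hx).
        replace (Dhalf b a (DF n t) x) with ((Dhalf b a (DF n t) x - Dhalf b a (DF n 0) x) + Dhalf b a (DF n 0) x) by ring.
        eapply Rle_trans; [apply Rabs_triang|]. lra.
      + eapply Rle_trans; [apply (K l t b a x); auto; try lia|lra].
        apply (inD_le d (Rmin d d1)); auto. }
  destruct (Q (S k) (Nat.le_refl _)) as [d [C [D [De K]]]].
  exists d, C. split; [exact D|]. split; [exact De|]. intros. apply K; auto; lia.
Qed.

Lemma jet_field k e d C F DF : Cj_curve_with k k e F DF -> d <= e ->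
  (forall l t b a x, (l <= k)%nat -> inD d t -> (a <= k)%nat ->
    half b x -> Rabs (Dhalf b a (DF l t) x) <= C) ->
  field_jet d k (jet DF).
Proof.
  intros HC Hde HB. pose proof HC as (H1 & H2 & H3 & H4).
  assert (Sub : forall t, inD d t -> inD e t) by (intros t; now apply inD_le).
  assert (Ck : forall l t b, (l <= k)%nat -> inD d t -> Ck_half k b (DF l t)).
  { intros. apply in_Bk_half, H2; auto. }
  split; unfold jet.
  - intros b a l t0 Ha Hl H0 eps He.
    destruct (H3 l t0 Hl (Sub _ H0)) as [HL H5].
    destruct (H5 eps He) as [dl [D K]]. exists dl. split; [exact D|]. intros t Ht Hd x Hx.
    specialize (K t (Sub _ Ht) Hd). apply normk_le_iff in K. destruct K as [_ K].
    specialize (K b a x Ha Hx).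
    destruct (Ck_half_lin k b (DF l t) (DF l t0) 1 (-1)) as [Q1 Q2]; [apply Ck; auto; lia|apply Ck; auto; lia|].
    destruct (Ck_half_lin k b _ (DF (S l) t0) 1 (- (t - t0)) Q1) as [Q3 Q4]; [apply Ck; auto; lia|].
    assert (Q5 : forall x, half b x -> 1 * (1 * DF l t x + -1 * DF l t0 x) + - (t - t0) * DF (S l) t0 x
       = DF l t x - DF l t0 x - (t - t0) * DF (S l) t0 x) by (intros; ring).
    rewrite (proj2 (Ck_half_ext k b _ (fun x => DF l t x - DF l t0 x - (t - t0) * DF (S l) t0 x) Q5 Q3)) in K by auto.
    rewrite Q4, Q2 in K by auto.
    eapply Rle_trans; [|exact K]. right. f_equal. ring.
  - intros b a l t x Ha Hl Ht Hx. apply (Ck_half_deriv k); auto.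
  - exists C. intros. apply HB; auto.
  - intros b a l t0 Ha Hl H0 eps He.
    destruct (curve_cont k e F DF l t0 HC Hl (Sub _ H0) eps He) as [dl [D K]].
    exists dl. split; [exact D|]. intros t Ht Hd x Hx.
    apply (normk_diff_half k); auto.
  - intros b a l t x Ha Hl Ht Hx. apply (CkOn_cont k); auto. apply Ck; auto.
Qed.

Definition branches (F : R -> R -> R) (w : R -> R) (t s : R) (b : bool) (x : R) : R :=
  ext b (F t) x + s * ext b w x.
Definition branches_deriv (F : R -> R -> R) (w : R -> R) (t s : R) (b : bool) (x : R) : R :=
  Dext b (F t) x + s * Dext b w x.

Lemma glue_branches F w t s x : inI x -> glue (branches F w t s) x = F t x + s * w x.
Proof.
  intros Hx. unfold glue, branches. rewrite !ext_in by (apply half_of; [apply side_closed|exact Hx]). reflexivity.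
Qed.

Lemma unimodal_slopes k g : unimodal k g -> exists a, 1 < a /\ forall b x, half b x -> a <= sg b * Dhalf b 1 g x.
Proof.
  intros (_ & _ & _ & [a [Ha H1]] & [a' [Ha' H2]] & _).
  exists (Rmin a (- a')). split; [apply Rmin_glb_lt; lra|].
  pose proof (Rmin_l a (- a')). pose proof (Rmin_r a (- a')).
  intros b x Hx. destruct b; simpl.
  - specialize (H1 x Hx). unfold DL in H1. change (Dpiece (-1) 0 1 g x) with (Dhalf true 1 g x) in H1. simpl in H1. lra.
  - specialize (H2 x Hx). unfold DR in H2. change (Dpiece 0 1 1 g x) with (Dhalf false 1 g x) in H2. simpl in H2. lra.
Qed.

Lemma sg_abs b y a : 0 < a -> a <= sg b * y -> a <= Rabs y.
Proof.
  intros Ha H. destruct b; simpl in H; eapply Rle_trans; try exact H.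
  - rewrite Rmult_1_l. apply Rle_abs.
  - rewrite <- Rabs_Ropp. eapply Rle_trans; [|apply Rle_abs]. lra.
Qed.

Lemma expanding_pair_intro lam G DG : 1 < lam -> (forall b x, is_derive (G b) x (DG b x)) ->
  (forall b x, lam <= sg b * DG b x) -> G true (-1) = -1 -> G false 1 = -1 -> G true 0 = G false 0 ->
  expanding_pair lam G.
Proof.
  intros Hl HD Hb E1 E2 E3.
  assert (Cn : forall b x, continuous (G b) x).
  { intros b x. apply (ex_derive_continuous (G b)). eexists; apply HD. }
  split; auto. intros b x y Hxy.
  destruct (MVT_gen (G b) x y (DG b)) as [c [_ E]].
  - intros; apply HD.
  - intros z _. apply continuity_pt_filterlim, Cn.
  - rewrite E, <- Rmult_assoc. apply Rmult_le_compat_r; [lra|apply Hb].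
Qed.

Record setup (k : nat) (e lam C d : R) (F : R -> R -> R) (DF : nat -> R -> R -> R) (w : R -> R) : Prop := {
  su_k : (2 <= k)%nat;
  su_d : 0 < d; su_de : d <= e;
  su_curve : Cj_curve_with k k e F DF;
  su_F : DF 0%nat = F;
  su_U : forall t, inD e t -> unimodal k (F t);
  su_w : in_Bk k w; su_wl : w (-1) = 0; su_wr : w 1 = 0;
  su_slope : forall t s b x, Rabs t < d -> Rabs s < d -> half b x ->
     lam <= sg b * (Dhalf b 1 (F t) x + s * Dhalf b 1 w x);
  su_jet : field_jet d k (jet DF);
  su_pf : parameter_family lam C d (branches F w) (branches_deriv F w) (fun b => ext b w) }.

Arguments su_k {_ _ _ _ _ _ _ _}.
Arguments su_d {_ _ _ _ _ _ _ _}.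
Arguments su_de {_ _ _ _ _ _ _ _}.
Arguments su_curve {_ _ _ _ _ _ _ _}.
Arguments su_F {_ _ _ _ _ _ _ _}.
Arguments su_U {_ _ _ _ _ _ _ _}.
Arguments su_w {_ _ _ _ _ _ _ _}.
Arguments su_wl {_ _ _ _ _ _ _ _}.
Arguments su_wr {_ _ _ _ _ _ _ _}.
Arguments su_slope {_ _ _ _ _ _ _ _}.
Arguments su_jet {_ _ _ _ _ _ _ _}.
Arguments su_pf {_ _ _ _ _ _ _ _}.

Lemma setup_exists k e F w : (2 <= k)%nat -> 0 < e -> Ck_family k k e F ->
  in_Bk k w -> w (-1) = 0 -> w 1 = 0 ->
  exists lam C d DF, setup k e lam C d F DF w.
Proof.
  intros Hk He [HU [DF0 HC0]] Hw wl wr.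
  assert (HFB : forall t, inD e t -> in_Bk k (F t)) by (intros t Ht; apply (HU t Ht)).
  pose proof (curve_normalize k k e F DF0 HFB HC0) as HC. clear HC0.
  set (DF := fun l => match l with O => F | S _ => DF0 l end) in *.
  assert (I0 : inD e 0) by (unfold inD; lra).
  destruct (curve_bounded k e F DF He HC) as [d1 [CA [D1 [De1 HB]]]].
  destruct (in_Bk_norm k w Hw) as [Nw [Nw0 HNw]]. apply normk_le_iff in HNw. destruct HNw as [Cw HNw].
  destruct (unimodal_slopes k (F 0) (HU 0 I0)) as [a [Ha Hsl]].
  (* The changes of slope due to t and to s are each at most [eta], and a - 2 eta = (a + 1) / 2 =
     [lam]. *)
  set (lam := (a + 1) / 2). set (eta := (a - 1) / 4).
  destruct (curve_cont k e F DF 0 0 HC ltac:(lia) I0 eta) as [d2 [D2 K2]]; [unfold eta; lra|].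
  assert (E3 : 0 < eta / (Nw + 1)) by (apply Rdiv_lt_0_compat; unfold eta; lra).
  set (d := Rmin d1 (Rmin d2 (eta / (Nw + 1)))).
  pose proof (Rmin_l d1 (Rmin d2 (eta / (Nw + 1)))). pose proof (Rmin_r d1 (Rmin d2 (eta / (Nw + 1)))).
  pose proof (Rmin_l d2 (eta / (Nw + 1))). pose proof (Rmin_r d2 (eta / (Nw + 1))).
  assert (D : 0 < d) by (unfold d; repeat apply Rmin_pos; auto).
  fold d in H, H0.
  assert (De : d <= e) by lra.
  assert (Sub : forall t, Rabs t < d -> inD e t) by (intros t Ht; apply inD_Rabs; lra).
  assert (Sub1 : forall t, inD d t -> inD d1 t) by (intros t; apply inD_le; lra).
  assert (Hslope : forall t s b x, Rabs t < d -> Rabs s < d -> half b x ->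
     lam <= sg b * (Dhalf b 1 (F t) x + s * Dhalf b 1 w x)).
  { intros t s b x Ht Hs Hx.
    assert (A1 : Rabs (t - 0) < d2) by (rewrite Rminus_0_r; lra).
    pose proof (normk_diff_half k (F t) (F 0) eta b 1 x ltac:(intros; apply in_Bk_half, HFB; auto)
       ltac:(intros; apply in_Bk_half, HFB; auto) (K2 t (Sub t Ht) A1) ltac:(lia) Hx) as Q.
    specialize (Hsl b x Hx). specialize (HNw b 1%nat x ltac:(lia) Hx).
    assert (B : Rabs (s * Dhalf b 1 w x) <= eta).
    { rewrite Rabs_mult. apply Rle_trans with (eta / (Nw + 1) * (Nw + 1)); [|right; field; lra].
      apply Rmult_le_compat; try apply Rabs_pos; lra. }
    assert (T : forall z b0, Rabs z <= b0 -> - b0 <= z <= b0).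
    { intros z b0 Hz. split; [|eapply Rle_trans; [apply Rle_abs|exact Hz]].
      pose proof (Rle_abs (- z)) as Qz. rewrite Rabs_Ropp in Qz. lra. }
    apply T in Q. apply T in B. unfold lam, eta in *. destruct b; simpl sg in *; lra. }
  assert (HJ : field_jet d k (jet DF)).
  { apply (jet_field k e d CA F DF HC De). intros. apply HB; auto. }
  assert (Hl : 1 < lam) by (unfold lam; lra).
  pose proof (orbit_bound_gt_1 lam Hl) as HM.
  assert (Ck1 : forall t b, Rabs t < d -> Ck_half 1 b (F t)).
  { intros t b Ht. apply (CkOn_mono k 1); [lia|]. apply in_Bk_half, HFB; auto. }
  assert (Cw1 : forall b, Ck_half 1 b w) by (intros b; apply (CkOn_mono k 1); [lia|apply Cw]).
  assert (HDer : forall t s b x, Rabs t < d -> Rabs s < d -> is_derive (branches F w t s b) x (branches_deriv F w t s b x)).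
  { intros t s b x Ht Hs. unfold branches, branches_deriv.
    apply (is_derive_plus (ext b (F t)) (fun x => s * ext b w x)).
    - apply ext_derive; auto.
    - apply (is_derive_scal (ext b w) x s). apply ext_derive; auto. }
  assert (HBig : forall t s b x, Rabs t < d -> Rabs s < d -> lam <= sg b * branches_deriv F w t s b x).
  { intros t s b x Ht Hs. unfold branches_deriv, Dext. apply Hslope; auto. apply clamp_half. }
  assert (CA0 : 0 <= CA).
  { eapply Rle_trans; [apply Rabs_pos|]. apply (HB 0%nat 0 true 0%nat 0); try lia; unfold inD, half, inCC; simpl; lra. }
  (* A tangent extension at x is bounded by a value plus a slope times the distance from x to the
     half interval, which is at most [orbit_bound lam + 1]. *)
  set (C := (CA + Nw) * (orbit_bound lam + 2)).
  exists lam, C, d, DF.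
  assert (Hcx : forall b x, Rabs x <= orbit_bound lam -> Rabs (x - clamp (lo b) (hi b) x) <= orbit_bound lam + 1).
  { intros b x Hx. eapply Rle_trans; [apply Rabs_minus_le|].
    destruct (half_inI b _ (clamp_half b x)). apply Rplus_le_compat; [exact Hx|]. apply Rabs_le; lra. }
  split; auto. split; auto.
  - unfold C. apply Rmult_le_pos; lra.
  - intros t s Ht Hs. destruct (HU t (Sub t Ht)) as (_ & Fl & Fr & _).
    apply (expanding_pair_intro lam (branches F w t s) (branches_deriv F w t s)); [exact Hl|intros; apply HDer; auto|intros; apply HBig; auto| | |]; unfold branches.
    + rewrite !ext_in by (unfold half, inCC; simpl; lra). rewrite Fl, wl, Rmult_0_r. apply Rplus_0_r.
    + rewrite !ext_in by (unfold half, inCC; simpl; lra). rewrite Fr, wr, Rmult_0_r. apply Rplus_0_r.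
    + rewrite !ext_in by (unfold half, inCC; simpl; lra). reflexivity.
  - intros t s b x Ht Hs. apply (sg_abs b); [lra|]. auto.
  - intros t s s' b x. unfold branches. ring.
  - intros b x Hx. unfold ext. set (c := clamp (lo b) (hi b) x).
    pose proof (HNw b 0%nat c ltac:(lia) (clamp_half b x)) as A0.
    pose proof (HNw b 1%nat c ltac:(lia) (clamp_half b x)) as A1.
    change (Dhalf b 0 w c) with (w c) in A0. specialize (Hcx b x Hx). fold c in Hcx.
    eapply Rle_trans; [apply Rabs_triang|]. rewrite Rabs_mult.
    assert (Rabs (Dhalf b 1 w c) * Rabs (x - c) <= Nw * (orbit_bound lam + 1)).
    { apply Rmult_le_compat; try apply Rabs_pos; auto. }
    assert (0 <= CA * (orbit_bound lam + 2)) by (apply Rmult_le_pos; lra).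
    unfold C. lra.
  - intros t t' s b x Ht Ht' Hx. unfold branches, ext. set (c := clamp (lo b) (hi b) x).
    specialize (Hcx b x Hx). fold c in Hcx.
    assert (L : forall a, (a < k)%nat -> Rabs (Dhalf b a (F t) c - Dhalf b a (F t') c) <= CA * Rabs (t - t')).
    { intros a0 Ha0.
      apply (mvt_inD d (fun u => jet DF b a0 0 u c) (fun u => jet DF b a0 1 u c)); try (now apply inD_Rabs).
      - intros u Hu. apply (jet_deriv_t d k); auto; try lia. apply clamp_half.
      - intros u Hu. apply HB; auto; try lia. apply clamp_half. }
    pose proof (L 0%nat ltac:(lia)) as L0. pose proof (L 1%nat ltac:(lia)) as L1.
    change (Dhalf b 0 (F t) c) with (F t c) in L0. change (Dhalf b 0 (F t') c) with (F t' c) in L0.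
    replace (F t c + Dhalf b 1 (F t) c * (x - c) + s * (w c + Dhalf b 1 w c * (x - c)) -
       (F t' c + Dhalf b 1 (F t') c * (x - c) + s * (w c + Dhalf b 1 w c * (x - c)))) with
       ((F t c - F t' c) + (Dhalf b 1 (F t) c - Dhalf b 1 (F t') c) * (x - c)) by ring.
    eapply Rle_trans; [apply Rabs_triang|]. rewrite Rabs_mult.
    assert (A : Rabs (Dhalf b 1 (F t) c - Dhalf b 1 (F t') c) * Rabs (x - c) <= CA * Rabs (t - t') * (orbit_bound lam + 1)).
    { apply Rmult_le_compat; try apply Rabs_pos; auto. }
    assert (0 <= Nw * (orbit_bound lam + 2) * Rabs (t - t')).
    { apply Rmult_le_pos; [apply Rmult_le_pos; lra|apply Rabs_pos]. }
    unfold C. lra.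
  - intros b x eps Hep. unfold branches_deriv, Dext.
    assert (I0d : inD d 0) by (unfold inD; lra).
    destruct (fj_ct HJ b 1%nat 0%nat 0 ltac:(lia) ltac:(lia) I0d (eps / 4)) as [e1 [E1 Q1]]; [lra|].
    destruct (fj_cx HJ b 1%nat 0%nat 0 (clamp (lo b) (hi b) x) ltac:(lia) ltac:(lia) I0d (clamp_half b x) (eps / 4)) as [e2 [E2 Q2]]; [lra|].
    assert (E4 : 0 < eps / 4 / (Nw + 1)) by (apply Rdiv_lt_0_compat; lra).
    exists (Rmin e1 (Rmin e2 (eps / 4 / (Nw + 1)))). split; [repeat apply Rmin_pos; auto|].
    pose proof (Rmin_l e1 (Rmin e2 (eps / 4 / (Nw + 1)))). pose proof (Rmin_r e1 (Rmin e2 (eps / 4 / (Nw + 1)))).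
    pose proof (Rmin_l e2 (eps / 4 / (Nw + 1))). pose proof (Rmin_r e2 (eps / 4 / (Nw + 1))).
    intros t s y Ht Hs Ht2 Hs2 Hy.
    set (cy := clamp (lo b) (hi b) y) in *. set (cx := clamp (lo b) (hi b) x) in *.
    assert (Lc : Rabs (cy - cx) < e2) by (eapply Rle_lt_trans; [apply clamp_lip|lra]).
    specialize (Q1 t ltac:(now apply inD_Rabs) ltac:(rewrite Rminus_0_r; lra) cy (clamp_half b y)).
    specialize (Q2 cy (clamp_half b y) Lc). unfold jet in Q1, Q2. change (DF 0%nat) with F in *.
    pose proof (HNw b 1%nat cy ltac:(lia) (clamp_half b y)) as A1.
    assert (A2 : Rabs (s * Dhalf b 1 w cy) <= eps / 4).
    { rewrite Rabs_mult. apply Rle_trans with (eps / 4 / (Nw + 1) * (Nw + 1)); [|right; field; lra].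
      apply Rmult_le_compat; try apply Rabs_pos; lra. }
    replace (Dhalf b 1 (F t) cy + s * Dhalf b 1 w cy - (Dhalf b 1 (F 0) cx + 0 * Dhalf b 1 w cx)) with
     ((Dhalf b 1 (F t) cy - Dhalf b 1 (F 0) cy) + ((Dhalf b 1 (F 0) cy - Dhalf b 1 (F 0) cx) + s * Dhalf b 1 w cy)) by ring.
    eapply Rle_lt_trans; [apply Rabs_triang|].
    pose proof (Rabs_triang (Dhalf b 1 (F 0) cy - Dhalf b 1 (F 0) cx) (s * Dhalf b 1 w cy)). lra.
  - intros b x. apply (ex_derive_continuous (ext b w)). eexists. apply ext_derive; auto.
Qed.

Lemma setup_unimodal k e lam C d F DF w t s : setup k e lam C d F DF w -> Rabs t < d -> Rabs s < d ->
  F t 0 + s * w 0 <= 1 -> unimodal k (fun x => F t x + s * w x).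
Proof.
  intros HS Ht Hs Htop.
  assert (HtE : inD e t) by (apply inD_Rabs; pose proof (su_de HS); lra).
  destruct (su_U HS t HtE) as (HB & Fl & Fr & _).
  pose proof (su_w HS) as Hw. pose proof (su_k HS) as Hk.
  assert (Hlam : 1 < lam).
  { pose proof (su_d HS). apply (@ep_lam lam (branches F w t s)).
    apply (pf_ep (su_pf HS)); auto. }
  assert (E : forall b x, half b x -> Dhalf b 1 (fun x => F t x + s * w x) x = Dhalf b 1 (F t) x + s * Dhalf b 1 w x).
  { intros b x Hx. destruct (Ck_half_lin k b (F t) w 1 s) as [Q1 Q2]; try now apply in_Bk_half.
    assert (Q5 : forall x, half b x -> 1 * F t x + s * w x = F t x + s * w x) by (intros; ring).
    rewrite (proj2 (Ck_half_ext k b _ (fun x => F t x + s * w x) Q5 Q1)) by (auto; lia).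
    rewrite Q2 by (auto; lia). ring. }
  split.
  { apply (in_Bk_ext k (fun x => 1 * F t x + s * w x)); [intros x _; ring|]. now apply in_Bk_lin. }
  split; [rewrite Fl, (su_wl HS); ring|].
  split; [rewrite Fr, (su_wr HS); ring|].
  split; [|split; [|exact Htop]].
  - exists lam. split; [exact Hlam|]. intros x Hx.
    change (lam <= Dhalf true 1 (fun x => F t x + s * w x) x). rewrite E by exact Hx.
    pose proof (su_slope HS t s true x Ht Hs Hx) as Q. simpl sg in Q. lra.
  - exists (- lam). split; [lra|]. intros x Hx.
    change (Dhalf false 1 (fun x => F t x + s * w x) x <= - lam). rewrite E by exact Hx.
    pose proof (su_slope HS t s false x Ht Hs Hx) as Q. simpl sg in Q. lra.
Qed.

(** * Collisions, and the sensitivity J *)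

(** A point below -1 is pushed away from the fixed point -1 by the left branch, so its overshoot
    would grow without bound; a point above 1 on the right side is sent below -1 in one step. *)
Lemma closed_orbit_inI lam G e X : expanding_pair lam G -> is_orbit lam G e X ->
  (forall i, closed_side (e i) (X i)) -> forall i, inI (X i).
Proof.
  intros HG [XB XE] Hc. pose proof (ep_lam HG) as Hl. pose proof (inv_lam lam Hl) as Hi.
  set (Z := fun i => if Rlt_dec (X i) (-1) then -1 - X i else 0).
  assert (E : forall i, Rabs (Z i) <= 0 / (1 - / lam)).
  { apply (backward_bound S Z (/ lam) 0 (orbit_bound lam + 1)); try lra.
    - intros i. unfold Z. destruct (Rlt_dec (X i) (-1)).
      + specialize (XB i). pose proof (Rle_abs (- X i)). rewrite Rabs_Ropp in H. apply Rabs_le. lra.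
      + rewrite Rabs_R0. pose proof (orbit_bound_gt_1 lam Hl). lra.
    - intros i. rewrite Rplus_0_r. unfold Z at 1. destruct (Rlt_dec (X i) (-1)) as [Hx|].
      2:{ rewrite Rabs_R0. apply Rmult_le_pos; [lra|apply Rabs_pos]. }
      apply abs_le_inv; [exact Hl|]. specialize (Hc i). specialize (XE i).
      destruct (e i); simpl in Hc; [|lra].
      pose proof (ep_exp HG true (X i) (-1) ltac:(lra)) as Q. rewrite (ep_l HG), XE in Q. simpl sg in Q.
      assert (0 < lam * (-1 - X i)) by (apply Rmult_lt_0_compat; lra).
      unfold Z. destruct (Rlt_dec (X (S i)) (-1)); [|lra].
      rewrite !Rabs_pos_eq by lra. lra. }
  assert (L : forall i, -1 <= X i).
  { intros i. specialize (E i). unfold Z in E. destruct (Rlt_dec (X i) (-1)); [|lra].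
    unfold Rdiv in E. rewrite Rmult_0_l, Rabs_pos_eq in E by lra. lra. }
  intros i. split; [apply L|]. destruct (Rle_dec (X i) 1) as [|Hn]; [assumption|]. exfalso.
  specialize (Hc i). pose proof (XE i) as Ei. destruct (e i); simpl in Hc; [lra|].
  pose proof (ep_exp HG false 1 (X i) ltac:(lra)) as Q. rewrite (ep_r HG), Ei in Q. simpl sg in Q.
  assert (0 < lam * (X i - 1)) by (apply Rmult_lt_0_compat; lra).
  specialize (L (S i)). lra.
Qed.

Lemma closed_orbit_iter lam G e X : expanding_pair lam G -> is_orbit lam G e X -> X 0%nat = 0 ->
  (forall i, closed_side (e i) (X i)) -> forall i, X i = iter i (glue G) 0.
Proof.
  intros HG [XB XE] H0 Hc. induction i; simpl; [exact H0|].
  rewrite <- IHi, (glue_closed lam G (e i) _ HG (Hc i)). auto.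
Qed.

Lemma glue_orbit lam G : expanding_pair lam G -> G true 0 <= 1 ->
  is_orbit lam G (fun i => side (iter i (glue G) 0)) (fun i => iter i (glue G) 0).
Proof.
  intros HG H1. split; [|reflexivity]. intros i. destruct (iter_inI lam G i HG H1).
  pose proof (orbit_bound_gt_1 lam (ep_lam HG)). apply Rabs_le. lra.
Qed.

(** From |y_(m+1)| >= mu |y_m| - |y_1| with mu > 2 follows |y_(m+1)| >= |y_1| (1 + m (mu - 2)); this
    linear growth already contradicts boundedness. *)
Lemma growth_unbounded (y : nat -> R) mu B : 2 < mu -> y 0%nat = 0 ->
  (forall m, mu * Rabs (y m) <= Rabs (y (S m) - y 1%nat)) -> (forall m, Rabs (y m) <= B) -> y 1%nat = 0.
Proof.
  intros Hmu H0 Hg HB. destruct (Req_dec (y 1%nat) 0) as [|Hn]; [assumption|]. exfalso.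
  set (a := Rabs (y 1%nat)). assert (Ha : 0 < a) by (now apply Rabs_pos_lt).
  assert (G : forall m, a * (1 + INR m * (mu - 2)) <= Rabs (y (S m))).
  { induction m.
    - simpl. unfold a. lra.
    - specialize (Hg (S m)).
      pose proof (Rabs_triang (y (S (S m))) (- y 1%nat)) as T. rewrite Rabs_Ropp in T. fold a in T.
      unfold Rminus in Hg at 1. rewrite S_INR.
      assert (A1 : mu * (a * (1 + INR m * (mu - 2))) <= mu * Rabs (y (S m))) by (apply Rmult_le_compat_l; lra).
      assert (0 <= INR m * (mu - 2)) by (apply Rmult_le_pos; [apply pos_INR|lra]).
      assert (A2 : 0 <= a * ((mu - 1) * (INR m * (mu - 2)))) by (apply Rmult_le_pos; [lra|apply Rmult_le_pos; lra]).
      replace (mu * (a * (1 + INR m * (mu - 2)))) with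
         (a * (1 + (INR m + 1) * (mu - 2)) + a + a * ((mu - 1) * (INR m * (mu - 2)))) in A1 by ring.
      lra. }
  destruct (INR_unbounded (B / (a * (mu - 2)))) as [m Hm].
  specialize (G m). specialize (HB (S m)).
  assert (P : 0 < a * (mu - 2)) by (apply Rmult_lt_0_compat; lra).
  apply (Rmult_lt_compat_r (a * (mu - 2))) in Hm; [|exact P].
  unfold Rdiv in Hm. rewrite Rmult_assoc, Rinv_l, Rmult_1_r in Hm by lra.
  replace (INR m * (a * (mu - 2))) with (a * (1 + INR m * (mu - 2)) - a) in Hm by ring. lra.
Qed.

(* If x returned to the critical point at time i with lam^i > 2, the return map of c would expand by more than 2 on a bounded orbit. *)
Lemma collision lam G0 G (i : nat) : expanding_pair lam G0 -> expanding_pair lam G -> G0 true 0 <= 1 ->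
  let c := fun j => iter j (glue G0) 0 in let x := fun j => iter j (glue G) 0 in
  (forall j, closed_side (side (c j)) (x j)) ->
  (1 <= i)%nat -> x i = 0 -> (forall j, (1 <= j)%nat -> (j < i)%nat -> x j <> 0) ->
  2 < lam ^ i -> c i = 0.
Proof.
  intros H0 HG T0 c x Hc Hi Hxi Hx Hmu.
  pose proof (ep_lam H0) as Hl.
  assert (cI : forall j, inI (c j)) by (intros; now apply (iter_inI lam)).
  assert (xper : forall j, x (j + i)%nat = x j).
  { intros j. unfold x. rewrite iter_add. fold (x i). rewrite Hxi. reflexivity. }
  assert (xperm : forall m j, x (j + m * i)%nat = x j).
  { induction m; intros j; simpl; [f_equal; lia|].
    replace (j + (i + m * i))%nat with ((j + m * i) + i)%nat by lia. rewrite xper. apply IHm. }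
  (* Between returns [x j] is not 0, so its closed side determines the symbol; the periodicity of
     [x] is thereby transferred to the symbols of [c], except at multiples of [i]. *)
  assert (Sd : forall m j, (1 <= j)%nat -> (j < i)%nat -> side (c (j + m * i)%nat) = side (c j)).
  { intros m j H1 H2. specialize (Hx j H1 H2). pose proof (Hc (j + m * i)%nat) as A1. rewrite xperm in A1.
    pose proof (Hc j) as A2. destruct (side (c (j + m * i)%nat)), (side (c j)); simpl in *; auto; lra. }
  (* The orbits of c_(m i) and of 0 use the same branches for [i] steps: in the first step because 0
     lies on both sides, afterwards by [Sd]. *)
  assert (St : forall m j, (1 <= j)%nat -> (j <= i)%nat -> lam ^ j * Rabs (c (m * i)%nat) <= Rabs (c (j + m * i)%nat - c j)).
  { intros m j H1. induction j; [lia|]. intros H2.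
    destruct (Nat.eq_dec j 0) as [->|Hj].
    - rewrite pow_1. change (c (1 + m * i)%nat) with (glue G0 (c (m * i)%nat)).
      change (c 1%nat) with (glue G0 0).
      rewrite (glue_closed lam G0 (side (c (m * i)%nat)) 0 H0) by apply closed_zero.
      rewrite <- (Rminus_0_r (c (m * i)%nat)) at 1. apply (ep_exp_abs lam G0); exact H0.
    - specialize (IHj ltac:(lia) ltac:(lia)).
      change (c (S j + m * i)%nat) with (glue G0 (c (j + m * i)%nat)).
      change (c (S j)) with (glue G0 (c j)). unfold glue at 1. rewrite (Sd m j) by lia.
      unfold glue. eapply Rle_trans; [|apply (ep_exp_abs lam G0); exact H0].
      simpl. rewrite Rmult_assoc. apply Rmult_le_compat_l; [lra|exact IHj]. }
  pose proof (growth_unbounded (fun m => c (m * i)%nat) (lam ^ i) 1 Hmu eq_refl) as Q.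
  simpl in Q. rewrite Nat.add_0_r in Q. apply Q.
  - intros m. apply (St m i); lia.
  - intros m. destruct (cI (m * i)%nat). apply Rabs_le. lra.
Qed.

(** One continuous function that is positive exactly when the first [n] are, so a single
    intermediate value argument treats them together; the value 1 for [n = 0] is any positive
    number. *)
Fixpoint min_upto (n : nat) (y : nat -> R -> R) (t : R) : R :=
  match n with O => 1 | S n' => Rmin (min_upto n' y t) (y n' t) end.

Lemma min_upto_pos n y t : 0 < min_upto n y t <-> forall i, (i < n)%nat -> 0 < y i t.
Proof.
  induction n; simpl.
  - split; [intros; lia|lra].
  - split.
    + intros H i Hi. pose proof (Rmin_l (min_upto n y t) (y n t)). pose proof (Rmin_r (min_upto n y t) (y n t)).
      destruct (Nat.eq_dec i n) as [->|]; [lra|]. apply IHn; [lra|lia].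
    + intros H. apply Rmin_pos; [apply IHn; auto|auto].
Qed.

Lemma min_upto_nonneg n y t : 0 <= min_upto n y t -> forall i, (i < n)%nat -> 0 <= y i t.
Proof.
  induction n; simpl; [intros; lia|]. intros H i Hi.
  pose proof (Rmin_l (min_upto n y t) (y n t)). pose proof (Rmin_r (min_upto n y t) (y n t)).
  destruct (Nat.eq_dec i n) as [->|]; [lra|]. apply IHn; [lra|lia].
Qed.

Lemma min_upto_cont d n y t : (forall i, (i < n)%nat -> cont_within (inD d) (y i) t) ->
  cont_within (inD d) (min_upto n y) t.
Proof.
  induction n; intros H eps He; simpl.
  - exists 1. split; [lra|]. intros. rewrite Rminus_diag, Rabs_R0. exact He.
  - destruct (IHn ltac:(auto) eps He) as [d1 [D1 K1]].
    destruct (H n ltac:(lia) eps He) as [d2 [D2 K2]].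
    exists (Rmin d1 d2). split; [now apply Rmin_pos|]. intros s Hs Hd.
    pose proof (Rmin_l d1 d2). pose proof (Rmin_r d1 d2).
    specialize (K1 s Hs ltac:(lra)). specialize (K2 s Hs ltac:(lra)).
    apply Rabs_def2 in K1. apply Rabs_def2 in K2. apply Rabs_def1;
    unfold Rmin; repeat destruct (Rle_dec _ _); lra.
Qed.

(** If the minimum ceased to be positive it would vanish somewhere; all functions are nonnegative
    there, hence positive by hypothesis, a contradiction. *)
Lemma signs_persist d n (y : nat -> R -> R) :
  (forall i t, (i < n)%nat -> inD d t -> cont_within (inD d) (y i) t) ->
  (forall i, (i < n)%nat -> 0 < y i 0) ->
  (forall t, inD d t -> (forall i, (i < n)%nat -> 0 <= y i t) -> forall i, (i < n)%nat -> 0 < y i t) ->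
  forall t, inD d t -> forall i, (i < n)%nat -> 0 < y i t.
Proof.
  intros Hc H0 Hs t Ht. apply min_upto_pos.
  destruct (Rlt_dec 0 (min_upto n y t)) as [|Hn]; [assumption|]. exfalso.
  assert (P0 : 0 < min_upto n y 0) by (apply min_upto_pos; auto).
  assert (E : exists u, inD d u /\ min_upto n y u = 0).
  { destruct (Rle_dec 0 t).
    - destruct (ivt_within (min_upto n y) 0 t 0) as [u [Hu Eu]]; [lra| |right; lra|].
      + intros u Hu. apply (cont_within_sub (inD d)); [unfold inD, inCC in *; intros; lra|].
        apply min_upto_cont. intros; apply Hc; auto. unfold inD, inCC in *; lra.
      + exists u. split; [unfold inD, inCC in *; lra|exact Eu].
    - destruct (ivt_within (min_upto n y) t 0 0) as [u [Hu Eu]]; [lra| |left; lra|].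
      + intros u Hu. apply (cont_within_sub (inD d)); [unfold inD, inCC in *; intros; lra|].
        apply min_upto_cont. intros; apply Hc; auto. unfold inD, inCC in *; lra.
      + exists u. split; [unfold inD, inCC in *; lra|exact Eu]. }
  destruct E as [u [Hu Eu]].
  assert (Q : 0 < min_upto n y u).
  { apply min_upto_pos. apply Hs; auto. apply min_upto_nonneg. lra. }
  lra.
Qed.

Lemma sum_n_S (a : nat -> R) n : @eq R (sum_n a (S n)) (sum_n a n + a (S n)).
Proof. apply (sum_Sn (G:=R_AbelianMonoid)). Qed.

(* [- Df(c) Z 0] is the infinite sensitivity series; when c is periodic this is the finite sum J times a nonzero geometric factor. *)
Lemma J_lin_sol (lam : R) (f u : R -> R) (Z : nat -> R) (B : R) : 1 < lam ->
  (forall i, lam <= Rabs (Dpt f (iter i f 0))) ->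
  (forall i, Rabs (Z i) <= B) ->
  lin_sol (fun i => / Dpt f (iter i f 0)) (fun i => u (iter i f 0)) Z ->
  (Z 0%nat = 0 <-> J f u = 0).
Proof.
  intros Hl HD HB HZ.
  set (c := fun i => iter i f 0) in *. set (D := fun i => Dpt f (c i)).
  assert (Dn : forall i, D i <> 0).
  { intros i E. specialize (HD i). fold (c i) in HD. fold (D i) in HD. rewrite E, Rabs_R0 in HD. lra. }
  assert (DS : forall n, Diter (S n) f (f 0) = Diter n f (f 0) * D (S n)).
  { intros n. simpl. unfold D, c. rewrite <- iter_shift. reflexivity. }
  assert (DB : forall n, lam ^ n <= Rabs (Diter n f (f 0))).
  { induction n; [simpl; rewrite Rabs_R1; lra|]. rewrite DS, Rabs_mult. simpl. rewrite Rmult_comm.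
    apply Rmult_le_compat; [apply pow_le; lra|lra|exact IHn|apply HD]. }
  assert (Dn' : forall n, Diter n f (f 0) <> 0).
  { intros n E. specialize (DB n). rewrite E, Rabs_R0 in DB.
    assert (0 < lam ^ n) by (apply pow_lt; lra). lra. }
  (* The recursion makes the partial sums telescope, leaving a remainder that tends to 0 in the
     aperiodic case and can be evaluated in the periodic one. *)
  assert (Sum : forall n, @eq R (sum_n (Jterm f u) n) (- D 0%nat * Z 0%nat + Z (S n) / Diter n f (f 0))).
  { induction n.
    - rewrite sum_O. unfold Jterm. change (iter 0 f 0) with (c 0%nat). simpl Diter.
      pose proof (HZ 0%nat) as E. simpl in E. change (Dpt f 0) with (D 0%nat) in E. change (u 0) with (u (c 0%nat)) in E.
      rewrite E. field. apply Dn.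
    - rewrite sum_n_S, IHn. unfold Jterm. fold (c (S n)). rewrite DS.
      pose proof (HZ (S n)) as E. simpl in E. fold (c n) in E. change (f (c n)) with (c (S n)) in E.
      fold (D (S n)) in E. rewrite E. field. split; [apply Dn|apply Dn']. }
  unfold J. destruct (excluded_middle_informative (crit_periodic f)) as [[p0 Hp0]|Hnp].
  - set (p := epsilon (inhabits 0%nat) (fun p => prime_period f p)).
    assert (Hp : prime_period f p).
    { apply (epsilon_spec (inhabits 0%nat) (fun p => prime_period f p)). now exists p0. }
    destruct Hp as [Hp1 [Hp2 _]].
    assert (cper : forall i, c (i + p)%nat = c i).
    { intros i. unfold c. rewrite iter_add, Hp2. reflexivity. }
    (* The shifted sequence solves the same recursion, since the orbit has period [p], and bounded
       solutions are unique. *)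
    assert (Zp : Z p = Z 0%nat).
    { assert (E : forall i, Z (i + p)%nat = Z i); [|apply (E 0%nat)].
      apply (aff_sol_unique (fun i => / D i) (fun i => - (/ D i * u (c i))) (fun i => Z (i + p)%nat) Z (/ lam) B B).
      - pose proof (inv_lam lam Hl); lra.
      - intros i. apply inv_small; [exact Hl|apply HD].
      - intros i. pose proof (HZ (i + p)%nat) as E.
        change (Z (i + p)%nat = / Dpt f (c (i + p)%nat) * (Z (S (i + p)) - u (c (i + p)%nat))) in E.
        rewrite cper in E. rewrite E. unfold D. simpl. ring.
      - intros; apply HB.
      - intros i. rewrite (HZ i) at 1. unfold D, c. simpl. ring.
      - exact HB. }
    rewrite Sum. replace (S (p - 1)) with p by lia. rewrite Zp.
    set (Q := Diter (p - 1) f (f 0)).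
    replace (- D 0%nat * Z 0%nat + Z 0%nat / Q) with (Z 0%nat * (/ Q - D 0%nat)) by (field; apply Dn').
    (* The modulus of [/ Q] is at most 1, whereas that of [D 0] is at least [lam]. *)
    assert (N : / Q - D 0%nat <> 0).
    { intros E. assert (Rabs (D 0%nat) = Rabs (/ Q)) by (f_equal; lra).
      assert (lam <= Rabs (D 0%nat)) by apply HD.
      assert (1 <= Rabs Q).
      { eapply Rle_trans; [|apply DB]. apply pow_R1_Rle. lra. }
      rewrite Rabs_inv in H.
      assert (/ Rabs Q <= 1) by (rewrite <- Rinv_1; apply Rinv_le_contravar; lra). lra. }
    split; [intros ->; ring|]. intros E. apply Rmult_integral in E. tauto.
  - assert (L : is_lim_seq (sum_n (Jterm f u)) (- D 0%nat * Z 0%nat)).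
    { apply (is_lim_seq_ext (fun n => - D 0%nat * Z 0%nat + Z (S n) / Diter n f (f 0))); [intros; now rewrite Sum|].
      replace (Finite (- D 0%nat * Z 0%nat)) with (Finite (- D 0%nat * Z 0%nat + 0)) by (f_equal; ring).
      apply (is_lim_seq_plus' (fun _ => - D 0%nat * Z 0%nat)); [apply is_lim_seq_const|].
      apply is_lim_seq_spec. intros eps.
      destruct (pow_small (/ lam) B eps) as [M HM]; [pose proof (inv_lam lam Hl); lra|apply cond_pos|].
      exists M. intros n Hn. rewrite Rminus_0_r. unfold Rdiv. rewrite Rabs_mult, Rabs_inv.
      eapply Rle_lt_trans; [|apply (HM n Hn)]. rewrite Rmult_comm.
      assert (0 < lam ^ n) by (apply pow_lt; lra).
      apply Rmult_le_compat; [left; apply Rinv_0_lt_compat; eapply Rlt_le_trans; [exact H|apply DB]|apply Rabs_pos| |apply HB].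
      rewrite pow_inv. apply Rinv_le_contravar; [exact H|apply DB]. }
    assert (E : Series (Jterm f u) = - D 0%nat * Z 0%nat).
    { apply is_series_unique. exact L. }
    rewrite E. split; [intros ->; ring|]. intros H. apply Rmult_integral in H. destruct H as [H|H]; [|exact H].
    exfalso. apply (Dn 0%nat). lra.
Qed.

(** * Families f_t + b(t) w with b of class C^k *)

Lemma field_jet_mono d d' k A : d' <= d -> field_jet d k A -> field_jet d' k A.
Proof.
  intros Hd HA. assert (Sub : forall t, inD d' t -> inD d t) by (intros t; now apply inD_le).
  split.
  - intros b a l t0 Ha Hl H0 eps He. destruct (fj_t HA b a l t0 Ha Hl (Sub _ H0) eps He) as [d1 [D1 K1]].
    exists d1. split; auto.
  - intros. apply (fj_x HA); auto.
  - destruct (fj_B HA) as [C HC]. exists C. auto.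
  - intros b a l t0 Ha Hl H0 eps He. destruct (fj_ct HA b a l t0 Ha Hl (Sub _ H0) eps He) as [d1 [D1 K1]].
    exists d1. split; auto.
  - intros. apply (fj_cx HA); auto.
Qed.

Lemma unif_Ck_derivs d n (beta : R -> R) : unif_Ck d n (fun _ => beta) ->
  exists Db : nat -> R -> R, Db 0%nat = beta /\
    (forall i t, (i < n)%nat -> inD d t -> is_derive (Db i) t (Db (S i) t)) /\
    (forall i t, (i <= n)%nat -> inD d t -> continuous (Db i) t) /\
    exists M, forall i t, (i <= n)%nat -> inD d t -> Rabs (Db i t) <= M.
Proof.
  revert beta. induction n; intros beta H.
  - exists (fun _ => beta). split; [reflexivity|]. split; [intros; lia|]. split.
    + intros i t _ Ht. apply (unif_Ck_cont d 0 (fun _ => beta) 0%nat t H Ht).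
    + destruct (unif_Ck_bounded _ _ _ H) as [M HM]. exists M. intros i t _ Ht. apply (HM 0%nat t Ht).
  - pose proof H as (_ & Hc & Y' & HY & UY).
    destruct (unif_Ck_bounded _ _ _ H) as [M HM].
    destruct (IHn (Y' 0%nat)) as (Db & E0 & H1 & H2 & M' & HM').
    { apply (unif_Ck_reindex d n Y' (fun _ => 0%nat) UY). }
    exists (fun l => match l with O => beta | S l' => Db l' end).
    split; [reflexivity|]. split; [|split].
    + intros [|i] t Hi Ht; [rewrite E0; apply (HY 0%nat t Ht)|]. apply H1; auto; lia.
    + intros [|i] t Hi Ht; [apply (Hc 0%nat t Ht)|]. apply H2; auto; lia.
    + exists (Rmax M M'). intros [|i] t Hi Ht.
      * eapply Rle_trans; [apply (HM 0%nat t Ht)|apply Rmax_l].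
      * eapply Rle_trans; [apply HM'; auto; lia|apply Rmax_r].
Qed.

Section Families.
Variables (k : nat) (e lam C d : R) (F : R -> R -> R) (DF : nat -> R -> R -> R) (w : R -> R).
Hypothesis HS : setup k e lam C d F DF w.
Variables (del : R) (beta : R -> R).
Hypothesis Hdel : 0 < del.
Hypothesis Hdeld : del <= d.

Let Sub : forall t, inD del t -> inD e t.
Proof. intros t. apply inD_le. pose proof (su_de HS). lra. Qed.

Lemma perturbed_deriv (P : R -> R -> R) (L : R -> R) (b : R -> R) (l t0 : R) :
  (forall t, inD e t -> in_Bk k (P t)) -> inD del t0 ->
  Bk_deriv k e P t0 L -> is_derive b t0 l ->
  Bk_deriv k del (fun t x => P t x + b t * w x) t0 (fun x => L x + l * w x).
Proof.
  intros HP H0 [HL H] Hb. pose proof (su_w HS) as Hw.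
  destruct (in_Bk_norm k w Hw) as [M [M0 HM]]. apply normk_le_iff in HM. destruct HM as [_ HM].
  split.
  - apply (in_Bk_ext k (fun x => 1 * L x + l * w x)); [intros x _; ring|]. now apply in_Bk_lin.
  - intros eps He. destruct (H (eps / 2)) as [d1 [D1 K1]]; [lra|].
    assert (E : 0 < eps / 2 / (M + 1)) by (apply Rdiv_lt_0_compat; lra).
    destruct (proj1 (is_derive_eps _ _ _) Hb _ E) as [d2 [D2 K2]].
    exists (Rmin d1 d2). split; [now apply Rmin_pos|]. intros t Ht Hd.
    pose proof (Rmin_l d1 d2). pose proof (Rmin_r d1 d2).
    specialize (K1 t (Sub t Ht) ltac:(lra)). specialize (K2 t ltac:(lra)).
    apply (normk_le_ext k (fun x => 1 * (P t x - P t0 x - (t - t0) * L x) + (b t - b t0 - l * (t - t0)) * w x));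
      [intros x _; ring|].
    apply normk_le_iff in K1. destruct K1 as [K3 K4].
    apply normk_lin; [exact K3|intros; now apply in_Bk_half|].
    intros c i x Hi Hx. specialize (K4 c i x Hi Hx). specialize (HM c i x Hi Hx).
    eapply Rle_trans; [apply Rabs_triang|]. rewrite Rmult_1_l, Rabs_mult.
    assert (A : Rabs (b t - b t0 - l * (t - t0)) * Rabs (Dhalf c i w x) <= eps / 2 / (M + 1) * Rabs (t - t0) * (M + 1)).
    { apply Rmult_le_compat; try apply Rabs_pos; lra. }
    replace (eps / 2 / (M + 1) * Rabs (t - t0) * (M + 1)) with (eps / 2 * Rabs (t - t0)) in A by (field; lra).
    lra.
Qed.

Lemma perturbed_cont (P : R -> R -> R) (b : R -> R) (t0 : R) :
  inD del t0 -> Bk_cont k e P t0 -> continuous b t0 ->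
  Bk_cont k del (fun t x => P t x + b t * w x) t0.
Proof.
  intros H0 H Hb eps He. pose proof (su_w HS) as Hw.
  destruct (in_Bk_norm k w Hw) as [M [M0 HM]]. apply normk_le_iff in HM. destruct HM as [_ HM].
  destruct (H (eps / 2)) as [d1 [D1 K1]]; [lra|].
  assert (E : 0 < eps / 2 / (M + 1)) by (apply Rdiv_lt_0_compat; lra).
  destruct (proj1 (continuous_eps _ _) Hb _ E) as [d2 [D2 K2]].
  exists (Rmin d1 d2). split; [now apply Rmin_pos|]. intros t Ht Hd.
  pose proof (Rmin_l d1 d2). pose proof (Rmin_r d1 d2).
  specialize (K1 t (Sub t Ht) ltac:(lra)). specialize (K2 t ltac:(lra)).
  apply (normk_le_ext k (fun x => 1 * (P t x - P t0 x) + (b t - b t0) * w x)); [intros x _; ring|].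
  apply normk_le_iff in K1. destruct K1 as [K3 K4].
  apply normk_lin; [exact K3|intros; now apply in_Bk_half|].
  intros c i x Hi Hx. specialize (K4 c i x Hi Hx). specialize (HM c i x Hi Hx).
  eapply Rle_trans; [apply Rabs_triang|]. rewrite Rmult_1_l, Rabs_mult.
  assert (A : Rabs (b t - b t0) * Rabs (Dhalf c i w x) <= eps / 2 / (M + 1) * (M + 1)).
  { apply Rmult_le_compat; try apply Rabs_pos; lra. }
  replace (eps / 2 / (M + 1) * (M + 1)) with (eps / 2) in A by (field; lra).
  lra.
Qed.

Hypothesis Hbd : forall t, inD del t -> Rabs (beta t) < d.
Hypothesis Htop : forall t, inD del t -> F t 0 + beta t * w 0 <= 1.
Hypothesis HbC : unif_Ck del k (fun _ => beta).

Lemma perturbed_unimodal t : inD del t -> unimodal k (fun x => F t x + beta t * w x).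
Proof.
  intros Ht. apply (setup_unimodal k e lam C d F DF w); [exact HS| |now apply Hbd|now apply Htop].
  apply (proj1 (inD_Rabs d t)). unfold inD in *; lra.
Qed.

Lemma perturbed_curve (Db : nat -> R -> R) (j : nat) : (j <= k)%nat -> Db 0%nat = beta ->
  (forall i t, (i < k)%nat -> inD del t -> is_derive (Db i) t (Db (S i) t)) ->
  (forall i t, (i <= k)%nat -> inD del t -> continuous (Db i) t) ->
  Cj_curve_with k j del (fun t x => F t x + beta t * w x) (fun l t x => DF l t x + Db l t * w x).
Proof.
  intros Hj E0 H1 H2. pose proof (su_curve HS) as HC.
  pose proof HC as (C1 & C2 & C3 & C4). pose proof (su_F HS) as EF.
  split; [|split; [|split]].
  - intros t x Ht Hx. rewrite E0, EF. reflexivity.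
  - intros i t Hi Ht. apply (in_Bk_ext k (fun x => 1 * DF i t x + Db i t * w x)); [intros x _; ring|].
    apply in_Bk_lin; [apply C2; auto; lia|apply (su_w HS)].
  - intros i t Hi Ht. apply (perturbed_deriv (DF i) (DF (S i) t) (Db i)); auto.
    + intros s Hs. apply C2; auto; lia.
    + apply C3; auto; lia.
    + apply H1; auto; lia.
  - intros t Ht. apply (perturbed_cont (DF j) (Db j)); auto.
    apply (curve_cont k e F); auto.
Qed.

Lemma perturbed_Ck_family : Ck_family k k del (fun t x => F t x + beta t * w x).
Proof.
  destruct (unif_Ck_derivs _ _ _ HbC) as (Db & E0 & H1 & H2 & _).
  split; [intros; now apply perturbed_unimodal|].
  exists (fun l t x => DF l t x + Db l t * w x). apply perturbed_curve; auto.
Qed.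

(** The k-th derivative is bounded on the interval, so the mean value theorem makes the (k-1)-th one
    Lipschitz. *)
Lemma perturbed_real_CLip : real_CLip k del beta.
Proof.
  destruct (unif_Ck_derivs _ _ _ HbC) as (Db & E0 & H1 & H2 & M & HM).
  pose proof (su_k HS) as Hk.
  exists Db. split; [rewrite E0; auto|]. split; [intros; apply H1; auto; lia|].
  exists M. intros s t Hs Ht. apply (mvt_inD del (Db (k - 1)%nat) (Db k)); auto.
  intros u Hu. replace k with (S (k - 1)) at 2 by lia. apply H1; auto; lia.
Qed.

Lemma perturbed_CLip_family : CLip_family k k del (fun t x => F t x + beta t * w x).
Proof.
  destruct (unif_Ck_derivs _ _ _ HbC) as (Db & E0 & H1 & H2 & M & HM).
  pose proof (su_k HS) as Hk. pose proof (su_w HS) as Hw.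
  pose proof (su_curve HS) as (C1 & C2 & C3 & C4).
  pose proof (field_jet_mono d del k _ Hdeld (su_jet HS)) as HJ.
  split; [intros; now apply perturbed_unimodal|].
  exists (fun l t x => DF l t x + Db l t * w x). split; [apply perturbed_curve; auto; lia|].
  destruct (fj_B HJ) as [CA HCA]. destruct (in_Bk_norm k w Hw) as [Nw [Nw0 HNw]].
  apply normk_le_iff in HNw. destruct HNw as [_ HNw].
  exists (CA + M * Nw). intros s t Hs Ht.
  apply (normk_le_ext k (fun x => 1 * (1 * DF (k - 1)%nat s x + -1 * DF (k - 1)%nat t x) + (Db (k - 1)%nat s - Db (k - 1)%nat t) * w x));
    [intros x _; ring|].
  assert (CB : forall u c, inD del u -> Ck_half k c (DF (k - 1)%nat u)).
  { intros. apply in_Bk_half, C2; auto; lia. }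
  apply normk_lin.
  - intros c. apply Ck_half_lin; auto.
  - intros; now apply in_Bk_half.
  - intros c i x Hi Hx. rewrite (proj2 (Ck_half_lin k c _ _ 1 (-1) (CB s c Hs) (CB t c Ht))) by auto.
    assert (A1 : Rabs (Dhalf c i (DF (k - 1)%nat s) x - Dhalf c i (DF (k - 1)%nat t) x) <= CA * Rabs (s - t)).
    { apply (mvt_inD del (fun u => jet DF c i (k - 1) u x) (fun u => jet DF c i k u x)); auto.
      intros u Hu.
      pose proof (jet_deriv_t del k (jet DF) c i (k - 1) x u HJ Hi ltac:(lia) Hu Hx) as Q.
      replace (S (k - 1)) with k in Q by lia. exact Q. }
    assert (A2 : Rabs (Db (k - 1)%nat s - Db (k - 1)%nat t) <= M * Rabs (s - t)).
    { apply (mvt_inD del (Db (k - 1)%nat) (Db k)); auto.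
      intros u Hu. replace k with (S (k - 1)) at 2 by lia. apply H1; auto; lia. }
    replace (1 * (1 * Dhalf c i (DF (k - 1)%nat s) x + -1 * Dhalf c i (DF (k - 1)%nat t) x) + (Db (k - 1)%nat s - Db (k - 1)%nat t) * Dhalf c i w x)
     with ((Dhalf c i (DF (k - 1)%nat s) x - Dhalf c i (DF (k - 1)%nat t) x) + (Db (k - 1)%nat s - Db (k - 1)%nat t) * Dhalf c i w x) by ring.
    eapply Rle_trans; [apply Rabs_triang|]. rewrite Rabs_mult, Rmult_plus_distr_r.
    apply Rplus_le_compat; [exact A1|].
    replace (M * Nw * Rabs (s - t)) with (M * Rabs (s - t) * Nw) by ring.
    apply Rmult_le_compat; try apply Rabs_pos; auto.
Qed.

End Families.

(** * The deformation *)

Lemma lip_cont d g L t : (forall s, inD d s -> Rabs (g s - g t) <= L * Rabs (s - t)) ->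
  inD d t -> continuous g t.
Proof.
  intros H Ht. apply (cont_within_inD d); auto. intros eps He.
  assert (HL : 0 < Rabs L + 1) by (pose proof (Rabs_pos L); lra).
  exists (eps / (Rabs L + 1)). split; [now apply Rdiv_lt_0_compat|]. intros y Hy Hd.
  eapply Rle_lt_trans; [apply H; exact Hy|].
  apply Rle_lt_trans with ((Rabs L + 1) * Rabs (y - t)).
  - apply Rmult_le_compat_r; [apply Rabs_pos|]. pose proof (Rle_abs L). lra.
  - apply Rlt_le_trans with ((Rabs L + 1) * (eps / (Rabs L + 1))); [|right; field; lra].
    apply Rmult_lt_compat_l; lra.
Qed.

Lemma top_conj_ext f f' g g' : (forall x, inI x -> f x = f' x) -> (forall x, inI x -> g x = g' x) ->
  top_conj f g -> top_conj f' g'.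
Proof.
  intros Ef Eg (fI & gI & h & k & hI & kI & hk & kh & hc & kc & E).
  split; [intros x Hx; rewrite <- Ef by exact Hx; auto|].
  split; [intros x Hx; rewrite <- Eg by exact Hx; auto|].
  exists h, k. repeat split; try (now apply hI); try (now apply kI); auto.
  intros x Hx. rewrite <- Ef, <- Eg by auto. auto.
Qed.

Lemma iter_ext_inI f g i : (forall x, inI x -> f x = g x) -> (forall j, inI (iter j f 0)) ->
  iter i f 0 = iter i g 0.
Proof.
  intros E HI. induction i; simpl; [reflexivity|]. rewrite E by apply HI. now rewrite IHi.
Qed.

Lemma Bk_deriv_pointwise k d F t0 L x : inD d t0 -> inI x -> Bk_deriv k d F t0 L ->
  is_derive (fun t => F t x) t0 (L x).
Proof.
  intros H0 Hx [_ H]. apply is_derive_eps. intros eps He.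
  destruct (H eps He) as [d1 [D1 K1]]. destruct (inD_open d t0 H0) as [d2 [D2 K2]].
  exists (Rmin d1 d2). split; [now apply Rmin_pos|]. intros t Ht.
  pose proof (Rmin_l d1 d2). pose proof (Rmin_r d1 d2).
  specialize (K1 t (K2 t ltac:(lra)) ltac:(lra)). apply normk_le_iff in K1. destruct K1 as [_ K1].
  specialize (K1 (side x) 0%nat x ltac:(lia) (half_of _ _ (side_closed x) Hx)).
  unfold Dhalf in K1. simpl in K1. rewrite (Rmult_comm (L x)). exact K1.
Qed.

Section Deformation.
Variables (k : nat) (e lam C d : R) (F : R -> R -> R) (DF : nat -> R -> R -> R) (w : R -> R).
Hypothesis HS : setup k e lam C d F DF w.
Let G := branches F w.
Let PF : parameter_family lam C d G (branches_deriv F w) (fun b => ext b w) := su_pf HS.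
Let c (i : nat) : R := iter i (glue (G 0 0)) 0.
Let e0 (i : nat) : bool := side (c i).
Hypothesis Htop0 : G 0 0 true 0 <= 1.
Variable Z0 : nat -> R.
Hypothesis HZ0 : lin_sol (inv_slopes (branches_deriv F w) e0 c) (forcing (fun b => ext b w) e0 c) Z0.
Hypothesis BZ0 : forall i, Rabs (Z0 i) <= / lam * C / (1 - / lam).
Hypothesis Hz : Z0 0%nat <> 0.
Let z := Rabs (Z0 0%nat).
Let X (e' : nat -> bool) (t s : R) : nat -> R := coded_orbit lam (G t s) e'.

Let dpos : 0 < d.
Proof. exact (su_d HS). Qed.

Let lam1 : 1 < lam.
Proof. exact (pf_lam _ _ _ _ _ _ PF). Qed.

Let th_b : 0 < / lam < 1.
Proof. exact (inv_lam lam lam1). Qed.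

Let zpos : 0 < z.
Proof. now apply Rabs_pos_lt. Qed.

Let C0 : 0 <= C.
Proof. exact (pf_C PF). Qed.

Let ep t s : Rabs t < d -> Rabs s < d -> expanding_pair lam (G t s).
Proof. exact (pf_ep PF t s). Qed.

Let ep00 : expanding_pair lam (G 0 0).
Proof. apply ep; rewrite Rabs_R0; exact dpos. Qed.

Let c_orbit : is_orbit lam (G 0 0) e0 c.
Proof. exact (glue_orbit lam (G 0 0) ep00 Htop0). Qed.

Definition agrees (N : nat) (e' : nat -> bool) : Prop := forall i, (i < N)%nat -> e' i = e0 i.

(** Here [dl] limits s and [del] limits t. The conditions hold at once for all codes that share
    their first [N] symbols with the critical itinerary: transversality with slope at least z / 2,
    and persistence of the signs of the nonzero c_i for i < [Q]. The last clause is the smallness of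
    t that the root argument needs. *)
Definition admissible_box (Q N : nat) (dl del : R) : Prop :=
  0 < del /\ del <= dl /\ dl <= d /\
  (forall e' t s, agrees N e' -> Rabs t < dl -> Rabs s < dl ->
     (forall s', Rabs s' < dl -> exists q, Rabs (q - Z0 0%nat) < z / 2 /\
        X e' t s 0%nat - X e' t s' 0%nat = (s - s') * q) /\
     (forall V B, (forall i, Rabs (V i) <= B) ->
        lin_sol (fun i => / branches_deriv F w t s (e' i) (X e' t s i)) (fun i => ext (e' i) w (X e' t s i)) V ->
        Rabs (V 0%nat - Z0 0%nat) < z / 2) /\
     (forall i, (1 <= i)%nat -> (i < Q)%nat -> c i <> 0 -> Rabs (X e' t s i - c i) < Rabs (c i))) /\
  (forall t, Rabs t < del -> C * Rabs t / (1 - / lam) < dl / 8 * z).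

Lemma admissible_box_exists Q : exists N dl del, admissible_box Q N dl del.
Proof.
  destruct (coded_orbit_transversal lam C d G (branches_deriv F w) (fun b => ext b w) PF e0 c c_orbit Z0 HZ0 BZ0 (z / 2)) as (N1 & d1 & D1 & D1d & H1); [lra|].
  assert (Heta : exists eta, 0 < eta /\ forall i eta', (i < Q)%nat -> 0 < eta' -> eta' <= eta -> c i <> 0 -> eta' <= Rabs (c i)).
  { apply (finite_uniform_radius (fun i eta' => c i <> 0 -> eta' <= Rabs (c i))). intros i.
    destruct (Req_dec (c i) 0) as [E|E].
    - exists 1. split; [lra|]. intros; tauto.
    - exists (Rabs (c i)). split; [now apply Rabs_pos_lt|]. auto. }
  destruct Heta as [eta [He Heta]].
  destruct (coded_orbit_close lam C d G (branches_deriv F w) (fun b => ext b w) PF e0 c c_orbit Q eta He) as (N2 & d2 & D2 & D2d & H2).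
  set (dl := Rmin d1 d2). assert (D : 0 < dl) by (now apply Rmin_pos).
  pose proof (Rmin_l d1 d2). pose proof (Rmin_r d1 d2). fold dl in H, H0.
  assert (Ez : 0 < dl / 8 * z * (1 - / lam) / (C + 1)).
  { apply Rdiv_lt_0_compat; [|lra]. repeat apply Rmult_lt_0_compat; lra. }
  exists (N1 + N2)%nat, dl, (Rmin dl (dl / 8 * z * (1 - / lam) / (C + 1))).
  split; [now apply Rmin_pos|]. split; [apply Rmin_l|]. split; [lra|]. split.
  - intros e' t s Ha Ht Hs.
    assert (A1 : forall i, (i < N1)%nat -> e' i = e0 i) by (intros; apply Ha; lia).
    assert (A2 : forall i, (i < N2)%nat -> e' i = e0 i) by (intros; apply Ha; lia).
    destruct (H1 e' t s A1 ltac:(lra) ltac:(lra)) as [P1 P2].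
    split; [intros s' Hs'; apply P1; lra|]. split; [exact P2|].
    intros i Hi1 HiQ Hc. eapply Rlt_le_trans; [apply (H2 e' t s A2); auto; lra|].
    apply (Heta i eta); auto; lra.
  - intros t Ht. pose proof (Rmin_r dl (dl / 8 * z * (1 - / lam) / (C + 1))).
    apply (Rmult_lt_reg_r (1 - / lam)); [lra|]. unfold Rdiv at 1. rewrite Rmult_assoc, Rinv_l, Rmult_1_r by lra.
    apply Rle_lt_trans with ((C + 1) * Rabs t); [apply Rmult_le_compat_r; [apply Rabs_pos|lra]|].
    apply Rlt_le_trans with ((C + 1) * (dl / 8 * z * (1 - / lam) / (C + 1))); [|right; field; lra].
    apply Rmult_lt_compat_l; lra.
Qed.

Section Box.
Variables (Q N : nat) (dl del : R).
Hypothesis HC : admissible_box Q N dl del.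

Let del_pos : 0 < del. Proof. apply HC. Qed.
Let del_dl : del <= dl. Proof. apply HC. Qed.
Let dl_d : dl <= d. Proof. apply HC. Qed.

Lemma slope_lower e' t s s' : agrees N e' -> Rabs t < dl -> Rabs s < dl -> Rabs s' < dl ->
  z / 2 * Rabs (s - s') <= Rabs (X e' t s 0%nat - X e' t s' 0%nat).
Proof.
  intros Ha Ht Hs Hs'. destruct HC as (_ & _ & _ & H & _).
  destruct (H e' t s Ha Ht Hs) as [H1 _]. destruct (H1 s' Hs') as [q [Hq E]].
  rewrite E, Rabs_mult, Rmult_comm. apply Rmult_le_compat_l; [apply Rabs_pos|].
  pose proof (Rabs_triang (Z0 0%nat - q) q) as T. replace (Z0 0%nat - q + q) with (Z0 0%nat) in T by ring.
  rewrite (Rabs_minus_sym (Z0 0%nat)) in T. fold z in T. lra.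
Qed.

Definition root (e' : nat -> bool) (t : R) : R :=
  epsilon (inhabits 0) (fun s => Rabs s < dl / 2 /\ X e' t s 0%nat = 0).

(** * The implicit function attached to one code *)

Section Root.
Variables (e' : nat -> bool) (s0 : R).
Hypothesis Hag : agrees N e'.
Hypothesis Hs0 : Rabs s0 < dl / 4.
Hypothesis HX0 : X e' 0 s0 0%nat = 0.

Lemma root_spec t : inD del t -> Rabs (root e' t) < dl / 2 /\ X e' t (root e' t) 0%nat = 0.
Proof.
  intros Ht. apply inD_Rabs in Ht.
  apply (epsilon_spec (inhabits 0) (fun s => Rabs s < dl / 2 /\ X e' t s 0%nat = 0)).
  pose proof HC as (_ & _ & _ & H & H').
  apply (coded_orbit_root lam C d G (branches_deriv F w) (fun b => ext b w) PF Z0 dl ltac:(lra) dl_d e' s0 t Hz); auto; try lra.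
  intros t' s Ht' Hs s' Hs'. apply (H e' t' s Hag Ht' Hs). exact Hs'.
Qed.

Let rdl t (Ht : inD del t) : Rabs (root e' t) < dl.
Proof. destruct (root_spec t Ht). lra. Qed.

Let rd t (Ht : inD del t) : Rabs (root e' t) < d.
Proof. specialize (rdl t Ht). lra. Qed.

Let td t (Ht : inD del t) : Rabs t < d.
Proof. apply inD_Rabs in Ht. lra. Qed.

Lemma root_unique t s : inD del t -> Rabs s < dl -> X e' t s 0%nat = 0 -> s = root e' t.
Proof.
  intros Ht Hs E. destruct (root_spec t Ht) as [_ E2].
  pose proof (proj1 (inD_Rabs _ _) Ht) as Ht'.
  pose proof (slope_lower e' t s (root e' t) Hag ltac:(lra) Hs (rdl t Ht)) as Q1.
  rewrite E, E2, Rminus_diag, Rabs_R0 in Q1.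
  destruct (Req_dec s (root e' t)) as [|Hn]; [assumption|].
  assert (0 < Rabs (s - root e' t)) by (apply Rabs_pos_lt; lra).
  assert (0 < z / 2 * Rabs (s - root e' t)) by (apply Rmult_lt_0_compat; lra). lra.
Qed.

Lemma root_0 : root e' 0 = s0.
Proof.
  symmetry. apply root_unique; auto; [unfold inD; lra|].
  pose proof (Rabs_pos s0). lra.
Qed.

Definition root_lip_const : R := C / (1 - / lam) / (z / 2).

(** The constant is the Lipschitz constant of X_0 in t divided by the lower bound z / 2 for its
    slope in s. *)
Lemma root_lip t t' : inD del t -> inD del t' -> Rabs (root e' t - root e' t') <= root_lip_const * Rabs (t - t').
Proof.
  intros Ht Ht'. destruct (root_spec t Ht) as [_ E1]. destruct (root_spec t' Ht') as [_ E2].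
  pose proof (proj1 (inD_Rabs _ _) Ht) as At.
  pose proof (slope_lower e' t (root e' t) (root e' t') Hag ltac:(lra) (rdl t Ht) (rdl t' Ht')) as Q1.
  rewrite E1, <- E2 in Q1.
  pose proof (coded_orbit_lip_t lam C d G (branches_deriv F w) (fun b => ext b w) PF e' t' t (root e' t') 0%nat (td _ Ht') (td _ Ht) (rd _ Ht')) as Q2.
  fold (X e' t' (root e' t')) in Q2. fold (X e' t (root e' t')) in Q2.
  rewrite (Rabs_minus_sym t') in Q2.
  apply (Rmult_le_reg_l (z / 2)); [lra|].
  eapply Rle_trans; [exact Q1|]. eapply Rle_trans; [exact Q2|]. right. unfold root_lip_const. field. lra.
Qed.

Lemma X_root_lip i t t' : inD del t -> inD del t' ->
  Rabs (X e' t (root e' t) i - X e' t' (root e' t') i) <= (C / (1 - / lam) * (1 + root_lip_const)) * Rabs (t - t').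
Proof.
  intros Ht Ht'.
  pose proof (coded_orbit_lip_t lam C d G (branches_deriv F w) (fun b => ext b w) PF e' t t' (root e' t) i (td _ Ht) (td _ Ht') (rd _ Ht)) as Q1.
  pose proof (coded_orbit_lip_s lam C d G (branches_deriv F w) (fun b => ext b w) PF e' t' (root e' t) (root e' t') i (td _ Ht') (rd _ Ht) (rd _ Ht')) as Q2.
  replace (X e' t (root e' t) i - X e' t' (root e' t') i) with
    ((X e' t (root e' t) i - X e' t' (root e' t) i) + (X e' t' (root e' t) i - X e' t' (root e' t') i)) by ring.
  eapply Rle_trans; [apply Rabs_triang|]. unfold X.
  pose proof (root_lip t t' Ht Ht') as Q3.
  assert (P : 0 <= C / (1 - / lam)).
  { apply Rmult_le_pos; [lra|]. left; apply Rinv_0_lt_compat; lra. }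
  apply (Rmult_le_compat_l _ _ _ P) in Q3.
  replace (C * Rabs (root e' t - root e' t') / (1 - / lam)) with (C / (1 - / lam) * Rabs (root e' t - root e' t')) in Q2 by (field; lra).
  replace (C * Rabs (t - t') / (1 - / lam)) with (C / (1 - / lam) * Rabs (t - t')) in Q1 by (field; lra).
  lra.
Qed.

Lemma root_cont t : inD del t -> continuous (root e') t.
Proof. intros Ht. apply (lip_cont del _ root_lip_const); auto. intros; now apply root_lip. Qed.

Lemma X_root_cont i t : inD del t -> continuous (fun t => X e' t (root e' t) i) t.
Proof.
  intros Ht. apply (lip_cont del _ (C / (1 - / lam) * (1 + root_lip_const))); auto. intros; now apply X_root_lip.
Qed.

Lemma root_orbit t : inD del t -> is_orbit lam (G t (root e' t)) e' (X e' t (root e' t)).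
Proof. intros Ht. apply coded_orbit_spec, ep; auto. Qed.

Hypothesis Hcl : forall t i, inD del t -> closed_side (e' i) (X e' t (root e' t) i).

Lemma cl_iter t i : inD del t -> X e' t (root e' t) i = iter i (glue (G t (root e' t))) 0.
Proof.
  intros Ht. apply (closed_orbit_iter lam (G t (root e' t)) e'); auto.
  - now apply root_orbit.
  - now apply root_spec.
Qed.

Lemma cl_inI t i : inD del t -> inI (X e' t (root e' t) i).
Proof. intros Ht. apply (closed_orbit_inI lam (G t (root e' t)) e'); auto. now apply root_orbit. Qed.

Lemma cl_top t : inD del t -> G t (root e' t) true 0 <= 1.
Proof.
  intros Ht. pose proof (cl_inI t 1 Ht) as [_ H]. rewrite cl_iter in H by auto. simpl in H.
  rewrite (glue_closed lam _ true 0) in H; auto. simpl; lra.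
Qed.

Let x (i : nat) (t : R) : R := X e' t (root e' t) i.

Let xK i t : inD del t -> half (e' i) (x i t).
Proof. intros Ht. apply half_of; [now apply Hcl|now apply cl_inI]. Qed.

Let xS i t : inD del t ->
  x (S i) t = jet DF (e' i) 0%nat 0%nat t (x i t) + root e' t * wjet w (e' i) 0%nat 0%nat t (x i t).
Proof.
  intros Ht. destruct (root_orbit t Ht) as [_ E]. unfold x. rewrite <- E. unfold G, branches.
  rewrite !ext_in by (now apply (xK i t)). unfold jet, wjet, Dhalf. simpl.
  rewrite (su_F HS). reflexivity.
Qed.

Let big b t y : inD del t -> half b y ->
  lam <= Rabs (jet DF b 1%nat 0%nat t y + root e' t * wjet w b 1%nat 0%nat t y).
Proof.
  intros Ht Hy. unfold jet, wjet. rewrite (su_F HS).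
  apply (sg_abs b); [lra|]. apply (su_slope HS); auto.
Qed.

Let slopeE b t y : half b y ->
  jet DF b 1%nat 0%nat t y + root e' t * wjet w b 1%nat 0%nat t y = branches_deriv F w t (root e' t) b y.
Proof.
  intros Hy. unfold jet, wjet, branches_deriv. rewrite !Dext_in by exact Hy. now rewrite (su_F HS).
Qed.

Let HV t V B : inD del t -> (forall i, Rabs (V i) <= B) ->
  aff_sol (fun i => / (jet DF (e' i) 1%nat 0%nat t (x i t) + root e' t * wjet w (e' i) 1%nat 0%nat t (x i t)))
    (fun i => - (/ (jet DF (e' i) 1%nat 0%nat t (x i t) + root e' t * wjet w (e' i) 1%nat 0%nat t (x i t)) *
       wjet w (e' i) 0%nat 0%nat t (x i t))) V -> z / 2 <= Rabs (V 0%nat).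
Proof.
  intros Ht HB HV. pose proof HC as (_ & _ & _ & H & _).
  pose proof (proj1 (inD_Rabs _ _) Ht) as At.
  destruct (H e' t (root e' t) Hag ltac:(lra) (rdl t Ht)) as (_ & H2 & _).
  assert (Q1 : Rabs (V 0%nat - Z0 0%nat) < z / 2).
  { apply (H2 V B HB). intros i. rewrite (HV i).
    rewrite slopeE by (now apply xK). fold (x i t). unfold wjet. rewrite ext_in by (now apply xK).
    change (Dhalf (e' i) 0 w (x i t)) with (w (x i t)). ring. }
  pose proof (Rabs_triang (Z0 0%nat - V 0%nat) (V 0%nat)) as T.
  replace (Z0 0%nat - V 0%nat + V 0%nat) with (Z0 0%nat) in T by ring.
  rewrite (Rabs_minus_sym (Z0 0%nat)) in T. fold z in T. lra.
Qed.

Let Jm : field_jet del k (jet DF).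
Proof. apply (field_jet_mono d); [lra|]. exact (su_jet HS). Qed.

Let k1 : (1 <= k)%nat.
Proof. pose proof (su_k HS). lia. Qed.

Lemma root_unif_Ck : unif_Ck del k (fun _ => root e').
Proof.
  apply (regularity del lam (z / 2) k (jet DF) (wjet w) e' (root e') x); auto; try lra.
  - apply wjet_field. exact (su_w HS).
  - intros t Ht. unfold x. now apply root_spec.
  - intros t Ht. now apply root_cont.
  - exists d. intros t Ht. left. auto.
  - intros i t Ht. now apply X_root_cont.
Qed.

(** Derivative at 0 is - U_0 / V_0, where [U] linearises the orbit in the direction of the
    t-derivative of the family; for that direction v, U_0 = 0 expresses J(f, v) = 0. *)
Lemma root_deriv_0 U BU :
  (forall i, Rabs (U i) <= BU) ->
  lin_sol (fun i => / branches_deriv F w 0 s0 (e' i) (X e' 0 s0 i)) (fun i => DF 1%nat 0 (X e' 0 s0 i)) U ->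
  U 0%nat = 0 -> is_derive (root e') 0 0.
Proof.
  intros HB HU U0. assert (I0 : inD del 0) by (unfold inD; lra).
  pose proof root_0 as R0.
  destruct (in_Bk_norm k w (su_w HS)) as [Nw [Nw0 HNw]]. apply normk_le_iff in HNw.
  destruct HNw as [_ HNw].
  set (r := fun i => / (jet DF (e' i) 1%nat 0%nat 0 (x i 0) + root e' 0 * wjet w (e' i) 1%nat 0%nat 0 (x i 0))).
  assert (rB : forall i, Rabs (r i) <= / lam) by (intros; apply inv_small; auto).
  destruct (aff_sol_exists r (fun i => - (r i * wjet w (e' i) 0%nat 0%nat 0 (x i 0))) (/ lam) Nw) as [V [HVs VB]]; auto; try lra.
  { intros i. rewrite Rabs_Ropp, Rabs_mult. rewrite <- (Rmult_1_l Nw).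
    apply Rmult_le_compat; try apply Rabs_pos; [specialize (rB i); lra|]. apply HNw; [lia|]. now apply xK. }
  pose proof (reg_derivative del lam (z / 2) k (jet DF) (wjet w) e' (root e') x lam1 ltac:(lra) k1 Jm
     (wjet_field _ _ _ (su_w HS)) ltac:(reflexivity)
     ltac:(intros; now apply root_spec) ltac:(intros; now apply xK) ltac:(intros; now apply xS)
     ltac:(intros; now apply root_cont) ltac:(intros; now apply X_root_cont) big HV
     0 U V BU (Nw / (1 - / lam)) I0) as D.
  destruct D as [D _]; [|exact HB|exact HVs|exact VB|].
  - intros i. rewrite (HU i). rewrite slopeE by (now apply xK). unfold x. rewrite R0.
    unfold jet, Dhalf. simpl. ring.
  - rewrite U0 in D. replace (- 0 * / V 0%nat) with 0 in D by ring. exact D.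
Qed.

End Root.

(** * Codes realised by the critical orbit of a map f_0 + s_0 w *)

Section Base.
Variables (e' : nat -> bool) (s0 : R).
Let c' (i : nat) : R := iter i (glue (G 0 s0)) 0.
Hypothesis Hag : agrees N e'.
Hypothesis Hs0 : Rabs s0 < dl / 4.
Hypothesis Htop : G 0 s0 true 0 <= 1.
Hypothesis He' : forall i, e' i = side (c' i).

Let ep0 : expanding_pair lam (G 0 s0).
Proof. apply ep; [rewrite Rabs_R0; exact dpos|]. pose proof (Rabs_pos s0). lra. Qed.

Lemma base_X i : X e' 0 s0 i = c' i.
Proof.
  apply coded_orbit_eq; [exact ep0|]. destruct (glue_orbit lam (G 0 s0) ep0 Htop) as [B E].
  split; [exact B|]. intros j. rewrite He'. apply E.
Qed.

Let HX0 : X e' 0 s0 0%nat = 0.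
Proof. exact (base_X 0). Qed.

(** Induction on the time of a first return. Before time [Q] the box keeps the orbit within |c_i| of
    c_i; from time [Q] on, a return would make the base critical orbit return as well, by
    [collision]. *)
Lemma no_return t : inD del t -> (forall i, closed_side (e' i) (X e' t (root e' t) i)) ->
  forall i, (1 <= i)%nat -> (forall j, (1 <= j)%nat -> (j <= i)%nat -> c' j <> 0 /\ ((j < Q)%nat -> c j <> 0)) ->
  2 < lam ^ Q \/ (i < Q)%nat -> X e' t (root e' t) i <> 0.
Proof.
  intros Ht Hcl i. induction i as [i IH] using (well_founded_induction lt_wf). intros Hi Hj HQ E.
  destruct (root_spec e' s0 Hag Hs0 HX0 t Ht) as [R1 R2].
  assert (EG : expanding_pair lam (G t (root e' t))).
  { apply ep; [apply inD_Rabs in Ht; lra|lra]. }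
  assert (It : forall j, X e' t (root e' t) j = iter j (glue (G t (root e' t))) 0).
  { apply (closed_orbit_iter lam _ e'); auto. now apply coded_orbit_spec. }
  destruct (le_lt_dec Q i) as [HQi|HiQ].
  - destruct HQ as [HQ|HQ]; [|lia].
    apply (proj1 (Hj i Hi (Nat.le_refl i))).
    apply (collision lam (G 0 s0) (G t (root e' t)) i); auto.
    + intros j. fold (c' j). rewrite <- He', <- It. apply Hcl.
    + rewrite <- It. exact E.
    + intros j H1 H2. rewrite <- It. apply IH; auto. intros l L1 L2. apply Hj; lia.
    + eapply Rlt_le_trans; [exact HQ|]. apply Rle_pow; [lra|exact HQi].
  - pose proof HC as (_ & _ & _ & H & _).
    destruct (H e' t (root e' t) Hag) as (_ & _ & H3); [apply inD_Rabs in Ht; lra|lra|].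
    specialize (H3 i Hi HiQ (proj2 (Hj i Hi (Nat.le_refl i)) HiQ)).
    rewrite E, Rminus_0_l, Rabs_Ropp in H3. lra.
Qed.

(** A periodic code has a periodic coded orbit, so only p - 1 signs need watching, and they persist
    because none can vanish while the closed sides are respected. The final alternative covers a
    periodic f, where all returns are short, and the approximations, whose periods are not bounded
    in advance. *)
Lemma per_signs p : (1 <= p)%nat -> c' p = 0 ->
  (forall q, (1 <= q)%nat -> (q < p)%nat -> c' q <> 0) ->
  (forall q, (1 <= q)%nat -> (q < p)%nat -> (q < Q)%nat -> c q <> 0) ->
  2 < lam ^ Q \/ (p <= Q)%nat ->
  forall t, inD del t -> forall i, same_sign (c' i) (X e' t (root e' t) i).
Proof.
  intros Hp Hcp Hmin HcQ HQ.
  assert (cper : forall i, c' (i + p)%nat = c' i).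
  { intros i. unfold c' at 1. rewrite iter_add. fold (c' p). rewrite Hcp. reflexivity. }
  assert (cperm : forall m i, c' (i + m * p)%nat = c' i).
  { induction m; intros i; simpl; [f_equal; lia|].
    replace (i + (p + m * p))%nat with ((i + m * p) + p)%nat by lia. rewrite cper. apply IHm. }
  assert (xper : forall t, inD del t -> forall i, X e' t (root e' t) (i + p)%nat = X e' t (root e' t) i).
  { intros t Ht i. destruct (root_spec e' s0 Hag Hs0 HX0 t Ht) as [R1 R2].
    assert (EG : expanding_pair lam (G t (root e' t))).
    { apply ep; [apply inD_Rabs in Ht; lra|lra]. }
    destruct (coded_orbit_spec lam (G t (root e' t)) e' EG) as [XB XE].
    symmetry. apply (coded_orbit_eq lam (G t (root e' t)) e' (fun i => X e' t (root e' t) (i + p)%nat) i EG).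
    split; [intros j; apply XB|]. intros j.
    replace (e' j) with (e' (j + p)%nat) by (rewrite !He', cper; reflexivity). apply XE. }
  assert (xperm : forall t, inD del t -> forall m i, X e' t (root e' t) (i + m * p)%nat = X e' t (root e' t) i).
  { intros t Ht. induction m; intros i; simpl; [f_equal; lia|].
    replace (i + (p + m * p))%nat with ((i + m * p) + p)%nat by lia. rewrite xper by exact Ht. apply IHm. }
  (* Positivity of the product means that the signs agree. The index is shifted because the point at
     time 0 is the critical point itself. *)
  set (y := fun i t => X e' t (root e' t) (S i) * c' (S i)).
  assert (Per : forall t, inD del t -> forall i, (i < p - 1)%nat -> 0 < y i t).
  { apply signs_persist.
    - intros i t _ Ht. apply cont_within_of_continuous. unfold y.
      apply (continuous_mult (fun t => X e' t (root e' t) (S i)) (fun _ => c' (S i))); [|apply continuous_const].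
      apply (X_root_cont e' s0); auto.
    - intros i Hi. unfold y. rewrite (root_0 e' s0 Hag Hs0 HX0), base_X.
      assert (N0 : c' (S i) <> 0) by (apply Hmin; lia). nra.
    - intros t Ht Hy i Hi.
      assert (Hcl : forall j, closed_side (e' j) (X e' t (root e' t) j)).
      { intros j. rewrite (Nat.div_mod_eq j p), Nat.add_comm, Nat.mul_comm, xperm, He', cperm by exact Ht.
        set (r := (j mod p)%nat). assert (Hr : (r < p)%nat) by (apply Nat.mod_upper_bound; lia).
        destruct r as [|r].
        - destruct (root_spec e' s0 Hag Hs0 HX0 t Ht) as [_ R2]. rewrite R2. apply closed_zero.
        - specialize (Hy r ltac:(lia)). unfold y in Hy.
          assert (N0 : c' (S r) <> 0) by (apply Hmin; lia).
          unfold side. destruct (Rlt_dec (c' (S r)) 0); simpl; nra. }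
      assert (xN : X e' t (root e' t) (S i) <> 0).
      { apply no_return; auto; try lia.
        - intros j J1 J2. split; [apply Hmin; lia|intros; apply HcQ; auto; lia].
        - destruct HQ; [left; assumption|right; lia]. }
      assert (N0 : c' (S i) <> 0) by (apply Hmin; lia).
      specialize (Hy i Hi). unfold y in *.
      assert (X e' t (root e' t) (S i) * c' (S i) <> 0) by (now apply Rmult_integral_contrapositive). lra. }
  intros t Ht i.
  rewrite (Nat.div_mod_eq i p), Nat.add_comm, Nat.mul_comm, cperm, xperm by exact Ht.
  set (r := (i mod p)%nat). assert (Hr : (r < p)%nat) by (apply Nat.mod_upper_bound; lia).
  destruct r as [|r].
  - destruct (root_spec e' s0 Hag Hs0 HX0 t Ht) as [_ R2]. rewrite R2. change (c' 0%nat) with 0. split; lra.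
  - specialize (Per t Ht r ltac:(lia)). unfold y in Per. split; split; intros; nra.
Qed.

Hypothesis Hss : forall t, inD del t -> forall i, same_sign (c' i) (X e' t (root e' t) i).

Let Hcl : forall t i, inD del t -> closed_side (e' i) (X e' t (root e' t) i).
Proof. intros t i Ht. rewrite He', (same_sign_side _ _ (Hss t Ht i)). apply side_closed. Qed.

Lemma base_top t : inD del t -> F t 0 + root e' t * w 0 <= 1.
Proof.
  intros Ht. pose proof (cl_top e' s0 Hag Hs0 HX0 Hcl t Ht) as H. unfold G, branches in H.
  rewrite !ext_in in H by (unfold half, inCC; simpl; lra). exact H.
Qed.

Lemma base_bound t : inD del t -> Rabs (root e' t) < d.
Proof. intros Ht. destruct (root_spec e' s0 Hag Hs0 HX0 t Ht). lra. Qed.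

Lemma base_unif_Ck : unif_Ck del k (fun _ => root e').
Proof. exact (root_unif_Ck e' s0 Hag Hs0 HX0 Hcl). Qed.

Lemma base_family : Ck_family k k del (fun t x => F t x + root e' t * w x).
Proof.
  apply (perturbed_Ck_family k e lam C d F DF w HS); [lra|exact base_bound|exact base_top|exact base_unif_Ck].
Qed.

Lemma base_root_0 : root e' 0 = s0.
Proof. exact (root_0 e' s0 Hag Hs0 HX0). Qed.

Lemma base_conj t : inD del t ->
  top_conj (fun x => F t x + root e' t * w x) (fun x => F 0 x + s0 * w x).
Proof.
  intros Ht.
  apply (conj_of_same_signs lam (G t (root e' t)) (G 0 s0)); auto.
  - apply ep; [apply inD_Rabs in Ht; lra|now apply base_bound].
  - exact (cl_top e' s0 Hag Hs0 HX0 Hcl t Ht).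
  - intros x Hx. symmetry. now apply glue_branches.
  - intros x Hx. symmetry. now apply glue_branches.
  - intros i. apply same_sign_sym. rewrite <- (cl_iter e' s0 Hag Hs0 HX0 Hcl t i Ht). now apply Hss.
Qed.

End Base.

Lemma e0_agrees : agrees N e0.
Proof. intros i _. reflexivity. Qed.

Let dl4 : Rabs 0 < dl / 4.
Proof. rewrite Rabs_R0. lra. Qed.

Let X00 : X e0 0 0 0%nat = 0.
Proof. exact (base_X e0 0 dl4 Htop0 (fun i => eq_refl) 0). Qed.

(** A conjugacy gives the true critical orbit the itinerary of c. That orbit is then the bounded
    orbit with code [e0], and it starts at 0, so s is the unique root in the box. *)
Lemma conj_root t s : inD del t -> Rabs s < dl ->
  top_conj (fun x => F t x + s * w x) (fun x => F 0 x + 0 * w x) -> s = root e0 t.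
Proof.
  intros Ht Hs Hcj. apply (root_unique e0 0 e0_agrees dl4 X00); auto.
  assert (EG : expanding_pair lam (G t s)) by (apply ep; [apply inD_Rabs in Ht; lra|lra]).
  destruct (same_signs_of_conj lam (G t s) (G 0 0) _ _ EG ep00
     (fun x Hx => eq_sym (glue_branches F w t s x Hx)) (fun x Hx => eq_sym (glue_branches F w 0 0 x Hx)) Hcj) as (T1 & _ & Ss).
  destruct (glue_orbit lam (G t s) EG T1) as [B E].
  apply (coded_orbit_eq lam (G t s) e0 (fun i => iter i (glue (G t s)) 0) 0 EG).
  split; [exact B|]. intros i. unfold e0, c. rewrite <- (same_sign_side _ _ (Ss i)). apply E.
Qed.


Section Conclusion.
Variables f v : R -> R.
Hypothesis Ff : forall x, inI x -> F 0 x = f x.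
Hypothesis HFv : Bk_deriv k e F 0 v.
Hypothesis Hss0 : forall t, inD del t -> forall i, same_sign (c i) (X e0 t (root e0 t) i).
Hypothesis HD0 : is_derive (root e0) 0 0.

Let b := root e0.

Lemma deformation (Approx : Prop) : Approx ->
  0 < del /\ del <= e /\
  (forall t, inD del t -> continuous b t) /\ b 0 = 0 /\
  (forall t, inD del t -> top_conj (fun x => F t x + b t * w x) f) /\
  (forall b' : R -> R,
     (forall t, inD del t -> continuous b' t) -> b' 0 = 0 ->
     (forall t, inD del t -> top_conj (fun x => F t x + b' t * w x) f) ->
     forall t, inD del t -> b' t = b t) /\
  real_CLip k del b /\ is_derive b 0 0 /\
  Bk_deriv k del (fun t x => F t x + b t * w x) 0 v /\
  CLip_family k k del (fun t x => F t x + b t * w x) /\ Approx.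
Proof.
  intros HApp.
  assert (HU : unif_Ck del k (fun _ => b)) by exact (base_unif_Ck e0 0 e0_agrees dl4 Htop0 (fun i => eq_refl) Hss0).
  assert (Hb0 : b 0 = 0) by exact (base_root_0 e0 0 e0_agrees dl4 Htop0 (fun i => eq_refl)).
  assert (Hbd : forall t, inD del t -> Rabs (b t) < d) by exact (base_bound e0 0 e0_agrees dl4 Htop0 (fun i => eq_refl)).
  assert (Htp : forall t, inD del t -> F t 0 + b t * w 0 <= 1) by exact (base_top e0 0 e0_agrees dl4 Htop0 (fun i => eq_refl) Hss0).
  assert (Hcont : forall t, inD del t -> continuous b t) by (intros t; exact (root_cont e0 0 e0_agrees dl4 X00 t)).
  assert (I0 : inD del 0) by (unfold inD; lra).
  assert (de : d <= e) by exact (su_de HS).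
  split; [exact del_pos|]. split; [lra|]. split; [exact Hcont|]. split; [exact Hb0|].
  split.
  { intros t Ht. apply (top_conj_ext (fun x => F t x + b t * w x) _ (fun x => F 0 x + 0 * w x)); auto.
    - intros x Hx. rewrite Ff by exact Hx. ring.
    - exact (base_conj e0 0 e0_agrees dl4 Htop0 (fun i => eq_refl) Hss0 t Ht). }
  split.
  (* A competitor b' could leave the range |s| < [dl] in which roots are unique. Continuity supplies
     a time where |b' - b| equals a positive [m <= dl / 4]; there b' is still in range, hence equal
     to b, a contradiction. *)
  { intros b' Hb' Hb'0 Hcj t1 Ht1. destruct (Req_dec (b' t1) (b t1)) as [|Hn]; [assumption|]. exfalso.
    set (u := fun t => Rabs (b' t - b t)).
    assert (Cu : forall t, inD del t -> continuous u t).
    { intros t Ht. unfold u. apply (continuous_comp (fun t => b' t - b t) Rabs).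
      - apply (continuous_minus b' b); auto.
      - apply continuous_Rabs. }
    assert (Pu : 0 < u t1) by (apply Rabs_pos_lt; lra).
    assert (U0 : u 0 = 0) by (unfold u; rewrite Hb'0, Hb0, Rminus_diag; apply Rabs_R0).
    set (m := Rmin (u t1) (dl / 4)). assert (Hm : 0 < m) by (apply Rmin_pos; lra).
    pose proof (Rmin_l (u t1) (dl / 4)). pose proof (Rmin_r (u t1) (dl / 4)). fold m in H, H0.
    assert (E : exists t2, inD del t2 /\ u t2 = m).
    { destruct (Rle_dec 0 t1).
      - destruct (ivt_within u 0 t1 m) as [t2 [H2 E2]]; [lra| |left; lra|].
        + intros t Ht. apply cont_within_of_continuous, Cu. unfold inD, inCC in *; lra.
        + exists t2. split; [unfold inD, inCC in *; lra|exact E2].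
      - destruct (ivt_within u t1 0 m) as [t2 [H2 E2]]; [lra| |right; lra|].
        + intros t Ht. apply cont_within_of_continuous, Cu. unfold inD, inCC in *; lra.
        + exists t2. split; [unfold inD, inCC in *; lra|exact E2]. }
    destruct E as [t2 [H2 E2]].
    destruct (root_spec e0 0 e0_agrees dl4 X00 t2 H2) as [R1 _]. fold b in R1.
    assert (E3 : b' t2 = b t2).
    { apply (conj_root t2); auto.
      - unfold u in E2. pose proof (Rabs_triang (b' t2 - b t2) (b t2)) as T.
        replace (b' t2 - b t2 + b t2) with (b' t2) in T by ring. lra.
      - apply (top_conj_ext (fun x => F t2 x + b' t2 * w x) _ f); auto.
        intros x Hx. rewrite Ff by exact Hx. ring. }
    unfold u in E2. rewrite E3, Rminus_diag, Rabs_R0 in E2. lra. }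
  split; [apply (perturbed_real_CLip k e lam C d F DF w HS); auto; lra|].
  split; [exact HD0|]. split; [|split; [|exact HApp]].
  - destruct (perturbed_deriv k e lam C d F DF w HS del ltac:(lra) F v b 0 0) as [_ Q1]; auto.
    { intros t Ht. apply (su_U HS t Ht). }
    split; [apply HFv|]. intros eps He. destruct (Q1 eps He) as [d1 [D1 K1]]. exists d1. split; [exact D1|].
    intros t Ht Hd. eapply normk_le_ext; [|apply K1; auto]. intros x _. cbv beta. ring.
  - apply (perturbed_CLip_family k e lam C d F DF w HS); auto; lra.
Qed.

End Conclusion.

Lemma base_crit_periodic e' s0 p : agrees N e' -> Rabs s0 < dl / 4 -> G 0 s0 true 0 <= 1 ->
  (forall i, e' i = side (iter i (glue (G 0 s0)) 0)) ->
  (1 <= p)%nat -> iter p (glue (G 0 s0)) 0 = 0 ->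
  (forall q, (1 <= q)%nat -> (q < p)%nat -> iter q (glue (G 0 s0)) 0 <> 0) ->
  crit_periodic (fun x => F 0 x + root e' 0 * w x).
Proof.
  intros Hag Hs Ht He H1 H2 H3. rewrite (base_root_0 e' s0 Hag Hs Ht He).
  assert (E : forall i, iter i (glue (G 0 s0)) 0 = iter i (fun x => F 0 x + s0 * w x) 0).
  { intros i. apply iter_ext_inI.
    - intros x Hx. now apply glue_branches.
    - intros j. apply (iter_inI lam); auto. apply ep; [rewrite Rabs_R0; exact dpos|]. pose proof (Rabs_pos s0). lra. }
  exists p. split; [exact H1|]. split; [rewrite <- E; exact H2|]. intros q Q1 Q2. rewrite <- E. auto.
Qed.

Definition approximable (b : R -> R) : Prop := exists g : nat -> R -> R -> R,
  (forall n, Ck_family k k del (g n)) /\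
  (forall n t, inD del t -> top_conj (g n t) (g n 0)) /\
  (forall n, crit_periodic (g n 0)) /\
  (forall t, inD del t ->
     forall eps, 0 < eps -> exists N : nat, forall n, (N <= n)%nat ->
       normk_le (k - 1) (fun x => g n t x - (F t x + b t * w x)) eps).

Lemma normk_scaled t b1 b2 eps Nw : normk_le k w Nw -> Rabs (b1 - b2) * Nw <= eps ->
  normk_le (k - 1) (fun x => (F t x + b1 * w x) - (F t x + b2 * w x)) eps.
Proof.
  intros HN Hb. apply normk_le_iff in HN. destruct HN as [Cw HN].
  assert (Cw1 : forall b, Ck_half (k - 1) b w) by (intros; apply (CkOn_mono k); [lia|apply Cw]).
  apply (normk_le_ext (k - 1) (fun x => (b1 - b2) * w x + 0 * w x)); [intros x _; ring|].
  apply normk_lin; auto. intros b i x Hi Hx. rewrite Rmult_0_l, Rplus_0_r, Rabs_mult.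
  eapply Rle_trans; [|exact Hb]. apply Rmult_le_compat_l; [apply Rabs_pos|]. apply HN; auto; lia.
Qed.

(** The deformed family is itself of class C^k with periodic critical point at t = 0, so the
    constant sequence serves. *)
Lemma periodic_approximable p : (1 <= p)%nat -> c p = 0 ->
  (forall q, (1 <= q)%nat -> (q < p)%nat -> c q <> 0) ->
  (forall t, inD del t -> forall i, same_sign (c i) (X e0 t (root e0 t) i)) ->
  approximable (root e0).
Proof.
  intros Hp Hcp Hmin Hss.
  exists (fun _ t x => F t x + root e0 t * w x). split; [|split; [|split]].
  - intros _. exact (base_family e0 0 e0_agrees dl4 Htop0 (fun i => eq_refl) Hss).
  - intros _ t Ht. apply (top_conj_ext (fun x => F t x + root e0 t * w x) _ (fun x => F 0 x + 0 * w x)); auto.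
    + intros x _. rewrite (base_root_0 e0 0 e0_agrees dl4 Htop0 (fun i => eq_refl)). reflexivity.
    + exact (base_conj e0 0 e0_agrees dl4 Htop0 (fun i => eq_refl) Hss t Ht).
  - intros _. apply (base_crit_periodic e0 0 p e0_agrees dl4 Htop0 (fun i => eq_refl)); auto.
  - intros t Ht eps He. exists 0%nat. intros n _.
    destruct (in_Bk_norm k w (su_w HS)) as [Nw [_ HNw]].
    apply (normk_scaled t _ _ eps Nw HNw). rewrite Rminus_diag, Rabs_R0, Rmult_0_l. lra.
Qed.

(** * Aperiodic critical point: approximation by periodic ones *)

Section Aperiodic.
Hypothesis Hnp : forall i, (1 <= i)%nat -> c i <> 0.

(* If no s near 0 on the side w(0) s <= 0 made the critical point periodic, the itinerary e0 would be constant in s, contradicting transversality. *)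
Lemma periodic_nearby M eta : 0 < eta -> exists s1, Rabs s1 < eta /\ Rabs s1 < dl / 4 /\
  G 0 s1 true 0 <= 1 /\ (exists n, (1 <= n)%nat /\ iter n (glue (G 0 s1)) 0 = 0) /\
  forall i, (i < M)%nat -> side (iter i (glue (G 0 s1)) 0) = e0 i.
Proof.
  intros Heta.
  (* On this side of 0 the critical value of f + s w is at most that of f, hence at most 1, so the
     critical orbit stays in I. *)
  set (sgw := if Rle_dec (w 0) 0 then 1 else -1).
  assert (Hsg : Rabs sgw = 1 /\ sgw * w 0 <= 0).
  { unfold sgw. destruct (Rle_dec (w 0) 0); [rewrite Rabs_R1|rewrite Rabs_left by lra]; lra. }
  destruct Hsg as [Hsg1 Hsg2].
  set (cu := fun i u => iter i (glue (G 0 (sgw * u))) 0).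
  assert (Au : forall u, 0 <= u -> Rabs (sgw * u) = u).
  { intros u Hu. rewrite Rabs_mult, Hsg1, Rabs_pos_eq; lra. }
  set (U := dl / 8).
  assert (Eu : forall u, inCC 0 U u -> expanding_pair lam (G 0 (sgw * u))).
  { intros u [U1 U2]. apply ep; [rewrite Rabs_R0; exact dpos|]. rewrite Au; unfold U in *; lra. }
  assert (Tu : forall u, inCC 0 U u -> G 0 (sgw * u) true 0 <= 1).
  { intros u [U1 U2]. pose proof Htop0 as T. unfold G, branches in *. rewrite !ext_in in * by (unfold half, inCC; simpl; lra).
    assert (0 <= u * - (sgw * w 0)) by (apply Rmult_le_pos; lra). lra. }
  assert (Iu : forall i u, inCC 0 U u -> inI (cu i u)).
  { intros i u Hu. apply (iter_inI lam); auto. }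
  assert (cu0 : forall i, cu i 0 = c i) by (intros; unfold cu, c; rewrite Rmult_0_r; reflexivity).
  assert (Cu : forall i u, inCC 0 U u -> cont_within (inCC 0 U) (cu i) u).
  { induction i; intros u Hu eps He.
    - exists 1. split; [lra|]. intros. unfold cu. simpl. rewrite Rminus_diag, Rabs_R0. exact He.
    - destruct (proj1 (continuous_eps _ _) (glue_cont lam _ (cu i u) (Eu u Hu)) (eps / 2)) as [d1 [D1 K1]]; [lra|].
      destruct (IHi u Hu d1 D1) as [d2 [D2 K2]].
      assert (E1 : 0 < eps / 2 / (C + 1)) by (apply Rdiv_lt_0_compat; lra).
      exists (Rmin d2 (eps / 2 / (C + 1))). split; [now apply Rmin_pos|]. intros v Hv Hd.
      pose proof (Rmin_l d2 (eps / 2 / (C + 1))). pose proof (Rmin_r d2 (eps / 2 / (C + 1))).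
      specialize (K1 (cu i v) (K2 v Hv ltac:(lra))).
      change (cu (S i) v) with (glue (G 0 (sgw * v)) (cu i v)). change (cu (S i) u) with (glue (G 0 (sgw * u)) (cu i u)).
      set (X1 := cu i v) in *.
      assert (E2 : glue (G 0 (sgw * v)) X1 - glue (G 0 (sgw * u)) X1 = (sgw * v - sgw * u) * ext (side X1) w X1).
      { unfold glue. apply (pf_s PF). }
      assert (E3 : Rabs (glue (G 0 (sgw * v)) X1 - glue (G 0 (sgw * u)) X1) <= eps / 2).
      { rewrite E2, Rabs_mult. replace (sgw * v - sgw * u) with (sgw * (v - u)) by ring.
        rewrite Rabs_mult, Hsg1, Rmult_1_l.
        apply Rle_trans with (eps / 2 / (C + 1) * (C + 1)); [|right; field; lra].
        assert (Rabs (ext (side X1) w X1) <= C).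
        { apply (pf_W PF). destruct (Iu i v Hv). pose proof (orbit_bound_gt_1 lam lam1).
          unfold X1. apply Rabs_le. lra. }
        apply Rmult_le_compat; try apply Rabs_pos; lra. }
      replace (glue (G 0 (sgw * v)) X1 - glue (G 0 (sgw * u)) (cu i u)) with
       ((glue (G 0 (sgw * v)) X1 - glue (G 0 (sgw * u)) X1) + (glue (G 0 (sgw * u)) X1 - glue (G 0 (sgw * u)) (cu i u))) by ring.
      eapply Rle_lt_trans; [apply Rabs_triang|]. lra. }
  assert (I0 : inCC 0 U 0) by (unfold inCC, U; lra).
  (* The finitely many points c_1, ..., c_(M-1) are nonzero, so their sides do not change for small
     parameters. *)
  assert (HM : exists r, 0 < r /\ forall i r', (i < M)%nat -> 0 < r' -> r' <= r ->
     forall u, inCC 0 U u -> u < r' -> side (cu i u) = e0 i).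
  { apply (finite_uniform_radius (fun i r' => forall u, inCC 0 U u -> u < r' -> side (cu i u) = e0 i)). intros i.
    destruct i as [|i].
    - exists 1. split; [lra|]. intros. reflexivity.
    - assert (P : 0 < Rabs (c (S i))) by (apply Rabs_pos_lt, Hnp; lia).
      destruct (Cu (S i) 0 I0 _ P) as [d1 [D1 K1]]. exists d1. split; [exact D1|].
      intros r' _ Hr u Hu Hur. rewrite cu0 in K1.
      specialize (K1 u Hu ltac:(rewrite Rminus_0_r, Rabs_pos_eq; destruct Hu; lra)).
      unfold e0. apply Rabs_def2 in K1. unfold side. unfold Rabs in K1.
      destruct (Rcase_abs (c (S i))), (Rlt_dec (cu (S i) u) 0), (Rlt_dec (c (S i)) 0); auto; lra. }
  destruct HM as [r [Hr HM]].
  set (u0 := Rmin U (Rmin (eta / 2) (r / 2))).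
  assert (Hu0 : 0 < u0) by (unfold u0, U; repeat apply Rmin_pos; lra).
  pose proof (Rmin_l U (Rmin (eta / 2) (r / 2))). pose proof (Rmin_r U (Rmin (eta / 2) (r / 2))).
  pose proof (Rmin_l (eta / 2) (r / 2)). pose proof (Rmin_r (eta / 2) (r / 2)). fold u0 in H, H0.
  assert (Ex : exists u n, inCC 0 U u /\ 0 < u <= u0 /\ (1 <= n)%nat /\ cu n u = 0).
  { apply NNPP. intros Hno.
    assert (Nz : forall i u, (1 <= i)%nat -> inCC 0 u0 u -> cu i u <> 0).
    { intros i u Hi [U1 U2] E. destruct (Req_dec u 0) as [->|Hn].
      - rewrite cu0 in E. apply (Hnp i Hi E).
      - apply Hno. exists u, i. unfold inCC. repeat split; auto; lra. }
    assert (Sd : forall i, side (cu i u0) = e0 i).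
    { intros [|i]; [reflexivity|]. unfold e0. rewrite <- cu0.
      destruct (Bool.bool_dec (side (cu (S i) u0)) (side (cu (S i) 0))) as [|Hn]; [assumption|]. exfalso.
      destruct (ivt_within (cu (S i)) 0 u0 0) as [u [Hu Ez]]; [lra| | |].
      - intros u Hu. apply (cont_within_sub (inCC 0 U)); [unfold inCC in *; intros; lra|].
        apply Cu. unfold inCC in *; lra.
      - unfold side in Hn. destruct (Rlt_dec (cu (S i) u0) 0), (Rlt_dec (cu (S i) 0) 0); try tauto; [right|left]; lra.
      - apply (Nz (S i) u ltac:(lia) Hu Ez). }
    assert (Iu0 : inCC 0 U u0) by (unfold inCC; lra).
    destruct (glue_orbit lam _ (Eu u0 Iu0) (Tu u0 Iu0)) as [B E].
    assert (X1 : X e0 0 (sgw * u0) 0%nat = 0).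
    { apply (coded_orbit_eq lam (G 0 (sgw * u0)) e0 (fun i => cu i u0) 0 (Eu u0 Iu0)).
      split; [exact B|]. intros i. rewrite <- Sd. apply E. }
    assert (A0 : Rabs 0 < dl) by (rewrite Rabs_R0; lra).
    assert (As : Rabs (sgw * u0) < dl) by (rewrite Au; unfold U in *; lra).
    pose proof (slope_lower e0 0 (sgw * u0) 0 e0_agrees A0 As A0) as L.
    rewrite X1, X00, Rminus_0_r, Rminus_diag, Rabs_R0, Au in L by lra.
    assert (0 < z / 2 * u0) by (apply Rmult_lt_0_compat; lra). lra. }
  destruct Ex as (u & n & Hu & [Hu1 Hu2] & Hn & En).
  exists (sgw * u). rewrite Au by lra. split; [lra|]. split; [unfold U in *; lra|].
  split; [now apply Tu|]. split; [exists n; split; assumption|].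
  intros i Hi. apply (HM i r Hi Hr (Rle_refl r) u Hu). lra.
Qed.

Hypothesis HQ : 2 < lam ^ Q.

(** Of the [N + n] prescribed symbols, the first [N] place the code in the admissible box and the
    further [n] force convergence. *)
Definition is_approx_param (n : nat) (s : R) : Prop :=
  Rabs s < dl / 4 /\ G 0 s true 0 <= 1 /\ (exists m, (1 <= m)%nat /\ iter m (glue (G 0 s)) 0 = 0) /\
  forall i, (i < N + n)%nat -> side (iter i (glue (G 0 s)) 0) = e0 i.

Definition approx_param (n : nat) : R := epsilon (inhabits 0) (is_approx_param n).

Definition approx_code (n i : nat) : bool := side (iter i (glue (G 0 (approx_param n))) 0).

Lemma approx_param_spec n : is_approx_param n (approx_param n).
Proof.
  apply (epsilon_spec (inhabits 0) (is_approx_param n)).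
  destruct (periodic_nearby (N + n) 1 Rlt_0_1) as (s & _ & H1 & H2 & H3 & H4).
  exists s. repeat split; auto.
Qed.

Lemma approx_code_agrees n : agrees N (approx_code n).
Proof. intros i Hi. destruct (approx_param_spec n) as (_ & _ & _ & H). apply H. lia. Qed.

Lemma approx_param_small n : Rabs (approx_param n) < dl / 4.
Proof. apply approx_param_spec. Qed.

Lemma approx_param_top n : G 0 (approx_param n) true 0 <= 1.
Proof. apply approx_param_spec. Qed.

Lemma approx_param_period n : exists p, (1 <= p)%nat /\ iter p (glue (G 0 (approx_param n))) 0 = 0 /\
  forall q, (1 <= q)%nat -> (q < p)%nat -> iter q (glue (G 0 (approx_param n))) 0 <> 0.
Proof.
  destruct (approx_param_spec n) as (_ & _ & [m [Hm Em]] & _). revert Hm Em.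
  induction m as [m IH] using (well_founded_induction lt_wf). intros Hm Em.
  destruct (excluded_middle_informative (exists q, (1 <= q)%nat /\ (q < m)%nat /\ iter q (glue (G 0 (approx_param n))) 0 = 0))
    as [[q (Q1 & Q2 & Q3)]|Hno]; [apply (IH q); auto|].
  exists m. split; [exact Hm|]. split; [exact Em|]. intros q Q1 Q2 Q3. apply Hno. exists q. auto.
Qed.

Lemma approx_code_signs n t i : inD del t ->
  same_sign (iter i (glue (G 0 (approx_param n))) 0) (X (approx_code n) t (root (approx_code n) t) i).
Proof.
  intros Ht. destruct (approx_param_period n) as (p & P1 & P2 & P3).
  apply (per_signs (approx_code n) (approx_param n) (approx_code_agrees n) (approx_param_small n) (approx_param_top n) (fun i => eq_refl) p); auto.
Qed.

Lemma inv_lam_pow_mono m a : (m <= a)%nat -> (/ lam) ^ a <= (/ lam) ^ m.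
Proof.
  induction 1; [lra|]. simpl. assert (0 < (/ lam) ^ m0) by (apply pow_lt; lra).
  assert (/ lam * (/ lam) ^ m0 <= 1 * (/ lam) ^ m0) by (apply Rmult_le_compat_r; lra). lra.
Qed.

Let Xn0 n : X (approx_code n) 0 (approx_param n) 0%nat = 0.
Proof. exact (base_X (approx_code n) (approx_param n) (approx_param_small n) (approx_param_top n) (fun i => eq_refl) 0). Qed.

(** Replacing the code by [e0] changes X_0 by O(lam^(-n)), and the slope in s, at least z / 2, turns
    this into a bound on the distance between roots. *)
Lemma root_conv n t : inD del t ->
  Rabs (root (approx_code n) t - root e0 t) <= (/ lam) ^ n * (2 * (2 * orbit_bound lam) / z).
Proof.
  intros Ht. pose proof (proj1 (inD_Rabs _ _) Ht) as At.
  destruct (root_spec (approx_code n) (approx_param n) (approx_code_agrees n) (approx_param_small n) (Xn0 n) t Ht) as [R1 R2].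
  destruct (root_spec e0 0 e0_agrees dl4 X00 t Ht) as [R3 R4].
  pose proof (slope_lower e0 t (root (approx_code n) t) (root e0 t) e0_agrees ltac:(lra) ltac:(lra) ltac:(lra)) as L.
  rewrite R4, <- R2 in L.
  pose proof (coded_orbit_agree lam C d G (branches_deriv F w) (fun b => ext b w) PF e0 (approx_code n) t (root (approx_code n) t) (N + n) 0
    ltac:(lra) ltac:(lra) ltac:(lia)) as A.
  specialize (A ltac:(intros j Hj; symmetry; apply (approx_param_spec n); exact Hj)).
  fold (X e0 t (root (approx_code n) t)) in A. fold (X (approx_code n) t (root (approx_code n) t)) in A.
  pose proof (inv_lam_pow_mono n (N + n - 0) ltac:(lia)) as P. pose proof (orbit_bound_gt_1 lam lam1).
  apply (Rmult_le_compat_r (2 * orbit_bound lam)) in P; [|lra].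
  apply (Rmult_le_reg_l (z / 2)); [lra|].
  replace (z / 2 * ((/ lam) ^ n * (2 * (2 * orbit_bound lam) / z))) with ((/ lam) ^ n * (2 * orbit_bound lam)) by (field; lra).
  eapply Rle_trans; [exact L|]. eapply Rle_trans; [exact A|exact P].
Qed.

(** The difference splits into a change of code at a fixed parameter and a change of parameter at
    the fixed code [e0]; both are O(lam^(-n)) for a fixed time [i]. *)
Lemma X_conv i t : inD del t -> forall eps, 0 < eps -> exists n, (S i <= n)%nat /\
  Rabs (X (approx_code n) t (root (approx_code n) t) i - X e0 t (root e0 t) i) < eps.
Proof.
  intros Ht eps He. pose proof (proj1 (inD_Rabs _ _) Ht) as At. pose proof (orbit_bound_gt_1 lam lam1) as HMB.
  set (K := 2 * orbit_bound lam + C / (1 - / lam) * (2 * (2 * orbit_bound lam) / z)).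
  destruct (pow_small (/ lam) K eps) as [m Hm]; [lra|exact He|].
  set (n := (S i + m)%nat). exists n. split; [unfold n; lia|].
  eapply Rle_lt_trans; [|apply (Hm m (Nat.le_refl m))].
  destruct (root_spec (approx_code n) (approx_param n) (approx_code_agrees n) (approx_param_small n) (Xn0 n) t Ht) as [R1 R2].
  destruct (root_spec e0 0 e0_agrees dl4 X00 t Ht) as [R3 R4].
  pose proof (coded_orbit_agree lam C d G (branches_deriv F w) (fun b => ext b w) PF (approx_code n) e0 t (root (approx_code n) t) (N + n) i
    ltac:(lra) ltac:(lra) ltac:(unfold n; lia)) as A.
  specialize (A ltac:(intros j Hj; apply (approx_param_spec n); exact Hj)).
  pose proof (coded_orbit_lip_s lam C d G (branches_deriv F w) (fun b => ext b w) PF e0 t (root (approx_code n) t) (root e0 t) i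
    ltac:(lra) ltac:(lra) ltac:(lra)) as B.
  pose proof (root_conv n t Ht) as Rc.
  assert (P : 0 <= C / (1 - / lam)).
  { apply Rmult_le_pos; [lra|]. left; apply Rinv_0_lt_compat; lra. }
  apply (Rmult_le_compat_l _ _ _ P) in Rc.
  replace (C * Rabs (root (approx_code n) t - root e0 t) / (1 - / lam)) with (C / (1 - / lam) * Rabs (root (approx_code n) t - root e0 t)) in B by (field; lra).
  pose proof (inv_lam_pow_mono m (N + n - i) ltac:(unfold n; lia)) as P1.
  pose proof (inv_lam_pow_mono m n ltac:(unfold n; lia)) as P2.
  apply (Rmult_le_compat_r (2 * orbit_bound lam)) in P1; [|lra].
  assert (P3 : 0 <= C / (1 - / lam) * (2 * (2 * orbit_bound lam) / z)).
  { apply Rmult_le_pos; [exact P|]. apply Rmult_le_pos; [lra|]. left; apply Rinv_0_lt_compat; lra. }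
  apply (Rmult_le_compat_r _ _ _ P3) in P2.
  replace (X (approx_code n) t (root (approx_code n) t) i - X e0 t (root e0 t) i) with
    ((coded_orbit lam (G t (root (approx_code n) t)) (approx_code n) i - coded_orbit lam (G t (root (approx_code n) t)) e0 i) +
     (coded_orbit lam (G t (root (approx_code n) t)) e0 i - coded_orbit lam (G t (root e0 t)) e0 i)) by (unfold X; ring).
  eapply Rle_trans; [apply Rabs_triang|]. unfold K.
  rewrite Rmult_plus_distr_l. apply Rplus_le_compat; [lra|].
  eapply Rle_trans; [exact B|]. eapply Rle_trans; [exact Rc|].
  eapply Rle_trans; [|exact P2]. right. ring.
Qed.

(** Only the closed sides pass to the limit of the approximations; that no point of the limit orbit
    is 0 at a positive time then comes from [no_return]. *)
Lemma aperiodic_signs t : inD del t -> forall i, same_sign (c i) (X e0 t (root e0 t) i).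
Proof.
  intros Ht.
  assert (Hcl : forall i, closed_side (e0 i) (X e0 t (root e0 t) i)).
  { intros i.
    assert (Q1 : forall n, (S i <= n)%nat -> closed_side (e0 i) (X (approx_code n) t (root (approx_code n) t) i)).
    { intros n Hn. destruct (approx_param_spec n) as (_ & _ & _ & Sp).
      rewrite <- (Sp i) by lia. rewrite (same_sign_side _ _ (approx_code_signs n t i Ht)). apply side_closed. }
    set (y := X e0 t (root e0 t) i) in *.
    destruct (Req_dec y 0) as [->|Hy]; [apply closed_zero|].
    destruct (X_conv i t Ht (Rabs y) (Rabs_pos_lt _ Hy)) as [n [Hn K]]. fold y in K.
    specialize (Q1 n Hn). apply Rabs_def2 in K. unfold Rabs in K.
    destruct (e0 i); simpl in *; destruct (Rcase_abs y); lra. }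
  intros i. destruct i as [|i].
  { rewrite (proj2 (root_spec e0 0 e0_agrees dl4 X00 t Ht)). change (c 0%nat) with 0. split; lra. }
  assert (N0 : X e0 t (root e0 t) (S i) <> 0).
  { apply (no_return e0 0 e0_agrees dl4 Htop0 (fun i => eq_refl) t Ht Hcl); [lia| |left; exact HQ].
    intros j J1 J2. split; [|intros _]; apply Hnp; exact J1. }
  specialize (Hcl (S i)). pose proof (Hnp (S i) ltac:(lia)) as N1.
  change (e0 (S i)) with (side (c (S i))) in Hcl. unfold side in Hcl.
  destruct (Rtotal_order (X e0 t (root e0 t) (S i)) 0) as [K|[K|K]]; [|tauto|];
    destruct (Rlt_dec (c (S i)) 0); destruct (Rtotal_order (c (S i)) 0) as [?|[?|?]];
    simpl in Hcl; try tauto; split; split; intros; lra.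
Qed.
Lemma aperiodic_approximable : approximable (root e0).
Proof.
  exists (fun n t x => F t x + root (approx_code n) t * w x). split; [|split; [|split]].
  - intros n. apply (base_family (approx_code n) (approx_param n) (approx_code_agrees n) (approx_param_small n) (approx_param_top n) (fun i => eq_refl)).
    intros t Ht i. now apply approx_code_signs.
  - intros n t Ht. apply (top_conj_ext (fun x => F t x + root (approx_code n) t * w x) _ (fun x => F 0 x + approx_param n * w x)); auto.
    + intros x _. rewrite (base_root_0 (approx_code n) (approx_param n) (approx_code_agrees n) (approx_param_small n) (approx_param_top n) (fun i => eq_refl)). reflexivity.
    + apply (base_conj (approx_code n) (approx_param n) (approx_code_agrees n) (approx_param_small n) (approx_param_top n) (fun i => eq_refl)); auto.
      intros t' Ht' i. now apply approx_code_signs.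
  - intros n. destruct (approx_param_period n) as (p & P1 & P2 & P3).
    apply (base_crit_periodic (approx_code n) (approx_param n) p (approx_code_agrees n) (approx_param_small n) (approx_param_top n) (fun i => eq_refl)); auto.
  - intros t Ht eps He. destruct (in_Bk_norm k w (su_w HS)) as [Nw [Nw0 HNw]].
    destruct (pow_small (/ lam) (2 * (2 * orbit_bound lam) / z * Nw) eps) as [M HM]; [lra|exact He|].
    exists M. intros n Hn. apply (normk_scaled t _ _ eps Nw HNw).
    specialize (HM n Hn). pose proof (root_conv n t Ht) as Rc.
    apply (Rmult_le_compat_r Nw) in Rc; [|exact Nw0]. rewrite Rmult_assoc in Rc. lra.
Qed.

End Aperiodic.
End Box.
End Deformation.

(** Both conventions put 0 on the right, so the formula also holds at the critical point. *)
Lemma Dpt_side g x : Dpt g x = Dhalf (side x) 1 g x.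
Proof. unfold Dpt, side. destruct (Rlt_dec x 0); reflexivity. Qed.

Theorem theorem2 :
  forall (k : nat) (f v w : R -> R),
    (2 <= k)%nat ->
    unimodal k f -> good f ->
    in_Bk k v -> in_Bk k w ->
    v (-1) = 0 -> v 1 = 0 -> w (-1) = 0 -> w 1 = 0 ->
    J f v = 0 -> J f w <> 0 ->
    forall (e : R) (F : R -> R -> R),
      0 < e -> Ck_family k k e F ->
      (forall x, inI x -> F 0 x = f x) ->
      Bk_deriv k e F 0 v ->
      exists delta : R, 0 < delta /\ delta <= e /\
      exists b : R -> R,
        (forall t, inD delta t -> continuous b t) /\ b 0 = 0 /\
        (forall t, inD delta t -> top_conj (fun x => F t x + b t * w x) f) /\
        (forall b' : R -> R,
           (forall t, inD delta t -> continuous b' t) -> b' 0 = 0 ->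
           (forall t, inD delta t -> top_conj (fun x => F t x + b' t * w x) f) ->
           forall t, inD delta t -> b' t = b t) /\
        real_CLip k delta b /\ is_derive b 0 0 /\
        Bk_deriv k delta (fun t x => F t x + b t * w x) 0 v /\
        CLip_family k k delta (fun t x => F t x + b t * w x) /\
        exists g : nat -> R -> R -> R,
          (forall n, Ck_family k k delta (g n)) /\
          (forall n t, inD delta t -> top_conj (g n t) (g n 0)) /\
          (forall n, crit_periodic (g n 0)) /\
          (forall t, inD delta t ->
             forall eps, 0 < eps -> exists N : nat, forall n, (N <= n)%nat ->
               normk_le (k - 1) (fun x => g n t x - (F t x + b t * w x)) eps).
Proof.
  intros k f v w Hk Hf _ _ Hw _ _ wl wr Jv Jw e F He HF Ff HFv.
  destruct (setup_exists k e F w Hk He HF Hw wl wr) as (lam & C & d & DF & HS).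
  pose proof (su_pf HS) as PF.
  pose proof (pf_lam _ _ _ _ _ _ PF) as lam1. pose proof (inv_lam lam lam1) as th_b.
  pose proof (pf_C PF) as C0. pose proof (su_d HS) as dpos.
  set (G := branches F w) in *. set (c := fun i => iter i (glue (G 0 0)) 0). set (e0 := fun i => side (c i)).
  assert (I0 : inI 0) by (unfold inI; lra).
  assert (E00 : expanding_pair lam (G 0 0)) by (apply (pf_ep PF); rewrite Rabs_R0; exact dpos).
  assert (uf : forall x, inI x -> glue (G 0 0) x = f x).
  { intros x Hx. unfold G. rewrite glue_branches, Ff by exact Hx. ring. }
  assert (Htop : G 0 0 true 0 <= 1).
  { rewrite <- (glue_closed lam (G 0 0) true 0 E00) by (simpl; lra). rewrite uf by exact I0. apply Hf. }
  assert (cI : forall i, inI (c i)) by (intros; now apply (iter_inI lam)).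
  assert (cf : forall i, c i = iter i f 0) by (intros; apply iter_ext_inI; auto).
  pose proof (glue_orbit lam (G 0 0) E00 Htop) as cO.
  assert (HD : forall i, branches_deriv F w 0 0 (e0 i) (c i) = Dpt f (iter i f 0)).
  { intros i. rewrite <- cf, Dpt_side. fold (e0 i). unfold branches_deriv.
    assert (K : half (e0 i) (c i)) by (apply half_of; [apply side_closed|apply cI]).
    rewrite !Dext_in by exact K. rewrite Rmult_0_l, Rplus_0_r. symmetry.
    refine (proj2 (Ck_half_ext k (e0 i) (F 0) f _ _) 1%nat (c i) _ K); [| |lia].
    - intros x Hx. apply Ff. now apply (half_inI (e0 i)).
    - apply in_Bk_half. apply (proj1 HF 0). unfold inD; lra. }
  assert (HDb : forall i, lam <= Rabs (Dpt f (iter i f 0))).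
  { intros i. rewrite <- HD. apply (pf_big PF); rewrite Rabs_R0; exact dpos. }
  assert (rB : forall i, Rabs (inv_slopes (branches_deriv F w) e0 c i) <= / lam).
  { intros i. unfold inv_slopes. rewrite HD. apply inv_small; auto. }
  destruct (lin_sol_exists (inv_slopes (branches_deriv F w) e0 c) (forcing (fun b => ext b w) e0 c) (/ lam) C) as [Z [HZ BZ]]; auto; try lra.
  { intros i. apply (pf_W PF). apply cO. }
  assert (Z0 : Z 0%nat <> 0).
  { intros E. apply Jw. apply (J_lin_sol lam f w Z _ lam1 HDb BZ); [|exact E].
    intros i. rewrite (HZ i). unfold inv_slopes, forcing. rewrite HD, ext_in by (apply half_of; [apply side_closed|apply cI]).
    rewrite cf. reflexivity. }
  (* [DF 1 0] and [v] are both derivatives of the curve at t = 0; evaluation at a point of I reduces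
     their equality to uniqueness of real derivatives. *)
  assert (Ev : forall x, inI x -> DF 1%nat 0 x = v x).
  { intros x Hx. assert (I0e : inD e 0) by (unfold inD; lra).
    pose proof (Bk_deriv_pointwise k e F 0 v x I0e Hx HFv) as D1.
    pose proof (proj1 (proj2 (proj2 (su_curve HS))) 0%nat 0 ltac:(lia) I0e) as D2.
    rewrite (su_F HS) in D2.
    apply (Bk_deriv_pointwise k e F 0 _ x I0e Hx) in D2.
    apply is_derive_unique in D1. apply is_derive_unique in D2. rewrite <- D1, <- D2. reflexivity. }
  destruct (in_Bk_norm k v (proj1 HFv)) as [Nv [Nv0 HNv]]. apply normk_le_iff in HNv. destruct HNv as [_ HNv].
  destruct (lin_sol_exists (inv_slopes (branches_deriv F w) e0 c) (fun i => v (c i)) (/ lam) Nv) as [U [HU BU]]; auto; try lra.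
  { intros i. apply (HNv (side (c i)) 0%nat (c i) ltac:(lia)). apply half_of; [apply side_closed|apply cI]. }
  assert (U0 : U 0%nat = 0).
  { apply (J_lin_sol lam f v U _ lam1 HDb BU); [|exact Jv].
    intros i. rewrite (HU i). unfold inv_slopes. rewrite HD, cf. reflexivity. }
  (* The two cases differ only in the choice of [Q]: the period itself when c is periodic, an
     exponent with lam^Q > 2 otherwise. *)
  set (Good := fun Q del => exists N dl, admissible_box lam C d F w Z Q N dl del /\
     (forall t, inD del t -> forall i, same_sign (c i) (coded_orbit lam (G t (root lam F w dl e0 t)) e0 i)) /\
     approximable k F w del (root lam F w dl e0)).
  assert (HG : exists Q del, Good Q del).
  { destruct (excluded_middle_informative (crit_periodic f)) as [[p (P1 & P2 & P3)]|Hnp].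
    - destruct (admissible_box_exists k e lam C d F DF w HS Htop Z HZ BZ Z0 p) as (N & dl & del & HC).
      assert (dl4 : Rabs 0 < dl / 4) by (rewrite Rabs_R0; destruct HC as (? & ? & _); lra).
      assert (Hss : forall t, inD del t -> forall i, same_sign (c i) (coded_orbit lam (G t (root lam F w dl e0 t)) e0 i)).
      { apply (per_signs k e lam C d F DF w HS Z Z0 p N dl del HC e0 0 (fun i _ => eq_refl) dl4 Htop (fun i => eq_refl) p);
          auto.
        - change (c p = 0). rewrite cf. exact P2.
        - intros q Q1 Q2. change (c q <> 0). rewrite cf. auto.
        - intros q Q1 Q2 _. change (c q <> 0). rewrite cf. auto. }
      exists p, del, N, dl. split; [exact HC|]. split; [exact Hss|].
      apply (periodic_approximable k e lam C d F DF w HS Htop Z Z0 p N dl del HC p); auto.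
      + change (c p = 0). rewrite cf. exact P2.
      + intros q Q1 Q2. change (c q <> 0). rewrite cf. auto.
    - assert (Hc : forall i, (1 <= i)%nat -> c i <> 0).
      { intros i. induction i as [i IH] using (well_founded_induction lt_wf). intros Hi E. apply Hnp.
        exists i. split; [exact Hi|]. split; [rewrite <- cf; exact E|].
        intros q Q1 Q2. rewrite <- cf. auto. }
      destruct (Pow_x_infinity lam ltac:(rewrite Rabs_pos_eq; lra) 3) as [Q HQ].
      assert (HQ2 : 2 < lam ^ Q).
      { specialize (HQ Q (Nat.le_refl Q)). rewrite Rabs_pos_eq in HQ by (apply pow_le; lra). lra. }
      destruct (admissible_box_exists k e lam C d F DF w HS Htop Z HZ BZ Z0 Q) as (N & dl & del & HC).
      exists Q, del, N, dl. split; [exact HC|]. split.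
      + exact (aperiodic_signs k e lam C d F DF w HS Htop Z Z0 Q N dl del HC Hc HQ2).
      + exact (aperiodic_approximable k e lam C d F DF w HS Htop Z Z0 Q N dl del HC Hc HQ2). }
  destruct HG as (Q & del & N & dl & HC & Hss & HA).
  assert (dl4 : Rabs 0 < dl / 4) by (rewrite Rabs_R0; destruct HC as (? & ? & _); lra).
  assert (HX : forall i, coded_orbit lam (G 0 0) e0 i = c i).
  { exact (base_X k e lam C d F DF w HS Z Q N dl del HC e0 0 dl4 Htop (fun i => eq_refl)). }
  assert (HD0 : is_derive (root lam F w dl e0) 0 0).
  { apply (root_deriv_0 k e lam C d F DF w HS Z Z0 Q N dl del HC e0 0 (fun i _ => eq_refl) dl4 (HX 0%nat)) with U (/ lam * Nv / (1 - / lam)); auto.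
    - intros t i Ht. unfold e0 at 1. rewrite (same_sign_side _ _ (Hss t Ht i)). apply side_closed.
    - intros i. cbv beta. fold G. rewrite HX, Ev by apply cI. apply HU. }
  destruct (deformation k e lam C d F DF w HS Htop Z Z0 Q N dl del HC f v Ff HFv Hss HD0 _ HA)
    as (R1 & R2 & R3).
  exists del. split; [exact R1|]. split; [exact R2|]. exists (root lam F w dl e0). exact R3.
Qed.
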